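(* Let $t,k$ be integers with $3 \le t < k$, and let $m \ge 0$ be an integer. Write $m = q\binom{k-1}{2} + b$ with integers $q \ge 0$ and $0 \le b < \binom{k-1}{2}$. If $G$ is a graph with $m$ edges containing no cycle of length at least $k$, then $$k_t(G) \le k_t(qK_{k-1} \cup L_b).$$ Moreover, such a $G$ attains equality if and only if $G$ is isomorphic (after deleting isolated vertices) to some graph in $\mathcal{G}_{forest}(qK_{k-1}, L)$ for some $L \in \mathcal{C}_{t,k}(b)$.
   Context: $k_t(G)$ denotes the number of copies of $K_t$ in $G$; $qK_{k-1}\cup L_b$ is the vertex-disjoint union of $q$ copies of $K_{k-1}$ and $L_b$. Graphs are considered equivalent if they are isomorphic after deleting all isolated vertices. Colex order on finite subsets of $\mathbb{N}$: $A \prec B$ iff $\max((A\setminus B)\cup(B\setminus A)) \in B$. The colex graph $L_m$ has vertex set $\mathbb{N}$ and as edges the first $m$ two-element subsets in colex order; if $m = \binom{r}{2}+s$ with $0 \le s < r$, then (up to isolated vertices) $L_m$ is a clique $K_r$ together with one further vertex adjacent to exactly $s$ vertices of the clique. The family $\mathcal{C}_{t,k}(m)$: for $m=0$ it consists of the empty graph; for $0 < m \le \binom{k-1}{2}$, write $m = \binom{r}{2}+s$ with $0 \le s < r$; then (i) if $s \ge t-1$, $\mathcal{C}_{t,k}(m) = \{L_m\}$; (ii) if $r \ge t$ and $s < t-1$, $\mathcal{C}_{t,k}(m)$ consists of $L_m$ together with all $m$-edge graphs with no cycle of length at least $k$ that contain $K_r$ as a subgraph; (iii) if $r < t$, $\mathcal{C}_{t,k}(m)$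 consists of $L_m$ together with all $m$-edge graphs with no cycle of length at least $k$. For connected graphs $F_1,\dots,F_l$, $\mathcal{G}_{forest}(F_1,\dots,F_l)$ is the family of graphs $G$ such that: (1) $E(G)$ can be partitioned into sets $E_1,\dots,E_l$ with the graph $G(E_i)$ formed by the edges of $E_i$ isomorphic to $F_i$, and $|V(G(E_i))\cap V(G(E_j))| \le 1$ for $i\ne j$; (2) the auxiliary graph on $\{1,\dots,l\}$ with $ij$ an edge iff $G(E_i)$ and $G(E_j)$ share a vertex is a forest. ''$qK_{k-1}$'' in the argument list means $q$ blocks each equal to $K_{k-1}$. For possibly disconnected arguments, $\mathcal{G}_{forest}(F_1,\dots,F_l)$ is defined as $\mathcal{G}_{forest}$ of the list of all connected components of all the $F_i$.
   Formalization: In the definition of G_forest, the condition that the auxiliary graph on blocks be a forest is replaced by acyclicity of the block–vertex incidence graph; as literally stated the equality claim fails, e.g. for three triangles sharing one vertex (t=3, k=4, m=9). *)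

(* Defs.v *)
From mathcomp Require Import all_boot.

Set Implicit Arguments.
Unset Strict Implicit.
Unset Printing Implicit Defensive.

(* Finite simple graphs *)
Record sgraph := SGraph {
  vertex :> finType;
  adj : rel vertex;
  adj_sym : symmetric adj;
  adj_irrefl : irreflexive adj }.

Definition edges (G : sgraph) : {set {set G}} :=
  [set e : {set G} | [exists x, exists y, adj x y && (e == [set x; y])]].

Definition is_clique (G : sgraph) (K : {set G}) : bool :=
  [forall x in K, forall y in K, (x != y) ==> adj x y].

Definition num_cliques (t : nat) (G : sgraph) : nat :=
  #|[set K : {set G} | (#|K| == t) && is_clique K]|.

Definition contains_clique (r : nat) (G : sgraph) : Prop :=
  exists K : {set G}, #|K| = r /\ is_clique K.

(* The sequence lists the vertices of the cycle once each, so its size is the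
   length of the cycle. *)
Definition is_cycle (G : sgraph) (p : seq G) : bool :=
  [&& 2 < size p, uniq p & cycle (@adj G) p].

Definition no_cycle_ge (k : nat) (G : sgraph) : Prop :=
  forall p : seq G, is_cycle p -> size p < k.

Definition is_forest (G : sgraph) : Prop :=
  forall p : seq G, ~~ is_cycle p.

Section Induced.
Variables (G : sgraph) (C : {set G}).
Let V : finType := {x : G | x \in C}.
Definition induced_adj : rel V := fun x y => adj (val x) (val y).
Fact induced_sym : symmetric induced_adj.
Proof. by move=> x y; apply: adj_sym. Qed.
Fact induced_irrefl : irreflexive induced_adj.
Proof. by move=> x; apply: adj_irrefl. Qed.
Definition induced : sgraph := SGraph induced_sym induced_irrefl.
End Induced.

Definition isomorphic (G H : sgraph) : Prop :=
  exists2 f : G -> H, bijective f & forall x y, adj (f x) (f y) = adj x y.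

Definition non_isolated (G : sgraph) : {set G} :=
  [set x : G | [exists y, adj x y]].

(* Isomorphism after deleting isolated vertices *)
Definition equiv_graph (G H : sgraph) : Prop :=
  isomorphic (induced (non_isolated G)) (induced (non_isolated H)).

(* The connected components having at least one edge: isolated vertices are
   disregarded throughout. *)
Definition components (G : sgraph) : seq sgraph :=
  [seq induced C | C <- enum (equivalence_partition (connect (@adj G))
                                                    (non_isolated G))].

Section Complete.
Variable n : nat.
Definition complete_adj : rel 'I_n := fun x y => x != y.
Fact complete_sym : symmetric complete_adj.
Proof. by move=> x y; rewrite /complete_adj eq_sym. Qed.
Fact complete_irrefl : irreflexive complete_adj.
Proof. by move=> x; rewrite /complete_adj eqxx. Qed.
Definition complete : sgraph := SGraph complete_sym complete_irrefl.
End Complete.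

(* q vertex-disjoint copies of G *)
Section Copies.
Variables (q : nat) (G : sgraph).
Let V : finType := ('I_q * G)%type.
Definition copies_adj : rel V := fun u v => (u.1 == v.1) && adj u.2 v.2.
Fact copies_sym : symmetric copies_adj.
Proof. by move=> u v; rewrite /copies_adj eq_sym adj_sym. Qed.
Fact copies_irrefl : irreflexive copies_adj.
Proof. by move=> u; rewrite /copies_adj adj_irrefl andbF. Qed.
Definition copies : sgraph := SGraph copies_sym copies_irrefl.
End Copies.

Section DisjointUnion.
Variables G H : sgraph.
Let V : finType := (G + H)%type.
Definition union_adj : rel V := fun u v =>
  match u, v with
  | inl x, inl y => adj x y
  | inr x, inr y => adj x y
  | _, _ => false
  end.
Fact union_sym : symmetric union_adj.
Proof. by move=> [x|x] [y|y] //=; apply: adj_sym. Qed.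
Fact union_irrefl : irreflexive union_adj.
Proof. by move=> [x|x] /=; apply: adj_irrefl. Qed.
Definition disjoint_union : sgraph := SGraph union_sym union_irrefl.
End DisjointUnion.

(* A precedes B iff max (A symdiff B) belongs to B *)
Definition colex_lt (n : nat) (A B : {set 'I_n}) : bool :=
  [exists x in B :\: A, forall y in (A :\: B) :|: (B :\: A), y <= x].

(* The colex graph has vertex set nat, all but finitely many vertices being
   isolated; here it is cut down to {0, ..., m}. This loses no edge: the
   2-subsets of {0, ..., m} form an initial segment, of size at least m, of all
   2-subsets of nat in colex order. A pair is an edge iff fewer than m pairs
   precede it. *)
Section Colex.
Variable m : nat.
Definition colex_adj : rel 'I_m.+1 := fun x y =>
  (x != y) &&
  (#|[set A : {set 'I_m.+1} | (#|A| == 2) && colex_lt A [set x; y]]| < m).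
Fact colex_sym : symmetric colex_adj.
Proof. by move=> x y; rewrite /colex_adj eq_sym setUC. Qed.
Fact colex_irrefl : irreflexive colex_adj.
Proof. by move=> x; rewrite /colex_adj eqxx. Qed.
Definition colex_graph : sgraph := SGraph colex_sym colex_irrefl.
End Colex.

(* The family C_{t,k}(m), closed under equiv_graph; it is only populated for
   m <= 'C(k - 1, 2). The decomposition m = 'C(r, 2) + s with s < r is unique. *)
Inductive C_family (t k m : nat) (L : sgraph) : Prop :=
| C_empty of m = 0 & edges L = set0
| C_colex (r s : nat) of 0 < m <= 'C(k - 1, 2) & m = 'C(r, 2) + s & s < r &
    t - 1 <= s & equiv_graph L (colex_graph m)
| C_clique (r s : nat) of 0 < m <= 'C(k - 1, 2) & m = 'C(r, 2) + s & s < r &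
    t <= r & s < t - 1 &
    equiv_graph L (colex_graph m) \/
    [/\ #|edges L| = m, no_cycle_ge k L & contains_clique r L]
| C_small (r s : nat) of 0 < m <= 'C(k - 1, 2) & m = 'C(r, 2) + s & s < r &
    r < t &
    equiv_graph L (colex_graph m) \/ (#|edges L| = m /\ no_cycle_ge k L).

(* The graph G(E) formed by a set E of edges of G; its vertex set is cover E. *)
Section EdgeGraph.
Variables (G : sgraph) (E : {set {set G}}).
Let V : finType := {x : G | x \in cover E}.
Definition edge_adj : rel V := fun x y =>
  (x != y) && ([set val x; val y] \in E).
Fact edge_sym : symmetric edge_adj.
Proof. by move=> x y; rewrite /edge_adj eq_sym setUC. Qed.
Fact edge_irrefl : irreflexive edge_adj.
Proof. by move=> x; rewrite /edge_adj eqxx. Qed.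
Definition edge_graph : sgraph := SGraph edge_sym edge_irrefl.
End EdgeGraph.

(* Bipartite incidence graph of a family S of vertex sets: i is adjacent to the
   elements of S i. *)
Section Incidence.
Variables (I T : finType) (S : I -> {set T}).
Let V : finType := (I + T)%type.
Definition incidence_adj : rel V := fun u v =>
  match u, v with
  | inl i, inr x => x \in S i
  | inr x, inl i => x \in S i
  | _, _ => false
  end.
Fact incidence_sym : symmetric incidence_adj.
Proof. by move=> [i|x] [j|y]. Qed.
Fact incidence_irrefl : irreflexive incidence_adj.
Proof. by move=> [i|x]. Qed.
Definition incidence_graph : sgraph := SGraph incidence_sym incidence_irrefl.
End Incidence.

(* G_forest for a list of connected graphs. That the blocks E i are arranged in
   a forest is expressed by acyclicity of the block-vertex incidence graph. The
   intersection graph of the blocks (i ~ j iff E i and E j share a vertex) will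
   not do literally: three blocks through one common vertex are a tree-like
   arrangement, but they form a triangle in the intersection graph. When no
   vertex lies in three blocks, the two conditions are equivalent. *)
Definition forest_of_connected (Fs : seq sgraph) (G : sgraph) : Prop :=
  exists E : 'I_(size Fs) -> {set {set G}},
    [/\ \bigcup_i E i = edges G,
        forall i j, i != j -> [disjoint E i & E j],
        forall i, equiv_graph (edge_graph (E i)) (nth (complete 0) Fs i),
        forall i j, i != j -> #|cover (E i) :&: cover (E j)| <= 1 &
        is_forest (incidence_graph (fun i => cover (E i)))].

(* G_forest for a list of possibly disconnected graphs *)
Definition forest_family (Fs : seq sgraph) : sgraph -> Prop :=
  forest_of_connected (flatten [seq components F | F <- Fs]).

(* Main.v *)
(* Split the edge set into blocks. Every clique on at least two vertices lies in
   one block, so it suffices to bound the number of t-cliques of a block with m'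
   edges by f(m') = (m' / M) C(k-1, t) + k_t(L_(m' mod M)), where M = C(k-1, 2),
   and to note that f is superadditive, strictly so when two residues modulo M
   add up to at least M.

   A block with fewer than M edges is handled by the Kruskal-Katona theorem, and
   a block with at least M edges on fewer than k vertices is K_(k-1). A larger
   block has no equality case: by Kopylov's disintegration argument its vertices
   can be deleted one after the other, each having degree at most a when it is
   deleted, until nothing (with a = floor((k-1)/2)) or a set of k - a vertices is
   left (with 2 <= a <= (k-1)/2), which gives a bound below f.

   In the case of equality q blocks are copies of K_(k-1), and the disjoint union
   L of the others has b edges and k_t(L_b) cliques; the equality case of
   Kruskal-Katona places L in the family C. *)
Require Import Defs.
From mathcomp Require Import all_boot zify.

Set Implicit Arguments.
Unset Strict Implicit.
Unset Printing Implicit Defensive.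

(** * Binomial coefficients and the clique numbers of colex graphs *)

(** A peeled vertex of degree d <= a removes d edges and at most ['C(d, t - 1)] cliques, so a peeled
    edge costs at most ['C(a, t - 1) / a] cliques. The numerical problem is therefore to compare f
    with a line of this slope. Remainders modulo M may fall below the line, and one full K_(k-1),
    present because m' >= M, must have enough surplus to make up for it. Multiplying by a gives the
    potential [a * f(m') - m' * 'C(a, t - 1)] behind many of the inequalities. The comparison can be
    an equality (t = 3, k = 5, a = 2, m' = 8), and then strictness comes from the graph: the first
    vertex to bring edges brings no larger clique. The cycle condition enters through a lemma of
    Pósa: in a 2-connected graph, a path on at least k vertices whose ends together have at least k
    neighbours on it yields a cycle of length at least k. To have such paths at hand, edges are
    first added until all non-adjacent vertices are joined by a path on at least k vertices; dense
    parts then become cliques. The two disjoint paths that Pósa's lemma needs come from moving a fan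
    along the path, in place of Menger's theorem. *)

Lemma bin_convex x y z j :
  x <= y -> 'C(x + z, j) + 'C(y, j) <= 'C(x, j) + 'C(y + z, j).
Proof.
move=> le_xy; elim: z => [|z IHz]; first by rewrite !addn0.
case: j IHz => [|j] IHz; first by rewrite !bin0.
rewrite !addnS !binS.
by have := leq_bin2l j (leq_add le_xy (leqnn z)); lia.
Qed.

Lemma bin_convex_lt x y z j : x < y -> 0 < z -> 1 < j -> j <= y + z ->
  'C(x + z, j) + 'C(y, j) < 'C(x, j) + 'C(y + z, j).
Proof.
case: z => // z; case: j => [|[|j]] // lt_xy _ _ le_j.
rewrite !addnS !binS.
have := bin_convex z j.+2 (ltnW lt_xy).
suff: 'C(x + z, j.+1) < 'C(y + z, j.+1) by lia.
have [n en] : exists n, y + z = n.+1 by exists (y + z).-1; lia.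
rewrite en binS -[X in X < _]addn0 -addnS leq_add //.
  by apply: leq_bin2l; lia.
by rewrite bin_gt0; lia.
Qed.

Lemma bin_superadd x y j : 0 < j -> 'C(x, j) + 'C(y, j) <= 'C(x + y, j).
Proof. by move=> j0; have := @bin_convex 0 x y j isT; rewrite add0n bin0n; lia. Qed.

(** By the absorption identity [j * 'C(n, j) = n * 'C(n - 1, j - 1)], the ratio of ['C(n, j)] to n
    does not decrease with n. *)
Lemma bin_chord x y j : 0 < j -> x <= y -> y * 'C(x, j) <= x * 'C(y, j).
Proof.
case: j => // j _; case: x => [|x] le_xy; first by rewrite bin0n muln0.
case: y le_xy => // y le_xy.
rewrite -(leq_pmul2l (ltn0Sn j)) mulnCA -mul_bin_diag [leqRHS]mulnCA -mul_bin_diag /=.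
by rewrite mulnCA !leq_mul2l leq_bin2l ?orbT.
Qed.

Lemma bin2S r : 'C(r.+1, 2) = 'C(r, 2) + r.
Proof. by rewrite binS bin1. Qed.

(** The colex position reached after b edges. Rows start at r = 1, so that s < r holds for b = 0 as
    well. *)
Fixpoint rowcol b : nat * nat :=
  if b is b'.+1 then
    let: (r, s) := rowcol b' in if s.+1 < r then (r, s.+1) else (r.+1, 0)
  else (1, 0).

Lemma rowcolP b : b = 'C((rowcol b).1, 2) + (rowcol b).2 /\
                  (rowcol b).2 < (rowcol b).1.
Proof.
elim: b => //= b; case: (rowcol b) => r s [/= eb lt_sr].
by case: ltnP => le_rs; split=> //=; rewrite ?bin2S; lia.
Qed.

Lemma bin2_lt r s r' : s < r -> 'C(r, 2) + s < 'C(r', 2) -> r < r'.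
Proof.
move=> ? lt_; rewrite ltnNge; apply/negP=> /(leq_bin2l 2); lia.
Qed.

Lemma bin2_row_uniq r s r' s' : s < r -> s' < r' ->
  'C(r, 2) + s = 'C(r', 2) + s' -> r = r' /\ s = s'.
Proof.
move=> sr sr' e; suff re: r = r' by split=> //; rewrite re in e; lia.
case: (ltngtP r r') => // /(leq_bin2l 2); rewrite bin2S; lia.
Qed.

(* The number of t-cliques of the colex graph with b edges. *)
Definition kcolex t b :=
  'C((rowcol b).1, t) + 'C((rowcol b).2, t - 1).

(** The bound s <= r admits a completed row: there ['C(r, t) + 'C(r, t - 1) = 'C(r + 1, t)] agrees
    with the normal form (r + 1, 0), so filling up a row is no special case. *)
Lemma kcolexE t r s : 1 < t -> s <= r -> 0 < r ->
  kcolex t ('C(r, 2) + s) = 'C(r, t) + 'C(s, t - 1).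
Proof.
move=> t1; rewrite leq_eqVlt => /orP[/eqP->|lt_sr] r0; last first.
  rewrite /kcolex; have [e lt] := rowcolP ('C(r, 2) + s).
  by have [<- <-] := bin2_row_uniq lt_sr lt e.
have e0 : 'C(r, 2) + r = 'C(r.+1, 2) + 0 by rewrite bin2S addn0.
rewrite e0 /kcolex; have [e lt] := rowcolP ('C(r.+1, 2) + 0).
have [<- <-] := bin2_row_uniq (ltn0Sn r) lt e.
by case: t t1 => // t t1; rewrite binS subn1 /= bin0n; lia.
Qed.

Lemma kcolex_bin t r : 1 < t -> kcolex t 'C(r, 2) = 'C(r, t).
Proof.
case: r => [|r] t1.
  by rewrite bin0n /kcolex /= !bin0n; case: t t1 => [|[|[]]].
by rewrite -[X in kcolex _ X]addn0 kcolexE // bin0n; lia.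
Qed.

(** Names the row of the last edge, the form suited to taking edges away from the end. *)
Lemma rowcolS b : 0 < b ->
  exists r s, [/\ b = 'C(r, 2) + s, 0 < s, s <= r & 0 < r].
Proof.
case: b => // b _; have [e lt] := rowcolP b.
by exists (rowcol b).1, (rowcol b).2.+1; split; lia.
Qed.

(* Among all windows of z consecutive edges in colex order, the end of a row
   is the one that creates most cliques. *)
Lemma kcolex_window t b z r : 1 < t -> z <= b -> z <= r -> b <= 'C(r.+1, 2) ->
  kcolex t b + 'C(r - z, t - 1) <= kcolex t (b - z) + 'C(r, t - 1).
Proof.
move=> t1; have [n] := ubnP z; elim: n z b => // n IHn z b lt_zn zb zr br.
case: (posnP b) => [b0|/rowcolS [p [s [e s0 sp p0]]]].
  by have -> : z = 0 by [lia]; rewrite !subn0.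
have pr : p <= r.
  case: ltngtP => // /(leq_bin2l 2); lia.
case: (leqP z s) => zs.
  have -> : b - z = 'C(p, 2) + (s - z) by lia.
  rewrite e !kcolexE //; try lia.
  have := @bin_convex (s - z) (r - z) z (t - 1).
  rewrite !subnK; lia.
(* The window uses up the whole partial row of s edges, worth ['C(s, t - 1)]; its other z - s edges
   stop at the end of a row. Superadditivity of the binomial joins the two parts. *)
have := IHn (z - s) 'C(p, 2).
have -> : 'C(p, 2) - (z - s) = b - z by lia.
move/(_ ltac:(lia) ltac:(lia) ltac:(lia) ltac:(apply: leq_bin2l; lia)).
rewrite e !kcolexE // kcolex_bin //.
have := @bin_superadd s (r - z) (t - 1) ltac:(lia).
have -> : s + (r - z) = r - (z - s) by lia.
lia.
Qed.

(** The window stops before the end of row r, so each comparison is between a column s < r and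
    column r, where convexity is strict: [2 < t] makes the lower index t - 1 at least 2, and
    [t - 1 <= r] makes the end of row r contribute. *)
Lemma kcolex_window_lt t b z r : 2 < t -> z <= b -> z <= r -> b < 'C(r.+1, 2) ->
  0 < z -> t - 1 <= r ->
  kcolex t b + 'C(r - z, t - 1) < kcolex t (b - z) + 'C(r, t - 1).
Proof.
move=> t1; have [n] := ubnP z; elim: n z b => // n IHn z b lt_zn zb zr br z0 tr.
case: (posnP b) => [b0|/rowcolS [p [s [e s0 sp p0]]]]; first lia.
have pr : p <= r.
  case: ltngtP => // /(leq_bin2l 2); lia.
have sr : s < r.
  move: pr; rewrite leq_eqVlt => /orP[/eqP pr|]; last lia.
  by move: br; rewrite e pr bin2S; lia.
case: (leqP z s) => zs.
  have -> : b - z = 'C(p, 2) + (s - z) by lia.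
  rewrite e !kcolexE //; try lia.
  have := @bin_convex_lt (s - z) (r - z) z (t - 1).
  rewrite !subnK; lia.
have := IHn (z - s) 'C(p, 2).
have -> : 'C(p, 2) - (z - s) = b - z by lia.
have pr2 : 'C(p, 2) < 'C(r.+1, 2).
  by have := leq_bin2l 2 pr; rewrite [X in _ -> _ < X]bin2S; lia.
move/(_ ltac:(lia) ltac:(lia) ltac:(lia) pr2 ltac:(lia) tr).
rewrite e !kcolexE // ?kcolex_bin //; try lia.
have := @bin_superadd s (r - z) (t - 1) ltac:(lia).
have -> : s + (r - z) = r - (z - s) by lia.
lia.
Qed.

(** With y <= x, edges are moved from the end of y to complete the current row of x; by
    [kcolex_window] no cliques are lost. Once y fits into that row, the window consisting of all of
    y gives [kcolex t y <= 'C(y, t - 1)]. *)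
Lemma kcolex_superadd t x y : 1 < t ->
  kcolex t x + kcolex t y <= kcolex t (x + y).
Proof.
move=> t1; wlog le_yx: x y / y <= x.
  by move=> W; case: (leqP y x) => [/W//|/ltnW/W]; rewrite addnC [y + x]addnC.
have [n] := ubnP y; elim: n x y le_yx => // n IHn x y le_yx lt_yn.
have [e lt_sr] := rowcolP x; set r := (rowcol x).1 in e lt_sr.
set s := (rowcol x).2 in e lt_sr.
have yr : y <= 'C(r.+1, 2) by rewrite bin2S; lia.
have k0 : kcolex t 0 = 0 by rewrite -[X in kcolex _ X](bin0n 2) kcolex_bin // bin0n; lia.
case: (leqP y (r - s)) => ysr.
  rewrite {2}e -addnA kcolexE //; try lia.
  rewrite {1}e kcolexE //; try lia.
  have := @kcolex_window t y y y t1 (leqnn _) (leqnn _).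
  rewrite subnn k0.
  have -> : y <= 'C(y.+1, 2) by rewrite bin2S; lia.
  move/(_ isT); have := @bin_superadd s y (t - 1) ltac:(lia); rewrite bin0n; lia.
have := IHn (x + (r - s)) (y - (r - s)) ltac:(lia) ltac:(lia).
have -> : x + (r - s) + (y - (r - s)) = x + y by lia.
have := @kcolex_window t y (r - s) r t1 ltac:(lia) ltac:(lia) yr.
have -> : x + (r - s) = 'C(r, 2) + r by lia.
rewrite {2}e !kcolexE //; try lia.
have -> : r - (r - s) = s by lia.
lia.
Qed.

(** The same transfer as for superadditivity, continued until x has grown to ['C(K, 2)]. The last
    transfer completes row K - 1, while y stops before the end of that row, so it gains strictly. *)
Lemma kcolex_overflow t K x y : 2 < t <= K -> y <= x -> x < 'C(K, 2) ->
  'C(K, 2) <= x + y ->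
  kcolex t x + kcolex t y < 'C(K, t) + kcolex t (x + y - 'C(K, 2)).
Proof.
move=> /andP[t2 tK] yx xM Mxy.
have [n] := ubnP ('C(K, 2) - x); elim: n x y yx xM Mxy => // n IHn x y yx xM Mxy ltn.
have [e lt_sr] := rowcolP x; set r := (rowcol x).1 in e lt_sr.
set s := (rowcol x).2 in e lt_sr.
have rK : r < K by apply: (@bin2_lt r s); lia.
have M' : 'C(r.+1, 2) <= 'C(K, 2) by apply: leq_bin2l.
have M'' : 'C(r.+1, 2) = 'C(r, 2) + r by rewrite bin2S; lia.
have e1 : kcolex t x + 'C(r, t - 1) = kcolex t (x + (r - s)) + 'C(s, t - 1).
  have -> : x + (r - s) = 'C(r, 2) + r by lia.
  by rewrite {1}e !kcolexE //; lia.
have es : r - (r - s) = s by lia.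
move: M'; rewrite leq_eqVlt => /orP[/eqP M'|ltM].
  have := @kcolex_window_lt t y (r - s) r t2 ltac:(lia) ltac:(lia) ltac:(lia) ltac:(lia).
  have -> : t - 1 <= r.
    suff: K <= r.+1 by lia.
    rewrite leqNgt; apply/negP=> /(leq_bin2l 2).
    by rewrite bin2S -M'; lia.
  have -> : y - (r - s) = x + y - 'C(K, 2) by lia.
  move/(_ isT).
  rewrite es -(@kcolex_bin t K); last lia.
  have <- : x + (r - s) = 'C(K, 2) by lia.
  lia.
have := IHn (x + (r - s)) (y - (r - s)) ltac:(lia) ltac:(lia) ltac:(lia) ltac:(lia).
have -> : x + (r - s) + (y - (r - s)) = x + y by lia.
have := @kcolex_window t y (r - s) r ltac:(lia) ltac:(lia) ltac:(lia) ltac:(lia).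
rewrite es; lia.
Qed.

(** * Comparing clique numbers with a linear rate of cliques per edge *)

Lemma bin_chord_lt a n j : 0 < a -> a.*2 <= n -> 1 < j <= n ->
  n * 'C(a, j) < a * 'C(n, j).
Proof.
move=> a0 an /andP[j1 jn]; case: (leqP j a.*2) => ja.
  (* Strictness arises between a and 2a, from strict convexity; the chord inequality carries it from
     2a to n. *)
  have := @bin_chord a.*2 n j ltac:(lia) an.
  have := @bin_convex_lt 0 a a j a0 a0 j1 ltac:(lia).
  rewrite bin0n addnn -addnn add0n; nia.
by rewrite bin_small ?muln0 ?muln_gt0 ?a0 ?bin_gt0; lia.
Qed.

(** Each step from n to n + 1 adds [a * 'C(n, j - 1)], which for n >= a is at least
    [a * 'C(a - 1, j - 1) = j * 'C(a, j)]. *)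
Lemma bin_slope a h n j : 0 < j -> 0 < a -> a <= h -> h <= n ->
  (n - h) * 'C(a, j) + a * 'C(h, j) <= a * 'C(n, j).
Proof.
move=> j0 a0 ah; elim: n => [|n IHn]; first by rewrite leqn0 => /eqP ->.
rewrite leq_eqVlt => /orP[/eqP->|]; first by rewrite subnn.
rewrite ltnS => hn; have := IHn hn.
case: j j0 {IHn} => // j _; rewrite subSn // binS.
have := mul_bin_diag a j.
have := @leq_bin2l a.-1 n j ltac:(lia).
nia.
Qed.

(* With c = 'C(a, j), the map r |-> a * 'C(r, j.+1) - 'C(r, 2) * c decreases up
   to r = a and increases afterwards. *)
Lemma potential_decr a j r p : 0 < j -> r <= p -> p <= a ->
  a * 'C(p, j.+1) + 'C(r, 2) * 'C(a, j) <=
  a * 'C(r, j.+1) + 'C(p, 2) * 'C(a, j).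
Proof.
move=> j0; elim: p => [|p IHp]; first by rewrite leqn0 => /eqP ->.
rewrite leq_eqVlt => /orP[/eqP->|] //.
rewrite ltnS => rp pa; have := IHp rp (ltnW pa).
by have := @bin_chord p a j j0 (ltnW pa); rewrite bin2S binS; lia.
Qed.

Lemma potential_incr a j r p : 0 < j -> r <= p -> a <= r ->
  a * 'C(r, j.+1) + 'C(p, 2) * 'C(a, j) <=
  a * 'C(p, j.+1) + 'C(r, 2) * 'C(a, j).
Proof.
move=> j0 rp ar; elim: p rp => [|p IHp]; first by rewrite leqn0 => /eqP ->.
rewrite leq_eqVlt => /orP[/eqP->|] //.
rewrite ltnS => rp; have := IHp rp.
by have := @bin_chord a p j j0 (leq_trans ar rp); rewrite bin2S binS; lia.
Qed.

(** For the potential [a * kcolex (j + 1) b - b * 'C(a, j)], complete rows are worst at r = a. A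
    partial row costs at most [(a - 1) * 'C(a, j)] more, since from column a on the chord inequality
    makes its contribution nonnegative. *)
Lemma kcolex_lower a j b : 0 < j -> 0 < a ->
  b * 'C(a, j) + a * 'C(a, j.+1) <=
  a * kcolex j.+1 b + ('C(a, 2) + a.-1) * 'C(a, j).
Proof.
move=> j0 a0; have [e lt_sr] := rowcolP b.
rewrite /kcolex subn1 /=; set r := (rowcol b).1 in e lt_sr *.
set s := (rowcol b).2 in e lt_sr *; rewrite e.
have Pr : a * 'C(a, j.+1) + 'C(r, 2) * 'C(a, j) <=
          a * 'C(r, j.+1) + 'C(a, 2) * 'C(a, j).
  case: (leqP a r) => [ar|/ltnW ra]; first exact: potential_incr.
  exact: potential_decr.
suff : s * 'C(a, j) <= a * 'C(s, j) + a.-1 * 'C(a, j) by lia.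
case: (leqP a s) => [as_|sa]; first by have := bin_chord j0 as_; lia.
by apply: leq_trans (leq_addl _ _); rewrite leq_mul2r; lia.
Qed.

(** The potential falls and then rises along the rows, so on the range up to ['C(h, 2)] it is
    bounded by its value at one of the ends; the two alternatives are these ends, the value at 0
    being 0. *)
Lemma kcolex_upper a j h x : 0 < j -> 0 < a -> a <= h -> x <= 'C(h, 2) ->
  a * kcolex j.+1 x <= x * 'C(a, j) \/
  a * kcolex j.+1 x + 'C(h, 2) * 'C(a, j) <= a * 'C(h, j.+1) + x * 'C(a, j).
Proof.
move=> j0 a0 ah; have [e lt_sr] := rowcolP x.
rewrite /kcolex subn1 /=; set r := (rowcol x).1 in e lt_sr *.
set s := (rowcol x).2 in e lt_sr *; rewrite e => le_h.
case: (leqP s a) => sa.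
  have Hs := bin_chord j0 sa.
  case: (leqP r a) => ra.
    left; have := potential_decr j0 (leq0n r) ra.
    by rewrite !bin0n; lia.
  have rh : r <= h by rewrite leqNgt; apply/negP=> /(leq_bin2l 2); rewrite bin2S; lia.
  by right; have := potential_incr j0 rh (ltnW ra); lia.
have rh : r < h by rewrite ltnNge; apply/negP=> /(leq_bin2l 2); lia.
(* A partial row with s > a is completed to length r, which cannot lower the potential; the
   completed row still fits because r + 1 <= h. *)
have Hs := bin_slope j0 a0 (ltnW sa) (ltnW lt_sr).
right; have := potential_incr j0 rh (ltnW (ltn_trans (ltn_trans sa lt_sr) (leqnn _))).
rewrite bin2S binS; nia.
Qed.

(** The quotient of ['C(2a, j + 1)] by ['C(a, j)] does not decrease for 2 <= j <= a, because (a - j)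
    / (j + 1) <= (2a - j - 1) / (j + 2) for j < a. This reduces [bin_double] to j = 2. *)
Lemma bin_ratio a j : 1 < j ->
  'C(a.*2, 3) * 'C(a, j) <= 'C(a.*2, j.+1) * 'C(a, 2).
Proof.
elim: j => // j IHj; rewrite ltnS leq_eqVlt => /orP[/eqP<-//|j1].
have := IHj j1 => {}IHj.
rewrite -(@leq_pmul2l (j.+1 * j.+2)) //.
have e1 := mul_bin_left a j; have e2 := mul_bin_left a.*2 j.+1.
have -> : j.+1 * j.+2 * ('C(a.*2, 3) * 'C(a, j.+1)) =
    'C(a.*2, 3) * 'C(a, j) * (j.+2 * (a - j)).
  transitivity (j.+1 * 'C(a, j.+1) * (j.+2 * 'C(a.*2, 3))); first lia.
  by rewrite e1; lia.
have -> : j.+1 * j.+2 * ('C(a.*2, j.+2) * 'C(a, 2)) =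
    'C(a.*2, j.+1) * 'C(a, 2) * (j.+1 * (a.*2 - j.+1)).
  transitivity (j.+2 * 'C(a.*2, j.+2) * (j.+1 * 'C(a, 2))); first lia.
  by rewrite e2; lia.
apply: leq_mul => //.
case: (leqP a j) => ja; first by rewrite (eqP (_ : a - j == 0)) ?muln0 // subn_eq0.
have [u eu] : exists u, a = j + u.+1 by exists (a - j.+1); lia.
have -> : a - j = u.+1 by lia.
have -> : a.*2 - j.+1 = j + u.*2.+1 by lia.
nia.
Qed.

Lemma bin3E n : 6 * 'C(n, 3) = n * (n - 1) * (n - 2).
Proof.
have := mul_bin_left n 2; have := mul_bin_left n 1; rewrite bin1; nia.
Qed.

Lemma bin2E n : 2 * 'C(n, 2) = n * (n - 1).
Proof. have := mul_bin_left n 1; rewrite bin1; nia. Qed.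

Lemma bin_double a j : 1 < j -> 0 < a ->
  ('C(a.*2, 2) + 'C(a, 2) + a.-1) * 'C(a, j) <= a * 'C(a.*2, j.+1).
Proof.
move=> j1 a0; case: (ltnP 1 a) => a1; last first.
  by rewrite ['C(a, j)]bin_small ?muln0 //; lia.
have c0 : 0 < 'C(a, 2) by rewrite bin_gt0.
rewrite -(leq_pmul2l c0).
apply: (@leq_trans (a * ('C(a.*2, 3) * 'C(a, j)))); last first.
  by have := @bin_ratio a j j1; nia.
suff : ('C(a.*2, 2) + 'C(a, 2) + a.-1) * 'C(a, 2) <= a * 'C(a.*2, 3).
  by move=> /(leq_mul (leqnn 'C(a, j))); lia.
have := bin3E a.*2; have := bin2E a.*2; have := bin2E a.
have [u ->] : exists u, a = u.+2 by exists (a - 2); lia.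
have -> : u.+2.*2 - 1 = u.*2.+3 by lia.
have -> : u.+2.*2 - 2 = u.*2.+2 by lia.
have -> : u.+2 - 1 = u.+1 by lia.
move: 'C(_, 2) => A; move: 'C(_, 2) => B; move: 'C(_, 3) => D eA eB eD.
rewrite -(@leq_pmul2l 12) //.
have -> : 12 * ((B + A + u.+1) * A) = 3 * (2 * B + 2 * A + 2 * u.+1) * (2 * A).
  by lia.
have -> : 12 * (u.+2 * D) = 2 * u.+2 * (6 * D) by lia.
rewrite eA eB eD.
have -> : 3 * (u.+2.*2 * u.*2.+3 + u.+2 * u.+1 + 2 * u.+1) * (u.+2 * u.+1) =
  (15 * (u * u) + 57 * u + 48) * (u.+2 * u.+1) by lia.
have -> : 2 * u.+2 * (u.+2.*2 * u.*2.+3 * u.*2.+2) =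
  (16 * (u * u) + 56 * u + 48) * (u.+2 * u.+1) by lia.
(* The two quadratic factors differ by u * u - u, which is nonnegative for integers and vanishes for
   a = 2 and a = 3. *)
by apply: leq_mul => //; nia.
Qed.

(** One full clique has enough surplus over the rate of ['C(a, j)] cliques per a edges to pay for
    the largest deficit that [kcolex_lower] allows a remainder. The case K = 2a is [bin_double];
    beyond it the potential grows. *)
Lemma kn_bound a K j : 1 < j -> 0 < a -> a.*2 <= K ->
  ('C(K, 2) + 'C(a, 2) + a.-1) * 'C(a, j) <= a * 'C(K, j.+1).
Proof.
move=> j1 a0 aK; have := bin_double j1 a0.
have := @potential_incr a j a.*2 K ltac:(lia) aK ltac:(lia); nia.
Qed.

Lemma kn_bound_lt a K j : 1 < j -> 0 < a -> a.*2 < K -> j < K ->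
  ('C(K, 2) + 'C(a, 2) + a.-1) * 'C(a, j) < a * 'C(K, j.+1).
Proof.
case: K => // K j1 a0; rewrite !ltnS => aK jK.
have := kn_bound j1 a0 aK; rewrite bin2S binS.
have := @bin_chord_lt a K j a0 aK; rewrite j1 jK => /(_ isT); nia.
Qed.

(** Induction on K from 2a, with K - a + 1 growing along: [bin_slope] over a - 1 steps shows that
    the right-hand side grows at least as fast. For K = k - 1 the number K - a + 1 is k - a, the
    order of the core left by Kopylov's argument. *)
Lemma kn_core_bound a K j : 1 < j -> 1 < a -> a.*2 <= K -> j < K ->
  a * 'C(K - a.-1, j.+1) + ('C(K, 2) + 'C(a, 2) + a.-1) * 'C(a, j) <
  a * 'C(K, j.+1) + a * 'C(a, j.+1) + 'C(K - a.-1, 2) * 'C(a, j).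
Proof.
move=> j1 a1 aK jK; case: (leqP j a) => ja; last first.
  rewrite ['C(a, j)]bin_small // !muln0 !addn0.
  suff : 'C(K - a.-1, j.+1) < 'C(K, j.+1) by nia.
  case: K jK {aK} => // K jK; rewrite binS.
  have := @leq_bin2l (K.+1 - a.-1) K j.+1 ltac:(lia).
  have : 0 < 'C(K, j) by rewrite bin_gt0.
  lia.
have c0 : 0 < 'C(a, j) by rewrite bin_gt0.
elim: K aK {jK} => [|K IHK]; first lia.
rewrite leq_eqVlt => /orP[/eqP eK|].
  rewrite -eK.
  have -> : a.*2 - a.-1 = a.+1 by lia.
  have := @bin_double a j j1 (ltnW a1).
  have c2 : 0 < 'C(a, 2) by rewrite bin_gt0.
  rewrite [X in _ * X + _ < _]binS [X in _ < _ + X * _]bin2S; nia.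
rewrite ltnS => aK; have := IHK aK.
have -> : K.+1 - a.-1 = (K - a.-1).+1 by lia.
rewrite !bin2S ['C(K.+1, j.+1)]binS ['C((K - a.-1).+1, j.+1)]binS.
have := @bin_slope a (K - a.-1) K j ltac:(lia) ltac:(lia) ltac:(lia) ltac:(lia).
have -> : K - (K - a.-1) = a.-1 by lia.
have : K = (K - a.-1) + a.-1 by lia.
nia.
Qed.

(* The number of t-cliques of the extremal graph with m edges, where K = k - 1. *)
Definition kextr t K m :=
  m %/ 'C(K, 2) * 'C(K, t) + kcolex t (m %% 'C(K, 2)).

Lemma kextr_small t K m : m < 'C(K, 2) -> kextr t K m = kcolex t m.
Proof. by move=> lt_m; rewrite /kextr divn_small // modn_small. Qed.

Lemma kextr_full t K : 1 < t <= K -> kextr t K 'C(K, 2) = 'C(K, t).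
Proof.
move=> /andP[t1 tK]; have M0 : 0 < 'C(K, 2) by rewrite bin_gt0; lia.
rewrite /kextr divnn M0 mul1n modnn -[X in kcolex _ X](bin0n 2) kcolex_bin //.
by rewrite bin0n; lia.
Qed.

(** Without a carry this is superadditivity of [kcolex]; with a carry, [kcolex_overflow] trades the
    two residues for a full clique. The boolean, read as 0 or 1, expresses the strictness of the
    second case. *)
Lemma kextr_superadd t K x y : 2 < t <= K ->
  kextr t K x + kextr t K y + ('C(K, 2) <= x %% 'C(K, 2) + y %% 'C(K, 2))
    <= kextr t K (x + y).
Proof.
move=> tK; set M := 'C(K, 2).
have M0 : 0 < M by rewrite bin_gt0; lia.
rewrite /kextr -/M divnD // modnD //.
have /(_ ltac:(lia)) := @kcolex_superadd t (x %% M) (y %% M).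
have xM := ltn_pmod x M0; have yM := ltn_pmod y M0.
case: (leqP M (x %% M + y %% M)) => Mxy H; last first.
  by rewrite ?mul0n ?addn0 ?subn0; lia.
suff : kcolex t (x %% M) + kcolex t (y %% M) <
       'C(K, t) + kcolex t (x %% M + y %% M - M) by rewrite ?mul1n; lia.
case: (leqP (y %% M) (x %% M)) => [le|/ltnW le].
  exact: kcolex_overflow.
by rewrite addnC [_ %% M + _ %% M]addnC; apply: kcolex_overflow => //; rewrite addnC.
Qed.

(** The second part drives the characterisation of equality: residues adding up without a carry fix
    how many edges lie outside the full blocks. *)
Lemma kextr_sum t K (I : Type) (r : seq I) (m : I -> nat) : 2 < t <= K ->
  \sum_(i <- r) kextr t K (m i) <= kextr t K (\sum_(i <- r) m i) /\
  (\sum_(i <- r) kextr t K (m i) = kextr t K (\sum_(i <- r) m i) ->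
   \sum_(i <- r) m i %% 'C(K, 2) = (\sum_(i <- r) m i) %% 'C(K, 2)).
Proof.
move=> tK; elim: r => [|i r [IHle IHeq]]; rewrite ?big_nil ?big_cons.
  by rewrite mod0n.
have := kextr_superadd (m i) (\sum_(j <- r) m j) tK.
case: (leqP 'C(K, 2) (m i %% _ + _)) => [_|lt] le; split=> [|e]; try lia.
rewrite IHeq; last by lia.
by rewrite -modnDm [in RHS]modn_small.
Qed.

Lemma kextr_lower a K j m : 1 < j -> 0 < a -> a.*2 <= K -> 'C(K, 2) <= m ->
  m * 'C(a, j) + a * 'C(K, j.+1) + a * 'C(a, j.+1) <=
  a * kextr j.+1 K m + ('C(K, 2) + 'C(a, 2) + a.-1) * 'C(a, j).
Proof.
move=> j1 a0 aK Mm; have := kn_bound j1 a0 aK.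
have M0 : 0 < 'C(K, 2) by rewrite bin_gt0; lia.
have := @kcolex_lower a j (m %% 'C(K, 2)) ltac:(lia) a0.
have q0 : 0 < m %/ 'C(K, 2) by rewrite divn_gt0.
have := divn_eq m 'C(K, 2); rewrite /kextr.
move: (m %/ _) (m %% _) q0 => [//|q] b _ -> lower bound.
(* Here q counts the full cliques beyond the first. Each of them meets the rate, while the surplus
   of the first stays explicit in the statement. *)
have : q * ('C(K, 2) * 'C(a, j)) <= q * (a * 'C(K, j.+1)) by apply: leq_mul; lia.
lia.
Qed.

Lemma kextr_degenerate a K j m : 1 < j -> 0 < a -> a.*2 <= K -> 'C(K, 2) <= m ->
  m * 'C(a, j) <= a * kextr j.+1 K m.
Proof.
move=> j1 a0 aK Mm; have := kextr_lower j1 a0 aK Mm.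
have := kn_bound j1 a0 aK; lia.
Qed.

(** Here x stands for the number of edges inside the core, whose cliques Kruskal-Katona bounds; the
    other m - x edges are paid for at the peeling rate. *)
Lemma kextr_core a K j m x : 1 < j < K -> 1 < a -> a.*2 < K ->
  x <= 'C(K - a.-1, 2) -> x <= m -> 'C(K, 2) <= m ->
  a * kcolex j.+1 x + (m - x) * 'C(a, j) < a * kextr j.+1 K m.
Proof.
move=> /andP[j1 jK] a1 aK xh xm Mm; have := kextr_lower j1 (ltnW a1) (ltnW aK) Mm.
have := kn_bound_lt j1 (ltnW a1) aK jK.
have := kn_core_bound j1 a1 (ltnW aK) jK.
have [] := @kcolex_upper a j (K - a.-1) x ltac:(lia) ltac:(lia) ltac:(lia) xh; nia.
Qed.

(** * Cliques and the Kruskal-Katona theorem *)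

Definition nbrs (G : sgraph) (v : G) : {set G} := [set u | adj v u].

(** Cliques are counted inside a vertex set of a fixed graph, so that the inductions can delete
    vertices without changing the type. *)
Definition cliques (G : sgraph) (U : {set G}) t : {set {set G}} :=
  [set K : {set G} | [&& K \subset U, #|K| == t & is_clique K]].

Definition ncl (G : sgraph) (U : {set G}) t := #|cliques U t|.

Section Cliques.
Variable G : sgraph.
Implicit Types (U W K : {set G}) (u v x y : G).

Lemma in_nbrs u v : (u \in nbrs v) = adj v u.
Proof. by rewrite inE. Qed.

Lemma cliqueP K :
  reflect {in K &, forall x y, x != y -> adj x y} (is_clique K).
Proof.
apply: (iffP forall_inP) => [H x y xK yK xy|H x xK].
  by move/forall_inP: (H x xK) => /(_ y yK)/implyP; apply.
by apply/forall_inP => y yK; apply/implyP; apply: H.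
Qed.

Lemma sub_clique K W : K \subset W -> is_clique W -> is_clique K.
Proof. by move=> /subsetP s /cliqueP H; apply/cliqueP=> x y /s + /s; apply: H. Qed.

Lemma cliqueU1 v K : K \subset nbrs v -> is_clique K -> is_clique (v |: K).
Proof.
move=> /subsetP s /cliqueP H; apply/cliqueP=> x y.
rewrite !inE => /orP[/eqP->|xK] /orP[/eqP->|yK]; rewrite ?eqxx //.
- by move: (s y yK); rewrite inE.
- by move: (s x xK); rewrite inE adj_sym.
- exact: H.
Qed.

Lemma ncl_mono U W t : U \subset W -> ncl U t <= ncl W t.
Proof.
move=> s; apply: subset_leq_card; apply/subsetP=> K; rewrite !inE.
by case/and3P=> KU -> ->; rewrite (subset_trans KU).
Qed.

Lemma ncl_le_bin U t : ncl U t <= 'C(#|U|, t).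
Proof.
rewrite -cards_draws; apply: subset_leq_card; apply/subsetP=> K.
by rewrite !inE => /and3P[-> ->].
Qed.

Lemma ncl_clique K t : is_clique K -> ncl K t = 'C(#|K|, t).
Proof.
move=> cK; rewrite -cards_draws; apply: eq_card => A; rewrite !inE.
by case: (boolP (A \subset K)) => //= /sub_clique/(_ cK) ->; rewrite andbT.
Qed.

Lemma ncl1 U : ncl U 1 = #|U|.
Proof.
rewrite -[RHS]bin1 -cards_draws; apply: eq_card => A; rewrite !inE.
case: (boolP (A \subset U)) => //= _; case: (boolP (#|A| == 1)) => //=.
move/cards1P=> [x ->]; apply/cliqueP => y z /set1P-> /set1P->.
by rewrite eqxx.
Qed.

Lemma ncl_del v U t : v \in U ->
  ncl U t.+1 = ncl (U :\ v) t.+1 + ncl (nbrs v :&: U) t.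
Proof.
move=> vU; rewrite /ncl -(cardsID [set K : {set G} | v \in K]) addnC; congr (_ + _).
  apply: eq_card => K; rewrite !inE subsetD1.
  by case: (v \in K); rewrite ?andbF ?andbT.
have inj : {in cliques (nbrs v :&: U) t &, injective (fun K => v |: K)}.
  move=> K L; rewrite !inE !subsetI.
  move=> /andP[/andP[/subsetP K1 _] _] /andP[/andP[/subsetP L1 _] _] e.
  have vK : v \notin K by apply/negP=> /K1; rewrite inE adj_irrefl.
  have vL : v \notin L by apply/negP=> /L1; rewrite inE adj_irrefl.
  by rewrite -(setU1K vK) e setU1K.
rewrite -(card_in_imset inj); apply: eq_card => K; apply/idP/imsetP.
  rewrite !inE => /andP[/and3P[KU cK /cliqueP qK] vK].
  exists (K :\ v); last by rewrite setD1K.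
  rewrite !inE subsetI; apply/and3P; split.
  - apply/andP; split; last by rewrite (subset_trans _ KU) // subsetDl.
    by apply/subsetP=> u; rewrite !inE => /andP[uv uK]; rewrite qK // eq_sym.
  - by move: cK; rewrite (cardsD1 v K) vK.
  - apply/cliqueP=> x y; rewrite !inE => /andP[_ xK] /andP[_ yK]; exact: qK.
move=> [L + ->]; rewrite !inE subsetI eqxx /= andbT => /and3P[/andP[Lv LU] /eqP cL qL].
have vL : v \notin L by apply/negP=> /(subsetP Lv); rewrite inE adj_irrefl.
by rewrite subUset sub1set vU LU cardsU1 vL cL add1n eqxx cliqueU1.
Qed.

(** A missing edge xy confines the neighbours of x in U to #|U| - 2 vertices, and Pascal's rule then
    shows a loss. *)
Lemma ncl_full U t : 1 < t <= #|U| -> ncl U t = 'C(#|U|, t) -> is_clique U.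
Proof.
case: t => [|[|t]] // tU e; apply/cliqueP=> x y xU yU xy; apply: contraT => nxy.
move: e; rewrite (ncl_del _ xU).
have cU : #|U| = #|U :\ x|.+1 by rewrite (cardsD1 x U) xU.
have sub : nbrs x :&: U \subset U :\ x :\ y.
  apply/subsetP=> z; rewrite !inE => /andP[xz ->]; rewrite andbT.
  by apply/andP; split; apply: contraTneq xz => ->; rewrite ?adj_irrefl.
have := subset_leq_card sub.
have cU' : #|U :\ x| = #|U :\ x :\ y|.+1.
  by rewrite (cardsD1 y (U :\ x)) !inE eq_sym xy yU.
have := ncl_le_bin (U :\ x) t.+2; have := ncl_le_bin (nbrs x :&: U) t.+1.
rewrite cU binS cU'; move: tU; rewrite cU cU' !ltnS.
move=> tU H1 H2 /(leq_bin2l t.+1); rewrite [in X in _ = _ + X -> _]binS.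
have : 0 < 'C(#|U :\ x :\ y|, t) by rewrite bin_gt0.
lia.
Qed.

Lemma sum_deg U : \sum_(v in U) #|nbrs v :&: U| = 2 * ncl U 2.
Proof.
have [n] := ubnP #|U|; elim: n U => // n IHn U lt_n.
have [->|[v vU]] := set_0Vmem U.
  rewrite big_set0 /ncl; suff -> : cliques set0 2 = set0 :> {set {set G}} by rewrite
    cards0.
  apply/setP=> K; rewrite !inE subset0; apply/negP=> /and3P[/eqP->].
  by rewrite cards0.
have cU : #|U| = #|U :\ v|.+1 by rewrite (cardsD1 v U) vU.
rewrite (bigD1 v) //= (ncl_del _ vU) ncl1 mulnDr -IHn; last by lia.
have -> : \sum_(i in U | i != v) #|nbrs i :&: U| =
          \sum_(i in U :\ v) (#|nbrs i :&: (U :\ v)| + adj v i).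
  apply: eq_big => [i|i]; rewrite ?inE 1?andbC // => /andP[iU iv].
  rewrite (cardsD1 v (nbrs i :&: U)) !inE vU andbT adj_sym addnC; congr (_ + _).
  by apply: eq_card => z; rewrite !inE; do !bool_congr.
rewrite big_split /=.
suff -> : \sum_(i in U :\ v) adj v i = #|nbrs v :&: U| by lia.
rewrite -sum1_card big_mkcond [RHS]big_mkcond /=; apply: eq_bigr => i _.
rewrite !inE; case: (eqVneq i v) => [->|_] /=; first by rewrite adj_irrefl.
by case: (i \in U); case: (adj v i).
Qed.


End Cliques.

(** The induction step of Kruskal-Katona in numbers, d being the degree of the deleted vertex. For d
    <= s the edges come off the partial row; otherwise the count drops into row r - 1 and convexity
    applies. *)
Lemma kcolex_remove t r s d : 2 < t -> s < r -> d < r ->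
  kcolex t ('C(r, 2) + s - d) + 'C(d, t - 1) <= 'C(r, t) + 'C(s, t - 1).
Proof.
move=> t2 sr dr; case: (leqP d s) => ds.
  rewrite -addnBA // kcolexE; try lia.
  by have := @bin_superadd (s - d) d (t - 1) ltac:(lia); rewrite subnK //; lia.
case: r sr dr => // r sr dr.
have -> : 'C(r.+1, 2) + s - d = 'C(r, 2) + (r + s - d) by rewrite bin2S; lia.
rewrite kcolexE; try lia.
have := @bin_convex s d (r - d) (t - 1) (ltnW ds).
have -> : s + (r - d) = r + s - d by lia.
have -> : d + (r - d) = r by lia.
by case: t t2 => // t _; rewrite binS subn1 /=; lia.
Qed.

(** Strict convexity leaves two degrees: that of the additional vertex of the colex graph, and that
    of a clique vertex not joined to it. *)
Lemma kcolex_remove_eq t r s d : 2 < t -> s < r -> 0 < d < r -> t <= r ->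
  'C(r, t) + 'C(s, t - 1) <= kcolex t ('C(r, 2) + s - d) + 'C(d, t - 1) ->
  if d <= s then t - 1 <= s -> d = s else d = r.-1.
Proof.
move=> t2 sr /andP[d0 dr] tr; case: (leqP d s) => ds.
  rewrite -addnBA // kcolexE; try lia.
  move=> H ts; apply/eqP; rewrite eqn_leq ds leqNgt; apply/negP=> lt.
  have := @bin_convex_lt 0 d (s - d) (t - 1) d0 ltac:(lia) ltac:(lia) ltac:(lia).
  by rewrite add0n subnKC // bin0n; lia.
case: r sr dr tr => // r sr dr tr.
have -> : 'C(r.+1, 2) + s - d = 'C(r, 2) + (r + s - d) by rewrite bin2S; lia.
rewrite kcolexE; try lia.
move=> H; apply/eqP; rewrite eqn_leq -ltnS dr /= leqNgt; apply/negP=> lt.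
have := @bin_convex_lt s d (r - d) (t - 1) ds ltac:(lia) ltac:(lia) ltac:(lia).
have -> : s + (r - d) = r + s - d by lia.
have -> : d + (r - d) = r by lia.
by move: H; case: t t2 {tr} => // t _; rewrite binS subn1 /=; lia.
Qed.

Section KruskalKatona.
Variable G : sgraph.
Implicit Types (U W K : {set G}) (u v x y : G).

(** If all degrees were at least r, the r + 1 or more vertices would span at least ['C(r, 2) + r]
    edges, too many as s < r. *)
Lemma small_deg U r s : s < r -> ncl U 2 = 'C(r, 2) + s -> r < #|U| ->
  exists2 v, v \in U & #|nbrs v :&: U| < r /\
    {in U, forall u, #|nbrs v :&: U| <= #|nbrs u :&: U|}.
Proof.
move=> sr eU rU; have [x xU] : exists x, x \in U by apply/card_gt0P; lia.
case: (arg_minnP (fun v => #|nbrs v :&: U|) xU) => v vU vmin.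
exists v => //; split=> //.
have : #|U| * #|nbrs v :&: U| <= 2 * ncl U 2.
  by rewrite -sum_deg -sum_nat_const; apply: leq_sum => u; apply: vmin.
by rewrite eU mulnDr bin2E; nia.
Qed.

Lemma kruskal_katona U t : 2 < t -> ncl U t <= kcolex t (ncl U 2).
Proof.
case: t => // t t2; have [n] := ubnP #|U|; elim: n U => // n IHn U lt_n.
have [e sr] := rowcolP (ncl U 2); move: (rowcol _).1 (rowcol _).2 e sr => r s e sr.
have r0 : 0 < r by lia.
rewrite e kcolexE //; try lia.
case: (leqP #|U| r) => [Ur|rU].
  apply: leq_trans (ncl_le_bin _ _) _.
  by apply: leq_trans (leq_bin2l _ Ur) (leq_addr _ _).
have [v vU [vr _]] := small_deg sr e rU.
have := IHn (U :\ v); rewrite [#|U|](cardsD1 v) vU in lt_n.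
move/(_ ltac:(lia)); rewrite (ncl_del _ vU).
have := ncl_del 1 vU; rewrite ncl1 e.
have := ncl_le_bin (nbrs v :&: U) t.
have := kcolex_remove t2 sr vr; rewrite subn1 /=; move: (ncl (U :\ v) 2) => e' H1 H2 H3.
by have -> : e' = 'C(r, 2) + s - #|nbrs v :&: U| by [lia]; lia.
Qed.

Lemma kruskal_katona_eq U t r s : 2 < t <= r -> s < r ->
  ncl U 2 = 'C(r, 2) + s -> 'C(r, t) + 'C(s, t - 1) <= ncl U t ->
  exists K, [/\ K \subset U, #|K| = r, is_clique K &
    t - 1 <= s -> exists2 v, v \in U :\: K & #|nbrs v :&: K| = s].
Proof.
case: t => [|t] //; rewrite ltnS => /andP[t2 tr] sr; rewrite subn1 /=.
have [n] := ubnP #|U|; elim: n U s sr => // n IHn U s sr lt_n e le.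
case: (leqP #|U| r) => [Ur|rU].
  have := leq_trans (leq_addr _ _) le => H.
  have eUr : #|U| = r.
    apply/eqP; rewrite eqn_leq Ur /= leqNgt; apply/negP=> lt.
    have := leq_trans H (ncl_le_bin U t.+1).
    have /(leq_bin2l t.+1) : #|U| <= r.-1 by lia.
    have := binS r.-1 t; rewrite prednK ?(leq_trans _ tr) //.
    have : 0 < 'C(r.-1, t) by rewrite bin_gt0; lia.
    by lia.
  have eU2 : ncl U 2 = 'C(#|U|, 2) by have := ncl_le_bin U 2; rewrite eUr e; lia.
  exists U; split=> //; first by apply: ncl_full eU2; lia.
  by move: eU2; rewrite eUr e; lia.
have [v vU [vr vmin]] := small_deg sr e rU.
have ltU : #|U :\ v| < n by move: lt_n; rewrite [#|U|](cardsD1 v) vU.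
have e2 := ncl_del 1 vU; rewrite ncl1 in e2.
have et := ncl_del t vU.
set N := nbrs v :&: U in vr vmin e2 et.
have NU : N \subset U :\ v.
  by apply/subsetP=> u; rewrite !inE => /andP[uv ->]; rewrite andbT; apply: contraTneq
    uv => ->; rewrite adj_irrefl.
have leN := ncl_le_bin N t.
have t2' : 2 < t.+1 by [].
have leU := kruskal_katona (U :\ v) t2'.
have eU' : ncl (U :\ v) 2 = 'C(r, 2) + s - #|N| by lia.
rewrite eU' in leU.
have rem := kcolex_remove t2' sr vr; rewrite subn1 /= in rem.
case: (posnP #|N|) => [N0|N0].
  have := IHn (U :\ v) s sr ltU; rewrite eU' N0 subn0 => /(_ erefl).
  have -> : ncl (U :\ v) t.+1 = ncl U t.+1.
    by rewrite et (_ : ncl N t = 0) ?addn0 //; move: leN; rewrite N0 bin0n; lia.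
  move=> /(_ le)[K [KU cK qK H]]; exists K; split=> //.
    by rewrite (subset_trans KU) ?subsetDl.
  move=> /H[w]; rewrite inE => /andP[wK wU] ew; exists w => //.
  by rewrite inE wK (subsetP (subsetDl _ _) _ wU).
have := @kcolex_remove_eq t.+1 r s #|N| t2' sr; rewrite N0 vr tr subn1 /=.
move=> /(_ isT isT); have -> : 'C(r, t.+1) + 'C(s, t) <=
  kcolex t.+1 ('C(r, 2) + s - #|N|) + 'C(#|N|, t) by lia.
move=> /(_ isT).
case: (leqP #|N| s) => [Ns sN|sN eN].
  have eU'2 : ncl (U :\ v) 2 = 'C(r, 2) + (s - #|N|) by rewrite eU' addnBA.
  case: (leqP t s) => [ts|st].
    have eN := sN ts.
    have eCs : 'C(s - #|N|, t) = 0 by rewrite eN subnn bin0n; lia.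
    have eCN : 'C(#|N|, t) = 'C(s, t) by rewrite eN.
    have [K [KU cK qK _]] := IHn (U :\ v) (s - #|N|) ltac:(lia) ltU eU'2 ltac:(lia).
    exists K; split=> //; first by rewrite (subset_trans KU) ?subsetDl.
    move=> _; exists v.
      by rewrite inE vU andbT; apply/negP=> /(subsetP KU); rewrite !inE eqxx.
    suff -> : nbrs v :&: K = N by [].
    have qN : is_clique N.
      apply: (@ncl_full _ _ t); first lia.
      by lia.
    have cKU : cliques K 2 = cliques (U :\ v) 2.
      apply/eqP; rewrite eqEcard; apply/andP; split.
        by apply/subsetP=> A; rewrite !inE => /and3P[AK -> ->]; rewrite (subset_trans AK).
      by rewrite -!/(ncl _ _) (ncl_clique _ qK) cK eU'2 eN subnn addn0.
    apply/setP=> u; rewrite inE [RHS]inE; case: (boolP (u \in nbrs v)) => //= uv.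
    apply/idP/idP => [/(subsetP KU)|uU]; first by rewrite !inE => /andP[].
    have uN : u \in N by rewrite inE uv.
    have [w wN wu] : exists2 w, w \in N & w != u.
      have : 0 < #|N :\ u| by move: (cardsD1 u N); rewrite uN; lia.
      by move=> /card_gt0P[w /setD1P[wu wN]]; exists w.
    have : [set u; w] \in cliques (U :\ v) 2.
      rewrite inE cards2 (eq_sym u) wu eqxx /= subUset !sub1set !(subsetP NU) //=.
      by apply: sub_clique qN; rewrite subUset !sub1set uN.
    by rewrite -cKU inE subUset sub1set => /andP[/andP[]].
  (* For s < t the binomials of all partial rows vanish, and only the clique is claimed. *)
  have [K [KU cK qK _]] := IHn (U :\ v) (s - #|N|) ltac:(lia) ltU eU'2 ltac:(have :=
    bin_small st; have := @bin_small (s - #|N|) t ltac:(lia); have := @bin_small #|N| t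
      ltac:(lia); lia).
  by exists K; split=> //; rewrite (subset_trans KU) ?subsetDl.
have qN : is_clique N.
  apply: (@ncl_full _ _ t); first lia.
  have := leN; have := rem; lia.
exists (v |: N); split.
- by rewrite subUset sub1set vU (subset_trans NU) ?subsetDl.
- by rewrite cardsU1 !inE adj_irrefl eN /=; lia.
- by apply: cliqueU1 => //; apply: subsetIl.
have cvN : #|v |: N| = r by rewrite cardsU1 !inE adj_irrefl eN /=; lia.
(* This case is contradictory: by the choice of v, a vertex w outside the clique has degree at least
   r - 1 > s, but the clique leaves only s edges for it. *)
have [w wU wN] : exists2 w, w \in U & w \notin v |: N.
  apply/subsetPn; apply/negP=> /subset_leq_card; lia.
have := ncl_del 1 wU; rewrite ncl1 e.
have : ncl (v |: N) 2 <= ncl (U :\ w) 2.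
  apply: ncl_mono; rewrite subsetD1 wN andbT.
  by rewrite subUset sub1set vU (subset_trans NU) ?subsetDl.
rewrite (@ncl_clique _ (v |: N)) ?cvN; last first.
  by apply: cliqueU1 => //; apply: subsetIl.
by have := vmin w wU; lia.
Qed.

End KruskalKatona.

(** * Long cycles in 2-connected graphs *)

Lemma path_sym_rev (T : eqType) (e : rel T) x p : symmetric e ->
  path e (last x p) (rev (belast x p)) = path e x p.
Proof. by move=> se; rewrite rev_path; apply: eq_path => y z; rewrite se. Qed.

Lemma rev_rcons_path (T : eqType) (e : rel T) x p y : symmetric e ->
  path e x (rcons p y) -> path e y (rcons (rev p) x).
Proof.
move=> se; rewrite -(path_sym_rev _ _ se) last_rcons belast_rcons rev_cons //.
Qed.

Lemma path_suffix (T : eqType) (e : rel T) x p u :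
  path e x p -> uniq (x :: p) -> u \in x :: p ->
  exists s, [/\ path e u s, uniq (u :: s), last u s = last x p,
    {subset u :: s <= x :: p} & {subset s <= p} /\ {subset belast u s <= belast x p}].
Proof.
move=> ep up /splitPl us; case: us ep up => p1 p2 lp1.
rewrite cat_path lp1 -cat_cons cat_uniq lastI lp1 => /andP[_ ep2] /and3P[u1 u2 u3].
exists p2; split=> //.
- by rewrite /= u3 andbT; apply: contra u2 => H; apply/hasP; exists u => //; rewrite
  mem_rcons mem_head.
- by rewrite last_cat lp1.
- by move=> y; rewrite inE mem_cat mem_rcons => /orP[/eqP->|->]; rewrite ?mem_head ?orbT.
split=> y; first by rewrite mem_cat => ->; rewrite orbT.
by rewrite belast_cat lp1 mem_cat => ->; rewrite orbT.
Qed.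

(* Run back from z to the start of the path, then jump to the first neighbour
   of the start beyond z. *)
Lemma arc_cover (T : eqType) (e : rel T) x p z : symmetric e ->
  path e x p -> uniq (x :: p) -> e x (last x p) -> z \in x :: p -> z != last x p ->
  exists s, [/\ path e z s, last z s = last x p, uniq (z :: s),
    {subset z :: s <= x :: p} &
    forall u, u \in x :: p -> (u == x) || e x u -> u \in z :: s].
Proof.
move=> se ep up exl zp; case/splitPl: zp ep up exl => p1 p2 lp1.
rewrite last_cat lp1 cat_path lp1 -cat_cons cat_uniq.
move=> /andP[ep1 ep2] /and3P[up1 dis up2] exl zl.
have hasn : has (e x) p2.
  case: p2 {ep2 dis up2} exl zl => [|y p2] /=; first by rewrite eqxx.
  by move=> H _; case: (lastP p2) H => [|p' w] /=; [move->|rewrite last_rcons has_rcons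
    => ->; rewrite orbT].
case: (split_find hasn) ep2 dis up2 exl zl => g q1 q2 eg nq1.
rewrite cat_rcons => ep2 dis up2 exl zl.
have eL : z :: rev (belast x p1) = rev (x :: p1) by rewrite (lastI x p1) lp1 rev_rcons.
have lL : last z (rev (belast x p1)) = x.
  by rewrite -[LHS](last_cons z) eL rev_cons last_rcons.
exists (rev (belast x p1) ++ g :: q2); split.
- rewrite cat_path lL /= eg -{1}lp1 path_sym_rev // ep1 /=.
  by move: ep2; rewrite cat_path /= => /and3P[].
- by rewrite last_cat /= last_cat.
- rewrite -cat_cons eL cat_uniq rev_uniq up1.
  move: up2; rewrite cat_uniq => /and3P[_ _ ->]; rewrite andbT andTb.
  apply: contra dis => /hasP[y yq /=]; rewrite mem_rev => yp.
  by apply/hasP; exists y => //; rewrite mem_cat yq orbT.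
- move=> y; rewrite -cat_cons eL mem_cat mem_rev => /orP[yp|yq].
    by rewrite mem_cat yp.
  by rewrite !mem_cat yq !orbT.
- move=> u + H; rewrite -cat_cons eL mem_cat (mem_cat _ (rev _)) mem_rev => /orP[->//|].
  rewrite mem_cat => /orP[uq|->]; last by rewrite orbT.
  case/orP: H => [/eqP->|H]; first by rewrite mem_head.
  by move/hasPn/(_ u uq): nq1; rewrite H.
Qed.

(** A simple path is shortened from both sides: it restarts at a later vertex in X and stops at an
    earlier one in Y while there are any. *)
Lemma min_path (T : finType) (e : rel T) (X Y : {pred T}) x y :
  (forall z, z \in X -> z \notin Y) -> x \in X -> y \in Y -> connect e x y ->
  exists u s z, [/\ u \in X, z \in Y, path e u (rcons s z), uniq (u :: rcons s z)
    & forall v, v \in s -> (v \notin X) && (v \notin Y)].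
Proof.
move=> dis xX yY /connectP[p0 ep0 ey]; move: yY; rewrite ey {ey y}.
case/shortenP: ep0 => p + + _ {p0}.
have [n] := ubnP (size p); elim: n p x xX => // n IHn p x xX lt_n ep up lY.
case: (boolP (has [in X] p)) => [/hasP[x' x'p x'X]|nX].
  case/splitPr: x'p lt_n ep up lY => p1 p2.
  rewrite size_cat cat_path last_cat -cat_cons cat_uniq /=.
  move=> lt_n /and3P[_ _ ep2] /and3P[_ _ up2] lY.
  apply: (IHn p2 x' x'X) => //.
  by move: lt_n; rewrite addnS ltnS; apply: leq_ltn_trans; apply: leq_addl.
case: (lastP p) lt_n ep up lY nX => [|s z] lt_n ep up.
  by move=> /= lY; move: (dis x xX); rewrite lY.
rewrite last_rcons => zY nX.
case: (boolP (has [in Y] s)) => [/hasP[y ys yY]|nY].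
  case/splitPr: ys lt_n ep up {nX} => p1 p2.
  rewrite rcons_cat rcons_cons size_cat -cat_rcons cat_path -cat_cons cat_uniq.
  move=> lt_n /andP[ep1 _] /and3P[up1 _ _].
  apply: (IHn (rcons p1 y) x) => //; rewrite ?last_rcons //.
  move: lt_n; rewrite /= !size_rcons ltnS; apply: leq_trans.
  by rewrite !addnS !ltnS leq_addr.
exists x, s, z; split=> // v vs; apply/andP; split.
  by apply: (hasPn nX); rewrite mem_rcons inE vs orbT.
exact: (hasPn nY).
Qed.

(** A single edge qualifies, so the notion covers all blocks. *)
Definition biconnected (G : sgraph) := forall v x y : G, x != v -> y != v ->
  connect (fun a b => [&& adj a b, a != v & b != v]) x y.

Section Vine.
Variables (G : sgraph) (A : {pred G}) (a : G).
Hypothesis conn : biconnected G.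
Hypothesis aA : a \in A.

(* Two disjoint paths lead from A to the vertex w and to a later vertex v of
   the path w :: p, avoiding all other vertices of w :: p; they are written from
   the end, and one of them starts at a. *)
Definition fan (w : G) (p : seq G) : Prop := exists v r1 r2,
  [/\ v \in p, path (@adj G) w r1 /\ path (@adj G) v r2,
      uniq ((w :: r1) ++ v :: r2),
      [/\ last w r1 \in A, last v r2 \in A & a \in [:: last w r1; last v r2]] &
      (forall x, x \in belast w r1 ++ belast v r2 -> x \notin A) /\
      (forall x, x \in r1 ++ r2 -> x \notin w :: p)].

(** At a itself the first path is trivial; the second is a minimal path from the rest of A to p in
    the graph without a. *)
Lemma fan_start c p : c \in A -> c != a -> p != [::] -> a \notin p ->
  {in p, forall x, x \notin A} -> fan a p.
Proof.
move=> cA ca; case: p => // y p _ ap pA.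
have ya : y != a by apply: contraNneq ap => ->; rewrite mem_head.
have dis z : z \in [predD1 A & a] -> z \notin [pred x | x \in y :: p].
  by rewrite !inE => /andP[_ zA]; apply: contraL zA; apply: pA.
have [||u [s [v [uX vY ep up H]]]] := min_path dis _ _ (@conn a c y ca ya).
- by rewrite !inE ca.
- by rewrite !inE eqxx.
move: uX vY; rewrite !inE => /andP[ua uA] vY.
have va : v != a by apply: contraNneq ap => <-.
have sa x : x \in s -> x != a.
  move=> xs; move: ep; rewrite rcons_path => /andP[ep _].
  case/splitPr: xs ep => s1 s2; rewrite cat_path /= => /andP[_ /andP[/and3P[]]].
  by [].
exists v, [::], (rcons (rev s) u); split=> //.
- split=> //; apply: rev_rcons_path; first exact: adj_sym.
  by apply: sub_path ep => i j /and3P[].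
- move: up; rewrite /= !rcons_uniq !mem_rcons !inE !negb_or rev_uniq !mem_rev.
  move=> /and3P[/andP[uv us] vs ss].
  rewrite mem_rcons inE mem_rev negb_or [v == u]eq_sym [a == v]eq_sym.
  rewrite va uv vs us ss [a == u]eq_sym ua !andbT /=.
  by apply/negP=> /sa; rewrite eqxx.
- by rewrite last_rcons /= aA uA mem_head.
split=> x; rewrite /= ?belast_rcons.
  rewrite inE mem_rev => /orP[/eqP->|xs]; first exact: pA.
  by move: (H x xs); rewrite !inE (sa x xs) => /andP[].
rewrite mem_rcons inE mem_rev => /orP[/eqP->|xs]; rewrite !inE !negb_or.
  by rewrite ua; have := dis u; rewrite !inE ua uA negb_or => /(_ isT).
by rewrite (sa x xs); move: (H x xs); rewrite !inE negb_or => /andP[_].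
Qed.

(** One augmentation in the style of Menger. If v is not w', the first path is just extended by w.
    If it is, a new path avoiding w' leads from A or the old fan to p and is combined with parts of
    the old paths. *)
Lemma fan_step w w' p : adj w w' -> uniq (w :: w' :: p) -> p != [::] ->
  {in w' :: p, forall x, x \notin A} -> fan w (w' :: p) -> fan w' p.
Proof.
move=> eww' up p0 pA [v [r1 [r2 [vp [er1 er2] ur [l1 l2 la] [rA rp]]]]].
have w'w : w' != w by move: up; rewrite /= inE eq_sym negb_or => /andP[/andP[]].
have wp : w \notin p by move: up; rewrite /= inE negb_or => /andP[/andP[]].
have w'p : w' \notin p by move: up; rewrite /= => /and3P[].
have r1p x : x \in r1 -> [&& x != w, x != w' & x \notin p].
  by move=> H; have := rp x; rewrite mem_cat H !inE !negb_or => /(_ isT).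
have r2p x : x \in r2 -> [&& x != w, x != w' & x \notin p].
  by move=> H; have := rp x; rewrite mem_cat H orbT !inE !negb_or => /(_ isT).
have w'r1 : w' \notin r1 by apply/negP=> /r1p; rewrite eqxx andbF.
have ew'w : path (@adj G) w' (w :: r1) by rewrite /= adj_sym eww'.
have [ur1 ur2 dis12] : [/\ uniq (w :: r1), uniq (v :: r2) &
    forall x, x \in w :: r1 -> x \notin v :: r2].
  move: ur; rewrite cat_uniq => /and3P[-> /hasPn H ->]; split=> // x xr.
  by apply/negP=> /H; rewrite /= xr.
have [vw'|vw'] := eqVneq v w'; last first.
  have vp' : v \in p by move: vp; rewrite inE (negPf vw').
  exists v, (w :: r1), r2; split=> //.
  - rewrite cat_cons cons_uniq ur andbT mem_cat !inE !negb_or w'w w'r1 [w' == v]eq_sym.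
    by rewrite vw' /=; apply/negP=> /r2p; rewrite eqxx andbF.
  - split=> x.
      rewrite inE => /orP[/eqP->|]; first by apply: pA; rewrite mem_head.
      exact: rA.
    rewrite cat_cons inE => /orP[/eqP->|]; first by rewrite inE negb_or eq_sym w'w.
    by move/rp; rewrite inE negb_or => /andP[].
subst v => {vp}.
pose X := [pred x | [|| x \in A, x \in w :: r1 | x \in r2]].
have Xp z : z \in X -> z \notin [pred x | x \in p].
  rewrite [z \in X]inE [z \in [pred _ | _]]inE => /or3P[zA|zr|/r2p/and3P[]//].
    by apply: contraL zA => zp; apply: pA; rewrite inE zp orbT.
  by move: zr; rewrite inE => /orP[/eqP->//|/r1p/and3P[]].
have [y yp] : exists y, y \in p by case: (p) p0 => // y p' _; exists y; rewrite mem_head.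
have yw' : y != w' by apply: contraNneq w'p => <-.
have [||u [s [z [uX zp ep us H]]]] := min_path Xp _ _ (@conn w' w y ltac:(by rewrite
  eq_sym) yw').
- by rewrite !inE eqxx orbT.
- by rewrite inE.
rewrite inE in zp.
have sw' x : x \in s -> x != w'.
  move=> xs; move: ep; rewrite rcons_path => /andP[ep _].
  by case/splitPr: xs ep => s1 s2; rewrite cat_path /= => /andP[_ /andP[/and3P[]]].
have uw' : u != w'.
  by case: (s) ep => [|t s'] /= /andP[/and3P[]].
have sX x : x \in s -> [&& x \notin A, x \notin w :: r1, x \notin r2 & x \notin p].
  by move=> /H; rewrite [x \in X]inE !negb_or inE => /andP[/and3P[-> -> ->] ->].
have uw'' : u \notin p by have := Xp u uX; rewrite inE.
have zw' : z != w' by apply: contraNneq w'p => <-.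
(* It remains to reroute inside the old fan: r leads from w' to A, and suf leads to A from u, where
   the new path s begins. *)
suff [r [suf [[er esuf ur'] [[lr ls lars] [[rA' sA'] [rX sX']]]]]] : exists r suf,
   [/\ path (@adj G) w' r, path (@adj G) u suf & uniq ((w' :: r) ++ u :: suf)] /\
   [/\ last w' r \in A, last u suf \in A & a \in [:: last w' r; last u suf]] /\
   ({in belast w' r, forall x, x \notin A} /\ {in belast u suf, forall x, x \notin A}) /\
   ({subset r <= X} /\ {subset suf <= X}).
  have pX x : x \in X -> x \notin p by move/Xp; rewrite inE.
  have nsX x : x \in s -> x \notin X by case/H/andP.
  have zX : z \notin X by apply: contraL zp; apply: pX.
  have zs : z \notin s by apply/negP=> /H; rewrite [z \in [pred _ | _]]inE zp andbF.
  have [ws wr wu] : [/\ w' \notin s, w' \notin r & w' \notin u :: suf].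
    split; first by apply/negP=> /sw'; rewrite eqxx.
      by move: ur'; rewrite /= mem_cat negb_or => /andP[/andP[]].
    by move: ur'; rewrite /= mem_cat negb_or => /andP[/andP[]].
  have usX x : x \in u :: suf -> x \in X by rewrite inE => /orP[/eqP->//|/sX'].
  exists z, r, (rev s ++ u :: suf); split=> //.
  - split=> //; rewrite -cat_rcons cat_path last_rcons esuf andbT.
    apply: rev_rcons_path; first exact: adj_sym.
    by apply: sub_path ep => i j /and3P[].
  - move: ur'; rewrite !cat_uniq => /and3P[u1 u2 u3]; apply/and3P; split=> //.
      apply/hasPn=> x; rewrite inE mem_cat mem_rev => /or3P[/eqP->|xs|xu].
      + by rewrite inE negb_or zw' /=; apply: contra zX; apply: rX.
      + by rewrite inE negb_or sw' //=; apply: contra (nsX x xs); apply: rX.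
      + exact: (hasPn u2).
    rewrite cons_uniq mem_cat mem_rev (negPf zs) cat_uniq rev_uniq u3 andbT orFb.
    have -> : uniq s by move: us; rewrite /= rcons_uniq => /and3P[].
    apply/andP; split; first by apply: contra zX => /usX.
    by apply/hasPn=> x /usX; rewrite mem_rev; apply: contraL; apply: nsX.
  - by split; rewrite ?last_cat.
  split=> x.
    rewrite mem_cat belast_cat => /orP[/rA'//|]; rewrite mem_cat => /orP[|/=].
      move/mem_belast; rewrite inE mem_rev => /orP[/eqP->|/sX/and4P[]//].
      by apply: pA; rewrite inE zp orbT.
    rewrite inE => /orP[/eqP->|/sA'//].
    have := mem_last z (rev s); rewrite inE mem_rev => /orP[/eqP->|/sX/and4P[]//].
    by apply: pA; rewrite inE zp orbT.
  rewrite !mem_cat mem_rev inE negb_or => /or3P[xr|xs|xu].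
  - by rewrite (pX x (rX x xr)) andbT; apply: contraNneq wr => <-.
  - by rewrite sw' //; case/and4P: (sX x xs).
  - by rewrite (pX x (usX x xu)) andbT; apply: contraNneq wu => <-.
have subX1 x : x \in w :: r1 -> x \in X by rewrite [x \in X]inE => ->; rewrite orbT.
have subX2 x : x \in r2 -> x \in X by rewrite [x \in X]inE => ->; rewrite !orbT.
have w'X x : x \in w' :: r2 -> x != w' -> x \in r2 by rewrite inE => /orP[->//|].
have AX x : x \in A -> x \in X by rewrite [x \in X]inE => ->.
have w'A : w' \notin A by apply: pA; rewrite mem_head.
have rA1 x : x \in belast w r1 -> x \notin A by move=> xr; apply: rA; rewrite mem_cat xr.
have rA2 x : x \in belast w' r2 -> x \notin A by move=> xr; apply: rA; rewrite mem_cat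
  xr orbT.
have w'wr1 : w' \notin w :: r1 by rewrite inE negb_or w'w.
have rA1' x : x \in belast w' (w :: r1) -> x \notin A.
  by rewrite inE => /orP[/eqP->|/rA1].
(* If u is on the path of w, the tail of that path continues the new one, and w' keeps r2. *)
case: (boolP (u \in w :: r1)) => [ur1'|nur1].
  have [suf [e1 e2 e3 e4 [e5 e6]]] := path_suffix er1 ur1 ur1'.
  exists r2, suf; split; [split=> //|split; [split|split; split]] => //.
  - rewrite cat_uniq ur2 e2 andbT andTb; apply/hasPn=> x /e4; exact: dis12.
  - by rewrite e3.
  - by move: la; rewrite e3 !inE orbC.
  - by move=> x /e6; apply: rA1.
  - by move=> x /e5 xr; apply: subX1; rewrite inE xr orbT.
(* If u is on the path of w', its tail goes to the new path, and w' turns back through w. *)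
case: (boolP (u \in w' :: r2)) => [ur2'|nur2].
  have [suf [e1 e2 e3 e4 [e5 e6]]] := path_suffix er2 ur2 ur2'.
  have w'us : w' \notin u :: suf.
    rewrite inE negb_or eq_sym uw' /=; apply/negP=> /e5.
    by move: ur2 => /= /andP[/negPf->].
  exists (w :: r1), suf; split; [split=> //|split; [split|split; split]] => //.
  - rewrite cat_cons cons_uniq mem_cat negb_or w'wr1 w'us cat_uniq ur1 e2 !andbT !andTb.
    apply/hasPn=> x /e4; apply: contraL; exact: dis12.
  - by rewrite e3.
  - by rewrite e3.
  - by move=> x /e6; apply: rA2.
  - by move=> x /e5; apply: subX2.
have uA : u \in A.
  move: uX; rewrite [u \in X]inE (negPf nur1) /=.
  by move: nur2; rewrite inE negb_or => /andP[_ /negPf->]; rewrite orbF.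
(* Otherwise u is in A and the new path is complete; w' takes whichever old path starts at a. *)
have [la1|la2] : a = last w r1 \/ a = last w' r2 by move: la; rewrite !inE => /orP[]
  /eqP; [left|right].
  exists (w :: r1), [::]; split; [split=> //|split; [split|split; split]] => //.
  - by rewrite cats1 rcons_uniq cons_uniq w'wr1 ur1 inE negb_or uw' nur1.
  - by rewrite /= -la1 mem_head.
exists r2, [::]; split; [split=> //|split; [split|split; split]] => //.
- by rewrite cats1 rcons_uniq nur2.
- by rewrite -la2 mem_head.
Qed.
End Vine.

Lemma not_path_split (T : Type) (r : rel T) x p : ~~ path r x p ->
  exists l1 u z l2, x :: p = l1 ++ u :: z :: l2 /\ ~~ r u z.
Proof.
elim: p x => //= z p IHp x; rewrite negb_and => /orP[nr|/IHp].
  by exists [::], x, z, p.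
by move=> [l1 [u [v [l2 [-> H]]]]]; exists (x :: l1), u, v, l2.
Qed.

Lemma count_alternating (T : Type) (a b : pred T) h s :
  path (fun u z => ~~ (b u && a z)) h s ->
  count a s + count b (belast h s) <= size s.
Proof.
elim: s h => //= z s IHs h /andP[+ /IHs].
by case: (b h); case: (a z) => //= _; lia.
Qed.

Lemma last_rev_belast (T : Type) (x : T) p : last (last x p) (rev (belast x p)) = x.
Proof. by case: p => //= y p; rewrite rev_cons last_rcons. Qed.

Lemma split_has_last (T : Type) (f : pred T) s : has f s ->
  exists s1 a s2, [/\ s = s1 ++ a :: s2, f a & ~~ has f s2].
Proof.
elim: s => //= z s IHs; case: (boolP (has f s)) => [/IHs[s1 [a [s2 [-> fa n2]]]] _|ns].
  by exists (z :: s1), a, s2.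
by rewrite orbF => fz; exists [::], z, s.
Qed.

Lemma split_has_first (T : Type) (f : pred T) s : has f s ->
  exists s1 a s2, [/\ s = s1 ++ a :: s2, f a & ~~ has f s1].
Proof.
elim: s => //= z s IHs; case: (boolP (f z)) => [fz _|nz /= /IHs[s1 [a [s2 [-> fa n1]]]]].
  by exists [::], z, s.
by exists (z :: s1), a, s2; rewrite /= negb_or nz.
Qed.

Section Posa.
Variable G : sgraph.
Hypothesis conn : biconnected G.

Lemma fan_along (A : {pred G}) (a w0 w : G) pre post :
  path (@adj G) w0 (pre ++ w :: post) -> uniq (w0 :: pre ++ w :: post) ->
  post != [::] -> {in pre ++ w :: post, forall x, x \notin A} ->
  fan A a w0 (pre ++ w :: post) -> fan A a w post.
Proof.
move=> + + post0; elim: pre w0 => [|y pre IHpre] w0 ep up pA.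
  by apply: fan_step => //; case/andP: ep.
case/andP: ep => ey ep F; apply: (IHpre y) => //.
- by case/andP: up.
- by move=> x xp; apply: pA; rewrite inE xp orbT.
by apply: fan_step F => //; case: (pre).
Qed.

(** The cycle runs from x to u, across to y, back to z and home to x, omitting only [mid]. Once
    [mid] has shrunk so far that it contains no neighbour of x or y, all neighbours lie on the
    cycle. They number at most its length, unless two consecutive vertices u', z' of the path cross;
    then nothing is omitted. *)
Lemma long_cycle_of_crossing k x y P1 mid P2 u z : 2 < k ->
  path (@adj G) x (P1 ++ mid ++ z :: P2) -> uniq (x :: P1 ++ mid ++ z :: P2) ->
  u = last x P1 -> y = last z P2 -> adj y u -> adj x z ->
  k <= size (x :: P1 ++ mid ++ z :: P2) ->
  k <= count (adj x) (x :: P1 ++ mid ++ z :: P2) +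
       count (adj y) (x :: P1 ++ mid ++ z :: P2) ->
  exists2 c : seq G, is_cycle c & k <= size c.
Proof.
move=> k2; have [n] := ubnP (size mid).
elim: n P1 mid P2 u z => // n IHn P1 mid P2 u z lt_n ep up eu ey yu xz sk ck.
case: (boolP (has (adj x) mid)) => [/hasP[z' z'm xz']|nx].
  case/splitPr: z'm lt_n ep up sk ck => m1 m2; rewrite -catA size_cat /=.
  move=> lt_n ep up sk ck.
  by apply: (IHn P1 m1 (m2 ++ z :: P2) u z') => //; rewrite ?last_cat //; lia.
case: (boolP (has (adj y) mid)) => [/hasP[u' u'm yu']|ny].
  case/splitPr: u'm lt_n ep up sk ck {nx} => m1 m2; rewrite -catA size_cat /=.
  have -> : P1 ++ m1 ++ u' :: m2 ++ z :: P2 = (P1 ++ rcons m1 u') ++ m2 ++ z :: P2.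
    by rewrite -!catA cat_rcons.
  move=> lt_n ep up sk ck.
  by apply: (IHn (P1 ++ rcons m1 u') m2 P2 u' z) => //; rewrite ?last_cat ?last_rcons
    //; lia.
pose c := x :: P1 ++ rev (z :: P2).
have ec : cycle (@adj G) c.
  move: ep; rewrite cat_path -eu => /andP[ep1]; rewrite cat_path => /andP[_ /= /andP[_
    ep2]].
  rewrite /= rcons_cat cat_path ep1 -eu lastI rev_rcons -ey /= adj_sym yu /=.
  rewrite rcons_path ey path_sym_rev ?ep2; last exact: adj_sym.
  by rewrite last_rev_belast adj_sym.
have uc : uniq c.
  rewrite /c -cat_cons cat_uniq rev_uniq; move: up.
  rewrite -cat_cons cat_uniq => /and3P[-> /hasPn dis].
  rewrite cat_uniq => /and3P[_ _ ->]; rewrite andbT andTb.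
  by apply/hasPn=> v; rewrite mem_rev => vz; apply: dis; rewrite mem_cat vz orbT.
case: (leqP k (size c)) => [sc|].
  by exists c => //; rewrite /is_cycle uc ec andbT; lia.
have -> : size c = size (x :: P1) + size (z :: P2) by rewrite /= size_cat size_rev.
move=> lt_c.
case: mid lt_n nx ny ep up sk ck => [|m0 mid] lt_n nx ny ep up sk ck.
  by move: sk lt_c; rewrite /= !size_cat /=; lia.
case: (boolP (path (fun u z => ~~ (adj y u && adj x z)) x (P1 ++ (m0 :: mid) ++ z ::
  P2))).
  rewrite cat_path => /andP[r1]; rewrite cat_path => /andP[_ /= /andP[_ r2]].
  have c1 := count_alternating r1; have c2 := count_alternating r2.
  have e1 : count (adj y) (x :: P1) = count (adj y) (belast x P1) + 1.
    by rewrite lastI -cats1 count_cat /= -eu yu.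
  have e2 : count (adj y) (z :: P2) = count (adj y) (belast z P2).
    by rewrite lastI -cats1 count_cat /= -ey adj_irrefl !addn0.
  move: lt_c; rewrite ltnNge => /negP[]; apply: leq_trans ck _.
  rewrite -cat_cons !count_cat e1 e2 /= adj_irrefl xz.
  move: nx ny; rewrite !has_count -!leqNgt /= !leqn0 => /eqP-> /eqP->.
  by rewrite !add0n; lia.
move=> npath; have [l1 [u' [z' [l2 [el]]]]] := not_path_split npath.
rewrite negbK => /andP[yu' xz'].
have [P1' eP1 eu'] : exists2 P1', l1 ++ [:: u'] = x :: P1' & last x P1' = u'.
  case: l1 el => [|w l1] /= [-> _]; first by exists [::].
  by exists (l1 ++ [:: u']) => //; rewrite last_cat.
have el' : P1 ++ (m0 :: mid) ++ z :: P2 = P1' ++ [::] ++ z' :: l2.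
  have : x :: (P1 ++ (m0 :: mid) ++ z :: P2) = x :: P1' ++ z' :: l2.
    by rewrite el -cat_cons -eP1 -catA.
  by case.
have ey' : y = last z' l2.
  have := congr1 (last x) el'; rewrite !last_cat /= => <-.
  by rewrite ey.
apply: (IHn P1' [::] l2 u' z') => //; rewrite -?el' //.
by case: (n) lt_n.
Qed.

(** Pósa's lemma. If no two chords cross, no neighbour of y precedes the last neighbour a of x. The
    cycle then consists of an arc through x and its neighbours, an arc through y and its neighbours,
    and the two paths of a fan. *)
Lemma posa k x p : 2 < k -> path (@adj G) x p -> uniq (x :: p) -> p != [::] ->
  k <= size (x :: p) ->
  k <= count (adj x) (x :: p) + count (adj (last x p)) (x :: p) ->
  exists2 c : seq G, is_cycle c & k <= size c.
Proof.
move=> k2 ep up p0 sk ck.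
have hx : has (adj x) p by case: (p) p0 ep => //= w p' _ /andP[->].
have [q1 [a [q [epq xa nq]]]] := split_has_last hx.
have [y ey] : exists y, y = last x p by exists (last x p).
have eyq : y = last a q by rewrite ey epq last_cat.
rewrite -ey in ck.
case: (boolP (has (adj y) (x :: q1))) => [/hasP[u uq yu]|nyq].
  case/splitPl: uq epq => p1 p2 eu epq; rewrite -catA in epq.
  by apply: (@long_cycle_of_crossing k x y p1 p2 q u a) => //; rewrite -?epq.
have hy : has (adj y) (a :: q).
  case: (lastP q) eyq epq nq => [|q' z] eyq epq nq.
    by move: nyq; rewrite /= eyq adj_sym xa.
  have ez : z = y by rewrite eyq last_rcons.
  have : adj (last a q') y.
    move: ep; rewrite epq cat_path => /andP[_ /= /andP[_]].
    by rewrite rcons_path ez => /andP[].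
  move=> yl; apply/hasP; exists (last a q'); last by rewrite adj_sym.
  by rewrite -rcons_cons mem_rcons inE mem_last orbT.
have [pre [w [post [ewp yw npre]]]] := split_has_first hy.
have epost : y = last w post.
  rewrite eyq -[RHS]/(last w (w :: post)) -[LHS]/(last w (a :: q)) ewp.
  by rewrite !last_cat.
have post0 : post != [::].
  by apply: contraTneq yw => e0; rewrite epost e0 /= adj_irrefl.
(* The arc of x will lie in A, the path up to a; the fan is carried from a to w, the first neighbour
   of y. *)
pose A := [pred v | v \in x :: rcons q1 a].
have upA : uniq (x :: rcons q1 a) /\ {in q, forall v, v \notin A}.
  move: up; rewrite epq -cat_rcons -cat_cons cat_uniq => /and3P[-> /hasPn H _].
  by split=> // v /H.
have epa : path (@adj G) x (rcons q1 a) /\ path (@adj G) a q.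
  by move: ep; rewrite epq -cat_rcons cat_path last_rcons => /andP.
have uaq : uniq (a :: q).
  by move: up; rewrite epq -cat_cons cat_uniq => /and3P[].
have xna : x != a by apply: contraTneq xa => ->; rewrite adj_irrefl.
have F0 : fan A a a q.
  apply: (@fan_start _ _ _ conn _ x) => //.
  - by rewrite inE mem_rcons mem_head orbT.
  - by rewrite !inE eqxx.
  - case: (pre) ewp => [[_ ->]//|? l [_ ->]]; by case: (l).
  - by case/andP: uaq.
  - by case: upA.
have F : fan A a w post.
  case: pre ewp {npre} => [[<- <-]//|a' pre [_ eq]].
  by apply: (@fan_along A a a w pre) => //; rewrite -eq //; [case: epa | case: upA].
have postA : {in post, forall v, v \notin A}.
  case: pre ewp {npre} => [[_ <-]|a' pre [_ eq]]; first by case: upA.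
  by move=> v vp; case: upA => _; apply; rewrite eq mem_cat inE vp !orbT.
have uwp : uniq (w :: post) by move: uaq; rewrite ewp cat_uniq => /and3P[].
have ewpost : path (@adj G) w post.
  case: pre ewp {npre} => [[<- <-]|a' pre [_ eq]]; first by case: epa.
  by case: epa => _; rewrite eq cat_path => /andP[_ /= /andP[]].
have [v [r1 [r2 [vp [er1 er2] ur [l1 l2 la] [rA rp]]]]] := F.
set s1 := last w r1 in l1 la; set s2 := last v r2 in l2 la.
have s12 : s1 != s2.
  move: ur; rewrite cat_uniq => /and3P[_ /hasPn H _].
  by apply/eqP => e; move: (H s2 (mem_last _ _)); rewrite -e mem_last.
(* One fan path starts at a, so [arc_cover] applies to the other contact in A; the arc is reversed
   when a is s1. *)
have [L [eL lL uL LA covL]] : exists L, [/\ path (@adj G) s1 L, last s1 L = s2,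
    uniq (s1 :: L), {subset s1 :: L <= x :: rcons q1 a} &
    forall v, v \in x :: rcons q1 a -> (v == x) || adj x v -> v \in s1 :: L].
  have cov := @arc_cover _ (@adj G) x (rcons q1 a) _ (@adj_sym G) (proj1 epa) (proj1 upA).
  rewrite last_rcons in cov.
  move: la; rewrite !inE => /orP[/eqP ea|/eqP ea].
    have [|L [e1 e2 e3 e4 e5]] := cov s2 xa l2; first by rewrite ea eq_sym.
    rewrite ea in e2.
    exists (rev (belast s2 L)); have eL : s1 :: rev (belast s2 L) = rev (s2 :: L).
      by rewrite (lastI s2 L) rev_rcons e2.
    split.
    - by rewrite -e2 path_sym_rev //; exact: adj_sym.
    - by rewrite -e2 last_rev_belast.
    - by rewrite eL rev_uniq.
    - by move=> t; rewrite eL mem_rev; apply: e4.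
    - by move=> t t1 t2; rewrite eL mem_rev; apply: e5.
  have [|L [e1 e2 e3 e4 e5]] := cov s1 xa l1; first by rewrite ea.
  by exists L; split=> //; rewrite e2.
have vw : v != w by apply: contraTneq vp => ->; case/andP: uwp.
(* The same for y, with the path from w to y read backwards. *)
have [B [eB uB Bp covB]] : exists B, [/\ path (@adj G) v (rcons B w),
    uniq (v :: rcons B w), {subset v :: rcons B w <= w :: post} &
    forall t, t \in w :: post -> (t == y) || adj y t -> t \in v :: rcons B w].
  have eR : y :: rev (belast w post) = rev (w :: post) by rewrite (lastI w post)
    rev_rcons epost.
  have [|||||S [e1 e2 e3 e4 e5]] := @arc_cover _ (@adj G) y (rev (belast w post)) v
    (@adj_sym G).
  - by rewrite epost path_sym_rev //; exact: adj_sym.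
  - by rewrite eR rev_uniq.
  - by rewrite epost last_rev_belast -epost.
  - by rewrite eR mem_rev inE vp orbT.
  - by rewrite epost last_rev_belast.
  rewrite epost last_rev_belast in e2.
  case: (lastP S) e1 e2 e3 e4 e5 => [|B z] e1 e2; first by rewrite /= in e2; rewrite e2
    eqxx in vw.
  rewrite last_rcons in e2; rewrite e2 in e1 * => e3 e4 e5.
  by exists B; split=> // t; [move=> /e4|move=> tp; apply: e5]; rewrite eR mem_rev.
pose c := w :: r1 ++ L ++ rev (belast v r2) ++ B.
have ec : cycle (@adj G) c.
  rewrite /= !rcons_cat !cat_path er1 -/s1 eL lL -/s2 path_sym_rev ?er2; last exact:
    adj_sym.
  by rewrite last_rev_belast eB.
have AP t : (t \in A) = (t \in x :: rcons q1 a) by rewrite inE.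
have uL' : s1 \notin L /\ uniq L by case/andP: uL.
have [ur1 ur2 dis] : [/\ uniq (w :: r1), uniq (v :: r2) &
    forall t, t \in v :: r2 -> t \notin w :: r1].
  by move: ur; rewrite cat_uniq => /and3P[-> /hasPn H ->].
have LA' t : t \in L -> t \in A by move=> tL; rewrite AP; apply: LA; rewrite inE tL orbT.
have LN1 t : t \in L -> t \notin w :: r1.
  move=> tL; rewrite lastI -/s1 mem_rcons inE negb_or.
  apply/andP; split; first by apply: contraTneq tL => ->; case: uL'.
  by apply: contraL (LA' t tL) => tr; apply: rA; rewrite mem_cat tr.
have r2A t : t \in belast v r2 -> t \notin A by move=> tr; apply: rA; rewrite mem_cat
  tr orbT.
have Bpost t : t \in B -> (t \in post) && (t != v).
  move=> tB; move: uB; rewrite /= rcons_uniq mem_rcons inE negb_or => /and3P[/andP[_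
    vB] wB _].
  have := Bp t; rewrite !inE mem_rcons inE tB !orbT => /(_ isT) /orP[/eqP et|->].
    by rewrite -et tB in wB.
  by apply: contraNneq vB => <-.
have Br t : t \in B -> (t \notin w :: r1) && (t \notin v :: r2).
  move=> /Bpost/andP[tp tv]; rewrite !inE !negb_or tv.
  have -> : t != w by apply: contraTneq tp => ->; case/andP: uwp.
  have H : t \notin r1 ++ r2 by apply/negP=> /rp; rewrite inE tp orbT.
  by move: H; rewrite mem_cat negb_or.
have uc : uniq c.
  rewrite /c -cat_cons cat_uniq ur1 andTb; apply/andP; split.
    apply/hasPn=> t; rewrite !mem_cat mem_rev => /or3P[/LN1//|/mem_belast|/Br/andP[]//].
    exact: dis.
  rewrite cat_uniq; case: uL' => _ -> /=; apply/andP; split.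
    apply/hasPn=> t; rewrite mem_cat mem_rev => /orP[/r2A|/Bpost/andP[/postA + _]];
      by apply: contra => /LA'.
  rewrite cat_uniq rev_uniq; apply/and3P; split.
  - by move: ur2; rewrite lastI rcons_uniq => /andP[].
  - apply/hasPn=> t /Br/andP[_]; apply: contra; rewrite mem_rev; exact: mem_belast.
  - by move: uB; rewrite /= rcons_uniq => /and3P[].
(* The arcs contain x and y besides their neighbours. Hence [size L] is at least the count for x,
   and [size B] at least the count for y minus 1; the head w of c supplies the missing vertex. *)
have sL : count (adj x) (x :: p) < (size L).+1.
  rewrite -size_filter.
  change (size (x :: filter (adj x) (x :: p)) <= size (s1 :: L)).
  apply: uniq_leq_size; first by rewrite cons_uniq mem_filter adj_irrefl filter_uniq.
  move=> t; rewrite inE => /orP[/eqP->|]; first by apply: covL; rewrite ?eqxx ?mem_head.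
  rewrite mem_filter => /andP[xt tp]; apply: covL; last by rewrite xt orbT.
  move: tp; rewrite epq -cat_rcons -cat_cons mem_cat => /orP[//|tq].
  by move/hasPn/(_ t tq): nq; rewrite xt.
have sB : count (adj y) (x :: p) < (size B).+2.
  rewrite -size_filter -(size_rcons B w).
  change (size (y :: filter (adj y) (x :: p)) <= size (v :: rcons B w)).
  apply: uniq_leq_size; first by rewrite cons_uniq mem_filter adj_irrefl filter_uniq.
  move=> t; rewrite [t \in y :: _]in_cons mem_filter => /orP[/eqP->|/andP[yt tp]].
    by apply: covB; rewrite ?eqxx // epost mem_last.
  apply: covB; last by rewrite yt orbT.
  move: tp; rewrite epq -cat_cons mem_cat => /orP[tq|].
    by move/hasPn/(_ t tq): nyq; rewrite yt.
  rewrite ewp mem_cat => /orP[tq|//].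
  by move/hasPn/(_ t tq): npre; rewrite yt.
have sc : k <= size c.
  rewrite /c /= !size_cat size_rev size_belast.
  by move: sL sB ck; clear; lia.
by exists c => //; rewrite /is_cycle uc ec !andbT; apply: leq_trans sc.
Qed.

End Posa.

Lemma clique_path (G : sgraph) (K : {set G}) x p : is_clique K ->
  uniq (x :: p) -> {subset x :: p <= K} -> path (@adj G) x p.
Proof.
move=> /cliqueP qK; elim: p x => //= y p IHp x /andP[xp yp] sK.
apply/andP; split.
  apply: qK; rewrite ?sK ?mem_head //; first by rewrite inE mem_head orbT.
  by apply: contraNneq xp => ->; rewrite mem_head.
by apply: IHp => // z zp; apply: sK; rewrite inE zp orbT.
Qed.

Lemma clique_cycle (G : sgraph) (K : {set G}) : is_clique K -> 2 < #|K| ->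
  exists2 p : seq G, is_cycle p & size p = #|K|.
Proof.
move=> qK K2; exists (enum K); last by rewrite cardE.
rewrite /is_cycle -cardE K2 enum_uniq /=.
have := enum_uniq K; have := mem_enum K; have := cardE K.
case: (enum K) => //= x p sz mK up; rewrite rcons_path.
have sK : {subset x :: p <= K} by move=> z; rewrite mK.
rewrite (clique_path qK) //=; move/cliqueP: qK; apply; rewrite ?sK ?mem_last ?mem_head //.
case/lastP: p sz up {mK sK} => [|p z] sz; first by rewrite sz in K2.
by rewrite last_rcons /= mem_rcons inE negb_or eq_sym => /andP[/andP[]].
Qed.

(** * Saturated graphs without long cycles *)

Section Saturation.
Variables (T : finType) (k : nat).

(** Bounding the number n of inner vertices by [#|T|] makes the property boolean; n + 2 includes the
    two ends. *)
Definition long_path (e : rel T) x y := [exists n : 'I_#|T|.+1, exists p : n.-tuple T,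
  [&& path e x (rcons p y), uniq (x :: rcons p y) & k <= n.+2]].

Lemma long_pathP (e : rel T) x y :
  reflect (exists p, [/\ path e x (rcons p y), uniq (x :: rcons p y) & k <= (size p).+2])
          (long_path e x y).
Proof.
apply: (iffP existsP) => [[n /existsP[p /and3P[ep up kp]]]|[p [ep up kp]]].
  by exists p; rewrite size_tuple.
have sp : size p < #|T|.+1.
  rewrite ltnS; have : uniq p by move: up; rewrite /= rcons_uniq => /and3P[].
  by move/card_uniqP <-; apply: max_card.
exists (Ordinal sp); apply/existsP; exists (in_tuple p).
by rewrite /= in ep up kp *; rewrite ep up kp.
Qed.

Definition add_edge (e : rel T) x y : rel T :=
  fun u v => e u v || (([set u; v] == [set x; y]) && (u != v)).

End Saturation.

Lemma set2_eq (T : finType) (a b u v : T) : [set a; b] = [set u; v] ->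
  a = u /\ b = v \/ a = v /\ b = u.
Proof.
move=> e; have := set21 a b; have := set22 a b; rewrite e !inE.
have := set21 u v; have := set22 u v; rewrite -e !inE.
by do !case/orP=> /eqP ?; subst; auto.
Qed.

(** Deleting the new edge from a long cycle through it would leave a path from x to y on at least k
    vertices. *)
Lemma add_edge_cycle (T : finType) k (e : rel T) x y p : symmetric e -> 2 < k ->
  x != y -> ~~ long_path k e x y -> uniq p -> cycle (add_edge e x y) p ->
  k <= size p -> cycle e p.
Proof.
move=> se k2 xy nlp up cp kp; apply: contraNT nlp => nc.
have [u uq nu] : exists2 u, u \in p & ~~ e u (next p u).
  apply/hasP; rewrite has_predC; apply: contra nc => /allP H.
  exact: cycle_from_next.
have [i s es] := rot_to uq.
have cp' : cycle (add_edge e x y) (u :: s) by rewrite -es rot_cycle.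
have up' : uniq (u :: s) by rewrite -es rot_uniq.
have sp : size (u :: s) = size p by rewrite -es size_rot.
have nx : next p u = next (u :: s) u by rewrite -es next_rot.
case: s es cp' up' sp nx => [|z s] es cp' up' sp nx; first by rewrite -sp in kp; move:
  kp; rewrite leqNgt (ltn_trans _ k2).
have {}nx : next p u = z by rewrite nx /= eqxx.
rewrite nx in nu.
move: cp' => /= /andP[]; rewrite {1}/add_edge (negPf nu) /= => /andP[/eqP euz uz] cz.
case: s es up' sp cz => [|c s] es up' sp cz.
  by rewrite -sp in kp; move: (leq_trans k2 kp).
have uz' : uniq (z :: rcons (c :: s) u) by rewrite -rcons_cons rcons_uniq; exact: up'.
have zc : z \notin c :: rcons s u by case/andP: uz'.
have add_z a b : a != z -> b != z -> add_edge e x y a b -> e a b.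
  move=> az bz /orP[//|/andP[/eqP eab _]].
  have : z \in [set a; b] by rewrite eab -euz set22.
  by rewrite !inE !(eq_sym z) (negPf az) (negPf bz).
have ez : path e z (rcons (c :: s) u).
  move: cz => /= /andP[/orP[->|/andP[/eqP ezc _]] cz] /=.
    apply: (@sub_in_path _ [pred a | a != z]) cz => [a b az bz|]; first exact: add_z.
    by apply/allP => a ac; apply: contraNneq zc => <-.
  have : u \in [set z; c] by rewrite ezc -euz set21.
  rewrite !inE => /orP[] /eqP uzc; move: up'; rewrite /= !inE -uzc eqxx ?orbT //.
have kcs : k <= (size (c :: s)).+2 by rewrite (leq_trans kp) // -sp.
have [[<- <-]|[<- <-]] := set2_eq euz.
  apply/long_pathP; exists (rev (c :: s)); split; last by rewrite size_rev.
    exact: rev_rcons_path.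
  by move: uz'; rewrite -rev_uniq rev_cons rev_rcons.
by apply/long_pathP; exists (c :: s).
Qed.

Lemma saturate (G : sgraph) k : 2 < k -> no_cycle_ge k G ->
  exists (e : rel G) (es : symmetric e) (ei : irreflexive e),
  [/\ subrel (@adj G) e, no_cycle_ge k (SGraph es ei) &
     forall x y, x != y -> ~~ e x y -> long_path k e x y].
Proof.
move=> k2 nG.
suff H n (e : rel G) (es : symmetric e) (ei : irreflexive e) :
    subrel (@adj G) e -> no_cycle_ge k (SGraph es ei) ->
    #|[set u : G * G | ~~ e u.1 u.2]| < n ->
  exists (e : rel G) (es : symmetric e) (ei : irreflexive e),
  [/\ subrel (@adj G) e, no_cycle_ge k (SGraph es ei) &
     forall x y, x != y -> ~~ e x y -> long_path k e x y].
  apply: (H _ (@adj G) (@adj_sym G) (@adj_irrefl G)) (leqnn _) => //.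
elim: n e es ei => // n IHn e es ei sub ne lt_n.
case: (boolP [forall x, forall y, (x != y) ==> ~~ e x y ==> long_path k e x y]).
  move=> /forallP H; exists e, es, ei; split=> // x y xy nexy.
  by move/forallP: (H x) => /(_ y); rewrite xy nexy.
rewrite negb_forall => /existsP[x]; rewrite negb_forall => /existsP[y].
rewrite negb_imply => /andP[xy]; rewrite negb_imply => /andP[nexy nlp].
have es' : symmetric (add_edge e x y) by move=> u v; rewrite /add_edge es (setUC [set
  u]) (eq_sym u).
have ei' : irreflexive (add_edge e x y) by move=> u; rewrite /add_edge ei eqxx andbF.
apply: (IHn _ es' ei').
- by move=> u v /sub; rewrite /add_edge => ->.
- move=> p /and3P[p2 up cp]; case: (ltnP (size p) k) => // kp.
  have := add_edge_cycle es k2 xy nlp up cp kp => ce.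
  by move: (ne p); rewrite /is_cycle p2 up ce ltnNge kp => /(_ isT).
rewrite ltnS in lt_n; apply: leq_trans lt_n.
apply: proper_card; apply/properP; split.
  by apply/subsetP=> u; rewrite !inE; apply: contra => /= eu; rewrite /add_edge eu.
by exists (x, y); rewrite !inE //= /add_edge eqxx xy orbT.
Qed.

(** * Kopylov's disintegration *)

Section Core.
Variables (G : sgraph).
Implicit Types (U W : {set G}) (c : nat).

(** The (c + 1)-core of graph theory. Taking a union of sets keeps the order of deletions out of the
    definition. *)
Definition core c : {set G} :=
  \bigcup_(W : {set G} | [forall v in W, c < #|nbrs v :&: W|]) W.

Lemma core_deg c v : v \in core c -> c < #|nbrs v :&: core c|.
Proof.
case/bigcupP=> W gW vW; move/forall_inP: (gW) => /(_ v vW) H.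
apply: leq_trans H _; apply: subset_leq_card; apply: setIS.
exact: bigcup_sup.
Qed.

Lemma core_max c W : {in W, forall v, c < #|nbrs v :&: W|} -> W \subset core c.
Proof. by move=> H; apply: bigcup_sup; apply/forall_inP. Qed.

Lemma core_peel c U : core c \proper U ->
  exists2 v, v \in U :\: core c & #|nbrs v :&: U| <= c.
Proof.
move=> /properP[sub [w wU wc]].
have : ~~ [forall v in U, c < #|nbrs v :&: U|].
  apply: contra wc => /forall_inP H; exact: (subsetP (core_max H)).
rewrite negb_forall_in => /exists_inP[v vU]; rewrite -leqNgt => H.
exists v => //; rewrite inE vU andbT; apply/negP=> /core_deg; rewrite ltnNge.
by rewrite (leq_trans (subset_leq_card (setIS _ sub)) H).
Qed.

End Core.

Lemma biconnected_deg (G : sgraph) (v : G) : biconnected G -> 2 < #|G| ->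
  1 < #|nbrs v|.
Proof.
move=> conn G2.
have nbr_avoid x : x != v -> exists2 u, u \in nbrs v & u != x.
  move=> xv; have [z zvx] : exists z, z \notin [set v; x].
    apply/existsP; rewrite -negb_forall; apply/negP=> /forallP H.
    have : #|G| <= #|[set v; x]| by apply: subset_leq_card; apply/subsetP=> z _.
    by rewrite cards2 leqNgt; apply/negP; rewrite negbK (leq_trans _ G2) //; case: (_
      != _).
  move: zvx; rewrite !inE negb_or => /andP[zv zx].
  have /connectP[[|u p] /= ep ez] := conn x v z ltac:(by rewrite eq_sym) zx.
    by rewrite ez eqxx in zv.
  by move: ep => /andP[/and3P[vu _ ux] _]; exists u; rewrite ?inE.
have [x xv] : exists x, x != v.
  apply/existsP; rewrite -negb_forall; apply/negP=> /forallP H.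
  have : #|G| <= #|[set v]| by apply: subset_leq_card; apply/subsetP=> z _; rewrite inE.
  by rewrite cards1 leqNgt (ltn_trans _ G2).
have [u1 u1v u1x] := nbr_avoid x xv.
have [|u2 u2v u21] := nbr_avoid u1.
  by apply: contraTneq u1v => ->; rewrite inE adj_irrefl.
have : #|[set u1; u2]| <= #|nbrs v|.
  by apply: subset_leq_card; rewrite subUset !sub1set u1v.
by rewrite cards2 eq_sym u21.
Qed.

Lemma count_in (T : finType) (A : {set T}) (a : pred T) (s : seq T) : uniq s ->
  {in A, forall z, a z && (z \in s)} -> #|A| <= count a s.
Proof.
move=> us H; rewrite -size_filter -(card_uniqP (filter_uniq a us)).
apply: subset_leq_card; apply/subsetP=> z /H; by rewrite mem_filter.
Qed.

(* A longest path between a non-adjacent pair contains all the neighbours of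
   its ends in H1 and in H2, respectively. *)
Lemma saturated_adj (G : sgraph) k d1 d2 (H1 H2 : {set G}) : 2 < k ->
  biconnected G -> no_cycle_ge k G ->
  (forall x y : G, x != y -> ~~ adj x y -> long_path k (@adj G) x y) ->
  {in H1, forall x, d1 <= #|nbrs x :&: H1|} ->
  {in H2, forall y, d2 <= #|nbrs y :&: H2|} ->
  k <= d1 + d2 -> {in H1 & H2, forall x y, x != y -> adj x y}.
Proof.
move=> k2 conn nG sat D1 D2 kd x y xH yH xy; apply: contraT => nxy.
have /long_pathP[p [ep up kp]] := sat x y xy nxy.
have [n] := ubnP (#|G| - size p).
elim: n x y p xH yH xy nxy ep up kp => // n IHn x y p xH yH xy nxy ep up kp lt_n.
have sp : size p < #|G|.
  have := max_card [in x :: rcons p y]; rewrite (card_uniqP up) /= size_rcons.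
  by apply: leq_trans; rewrite ltnW.
have ec z : z \notin x :: rcons p y -> adj x z -> adj y z -> false.
  move=> zp xz yz; have cz : is_cycle (z :: x :: rcons p y).
    apply/and3P; split; [by rewrite /= size_rcons | by rewrite cons_uniq zp up |].
    by rewrite /= (adj_sym z) xz rcons_path ep last_rcons.
  by have := nG _ cz; rewrite /= size_rcons ltnNge (leq_trans kp).
case: (boolP [exists z in nbrs x :&: H1, z \notin x :: rcons p y]).
  move=> /exists_inP[z]; rewrite !inE => /andP[xz zH]; rewrite -in_cons => zp.
  have zy : z != y by apply: contraNneq zp => ->; rewrite inE mem_rcons mem_head orbT.
  case: (boolP (adj z y)) => [zy'|nzy]; first by have := ec z zp xz; rewrite adj_sym
    zy' => /(_ isT).
  apply: (IHn z y (x :: p)) => //.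
  - by rewrite /= adj_sym xz ep.
  - by rewrite rcons_cons cons_uniq zp up.
  - by rewrite (leq_trans kp) //= ltnW.
  - by move: lt_n sp; clear => /=; lia.
rewrite negb_exists_in => /forall_inP N1.
case: (boolP [exists z in nbrs y :&: H2, z \notin x :: rcons p y]).
  move=> /exists_inP[z]; rewrite !inE => /andP[yz zH]; rewrite -in_cons => zp.
  have xz : x != z by apply: contraNneq zp => <-; rewrite mem_head.
  case: (boolP (adj x z)) => [xz'|nxz]; first by have := ec z zp xz' yz.
  apply: (IHn x z (rcons p y)) => //.
  - by rewrite rcons_path ep last_rcons.
  - by rewrite -rcons_cons rcons_uniq zp up.
  - by rewrite size_rcons (leq_trans kp) //= ltnW.
  - by move: lt_n sp; rewrite size_rcons; clear => /=; lia.
rewrite negb_exists_in => /forall_inP N2.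
have [|||c cc kc] := @posa G conn k x (rcons p y) k2 ep up.
- by case: (p).
- by rewrite /= size_rcons.
- rewrite last_rcons; apply: leq_trans kd _; apply: leq_add.
    apply: leq_trans (D1 x xH) _; apply: count_in => // z zH.
    by have := N1 z zH; move: zH; rewrite in_setI in_nbrs negbK => /andP[-> _].
  apply: leq_trans (D2 y yH) _; apply: count_in => // z zH.
  by have := N2 z zH; move: zH; rewrite in_setI in_nbrs negbK => /andP[-> _].
by have := nG c cc; rewrite ltnNge kc.
Qed.

(** As 2(d + 1) >= k, [saturated_adj] makes H = [core G d] a clique. With a = k - #|H|, the degrees
    #|H| - 1 in H and a + 1 in [core G a] add up to k, so these two sets are completely joined. A
    vertex of [core G a] outside H could then be added to H, against its maximality. *)
Lemma kopylov_saturated (G : sgraph) k : 3 < k -> k <= #|G| ->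
  biconnected G -> no_cycle_ge k G ->
  (forall x y : G, x != y -> ~~ adj x y -> long_path k (@adj G) x y) ->
  let d := (k - 1)./2 in
  core G d = set0 \/
  exists a, [/\ core G a = core G d, #|core G d| + a = k, 1 < a & a + d + 2 <= k].
Proof.
move=> k3 kG conn nG sat d; have k2 : 2 < k by apply: ltnW.
have kd : k <= d.+1 + d.+1 by rewrite /d; lia.
case: (set_0Vmem (core G d)) => [->|[v vH]]; [by left | right].
have qH : is_clique (core G d).
  apply/cliqueP; apply: (@saturated_adj _ k d.+1 d.+1) => // x; exact: core_deg.
have degH x : x \in core G d -> #|nbrs x :&: core G d|.+1 = #|core G d|.
  move=> xH; rewrite [RHS](cardsD1 x) xH add1n; congr _.+1.
  apply: eq_card => z; rewrite !inE; case: (boolP (z \in core G d)) => zH; rewrite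
    ?andbF // !andbT.
  have [->|zx] := eqVneq z x; first by rewrite adj_irrefl.
  by move/cliqueP: qH; apply; rewrite // eq_sym.
have dH : d.+2 <= #|core G d| by rewrite -(degH v vH) ltnS core_deg.
have d0 : 0 < d by rewrite /d; lia.
have Hk : #|core G d| < k.
  rewrite ltnNge; apply/negP=> kH; have [|p cp sp] := clique_cycle qH; first by lia.
  by have := nG p cp; rewrite sp ltnNge kH.
exists (k - #|core G d|).
have ak : k - #|core G d| <= d by lia.
have ea : core G (k - #|core G d|) = core G d.
  apply/eqP; rewrite eqEsubset; apply/andP; split; last first.
    by apply: core_max => x xH; have := degH x xH; lia.
  have adjH : {in core G d & core G (k - #|core G d|), forall x y, x != y -> adj x y}.
    apply: (@saturated_adj _ k #|core G d|.-1 (k - #|core G d|).+1) => //.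
    - by move=> x xH; rewrite -(degH x xH).
    - by move=> x; apply: core_deg.
    - by lia.
  apply/subsetP=> y yH'; apply: contraT => yH.
  have : y |: core G d \subset core G d.
    apply: core_max => x; rewrite in_setU1 => /orP[/eqP->|xH].
      suff : core G d \subset nbrs y :&: (y |: core G d).
        by move/subset_leq_card; apply: leq_trans; apply: ltnW.
      apply/subsetP=> z zH; rewrite !inE zH orbT andbT adj_sym.
      by apply: adjH => //; apply: contraNneq yH => <-.
    by apply: leq_trans (core_deg xH) _; apply: subset_leq_card; rewrite setIS //
      subsetUr.
  by move/subsetP/(_ y); rewrite setU11 (negPf yH) => /(_ isT).
split=> //; try lia.
(* For a <= 1, minimum degree 2 would put all vertices, at least k of them, into a core with fewer
   than k vertices. *)
rewrite ltnNge; apply/negP=> a1.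
have : [set: G] \subset core G (k - #|core G d|).
  apply: core_max => x _; rewrite setIT; apply: leq_ltn_trans a1 _.
  by apply: biconnected_deg => //; apply: leq_trans kG.
by rewrite ea => /subset_leq_card; rewrite cardsT leqNgt (leq_trans Hk).
Qed.

(* The vertex degrees of the saturated graph bound those of G, so the order in
   which its vertices are peeled off serves G as well. *)
Lemma kopylov (G : sgraph) k : 3 < k -> k <= #|G| ->
  biconnected G -> no_cycle_ge k G ->
  exists (W : {set G}) a,
  (forall U : {set G}, W \proper U ->
     exists2 v, v \in U :\: W & #|nbrs v :&: U| <= a) /\
  ((W = set0 /\ a = (k - 1)./2) \/
   [/\ #|W| + a = k, 1 < a & a + (k - 1)./2 + 2 <= k]).
Proof.
move=> k3 kG conn nG.
have [e [es [ei [sub ne sat]]]] := saturate (ltnW k3) nG.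
pose H := SGraph es ei.
have connH : biconnected H.
  move=> v x y xv yv; apply: connect_sub (conn v x y xv yv) => a b /and3P[/sub eab av bv].
  by apply: connect1; rewrite /= eab av.
have peel a (U : {set G}) : core H a \proper U ->
    exists2 v, v \in U :\: core H a & #|nbrs v :&: U| <= a.
  move=> /core_peel[v vU le]; exists v => //; apply: leq_trans le.
  by apply: subset_leq_card; apply: setSI; apply/subsetP=> u; rewrite !inE => /sub.
case: (@kopylov_saturated H k k3 kG connH ne sat) => [H0|[a [ea H1 H2 H3]]].
  exists (core H (k - 1)./2), (k - 1)./2; split; [exact: peel | by left].
by exists (core H a), a; split; [exact: peel | right; rewrite ea].
Qed.

Section Degenerate.
Variables (G : sgraph) (W : {set G}) (a : nat).
Hypothesis peel : forall U : {set G}, W \proper U ->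
  exists2 v, v \in U :\: W & #|nbrs v :&: U| <= a.

Lemma peel_ind (Q : {set G} -> Prop) : Q W ->
  (forall (U : {set G}) v, W \subset U :\ v -> v \in U -> #|nbrs v :&: U| <= a ->
     Q (U :\ v) -> Q U) ->
  forall U : {set G}, W \subset U -> Q U.
Proof.
move=> QW step U; have [n] := ubnP #|U|; elim: n U => // n IHn U lt_n WU.
have [<-//|neq] := eqVneq W U.
have [|v] := peel (U := U); first by rewrite properEneq neq.
rewrite inE => /andP[vW vU] dv.
have WUv : W \subset U :\ v by rewrite subsetD1 WU.
apply: (step U v) => //; apply: IHn => //.
by move: lt_n; rewrite [#|U|](cardsD1 v) vU.
Qed.

(** Deleting a vertex of degree d <= a destroys d edges and at most ['C(d, j)] cliques; [bin_chord]
    compares this ratio with the one for a. *)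
Lemma ncl_degenerate j (U : {set G}) : 0 < j -> W \subset U ->
  a * ncl U j.+1 + ncl W 2 * 'C(a, j) <= a * ncl W j.+1 + ncl U 2 * 'C(a, j).
Proof.
move=> j0; move: U; apply: peel_ind => // U v WU vU dv.
rewrite (ncl_del j vU) (ncl_del 1 vU) ncl1.
have := bin_chord j0 dv; have := ncl_le_bin (nbrs v :&: U) j; nia.
Qed.

End Degenerate.

Lemma ncl_edgeless (G : sgraph) (U : {set G}) t : 2 <= t -> ncl U 2 = 0 -> ncl U t = 0.
Proof.
rewrite leq_eqVlt => /orP[/eqP<-//|t2 e]; apply/eqP; rewrite -leqn0.
rewrite (leq_trans (kruskal_katona U t2)) // e.
by have := @kcolex_bin t 0 ltac:(lia); rewrite !bin0n => ->; lia.
Qed.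

(** The first vertex to bring edges brings no clique on j + 1 >= 3 vertices. Strictness has to be
    gained here because [kextr_degenerate] can be an equality. *)
Lemma ncl_degenerate_lt (G : sgraph) a j (U : {set G}) :
  (forall U : {set G}, set0 \proper U ->
     exists2 v, v \in U :\: set0 & #|nbrs v :&: U| <= a) ->
  1 < j -> 0 < 'C(a, j) -> 0 < ncl U 2 ->
  a * ncl U j.+1 < ncl U 2 * 'C(a, j).
Proof.
move=> peel j1 c0; have : set0 \subset U by apply: sub0set.
move: U; apply: (peel_ind peel) => [|U v _ vU dv IH].
  by rewrite lt0n => /eqP[]; apply/eqP; rewrite -leqn0 (leq_trans (ncl_le_bin _ _)) //
    cards0.
have sub : nbrs v :&: U \subset U :\ v.
  by apply/subsetP=> u; rewrite !inE => /andP[uv ->]; rewrite andbT; apply: contraTneq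
    uv => ->; rewrite adj_irrefl.
rewrite (ncl_del j vU) (ncl_del 1 vU) ncl1 => e0.
have := @bin_chord _ _ j ltac:(lia) dv; have := ncl_le_bin (nbrs v :&: U) j.
case: (posnP (ncl (U :\ v) 2)) => [e'|/IH]; last by nia.
have -> : ncl (U :\ v) j.+1 = 0 by apply: ncl_edgeless => //; lia.
have -> : ncl (nbrs v :&: U) j = 0.
  apply: ncl_edgeless => //; apply/eqP; rewrite -leqn0.
  by rewrite (leq_trans (ncl_mono 2 sub)) // e'.
by rewrite e' in e0 *; rewrite !add0n muln0 muln_gt0 c0 => _ _; rewrite e0.
Qed.

Lemma kextr_gt0 t K m : 1 < t <= K -> 'C(K, 2) <= m -> 0 < kextr t K m.
Proof.
move=> /andP[t1 tK] Mm; rewrite ltn_addr // muln_gt0 bin_gt0 tK andbT divn_gt0 //.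
by rewrite bin_gt0; lia.
Qed.

Lemma biconnected_bound (G : sgraph) k t : 2 < t < k -> k <= #|G| ->
  biconnected G -> no_cycle_ge k G -> 'C(k - 1, 2) <= ncl [set: G] 2 ->
  ncl [set: G] t < kextr t (k - 1) (ncl [set: G] 2).
Proof.
case: t => // j /andP[j1 jk] kG conn nG Mm.
have k3 : 3 < k by lia.
have [W [a [peel HW]]] := kopylov k3 kG conn nG.
have le := ncl_degenerate peel (ltnW j1) (subsetT W).
case: HW => [[eW ea]|[hW a1 ad]].
  have a0 : 0 < a by rewrite ea; lia.
  have aK : a.*2 <= k - 1 by rewrite ea; lia.
  have W0 t' : 0 < t' -> ncl W t' = 0.
    move=> t0; apply/eqP; rewrite -leqn0 (leq_trans (ncl_le_bin _ _)) // eW cards0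
      bin0n; lia.
  rewrite !W0 // in le.
  (* If j > a, peeling leaves no room for a clique on j + 1 vertices, while the extremal number is
     positive. *)
  case: (posnP 'C(a, j)) => [c0|c0].
    have -> : ncl [set: G] j.+1 = 0 by rewrite c0 in le; nia.
    by apply: kextr_gt0 => //; lia.
  rewrite eW in peel.
  have := @ncl_degenerate_lt G a j [set: G] peel j1 c0.
  have := kextr_degenerate j1 a0 aK Mm.
  have M0 : 0 < 'C(k - 1, 2) by rewrite bin_gt0; lia.
  move=> H1 /(_ (leq_trans M0 Mm)) H2; have := leq_trans H2 H1.
  by rewrite ltn_pmul2l.
have aK : a.*2 < k - 1 by lia.
have eh : #|W| = k - 1 - a.-1 by lia.
have xh : ncl W 2 <= 'C(k - 1 - a.-1, 2) by rewrite -eh ncl_le_bin.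
have xm : ncl W 2 <= ncl [set: G] 2 by apply: ncl_mono; apply: subsetT.
have := @kextr_core a (k - 1) j _ _ ltac:(lia) a1 aK xh xm Mm.
have := kruskal_katona W (j1 : 2 < j.+1).
by move=> kk lt; rewrite -(@ltn_pmul2l a) ?(ltnW a1) //; nia.
Qed.

(** * Equivalence of graphs *)

Lemma num_cliquesE (G : sgraph) t : num_cliques t G = ncl [set: G] t.
Proof. by apply: eq_card => K; rewrite !inE subsetT. Qed.

Lemma card_edges (G : sgraph) : #|edges G| = num_cliques 2 G.
Proof.
apply: eq_card => e; rewrite !inE; apply/existsP/andP.
  move=> [x /existsP[y /andP[xy /eqP->]]].
  have nxy : x != y by apply: contraTneq xy => ->; rewrite adj_irrefl.
  rewrite cards2 nxy; split=> //; apply/cliqueP=> u v; rewrite !inE.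
  by move=> /orP[]/eqP-> /orP[]/eqP->; rewrite ?eqxx // adj_sym.
move=> [/cards2P[x [y [xy ->]]] /cliqueP q]; exists x; apply/existsP; exists y.
by rewrite eqxx andbT; apply: q; rewrite ?set21 ?set22.
Qed.

Lemma edgesP (G : sgraph) (e : {set G}) :
  reflect (exists x y, adj x y /\ e = [set x; y]) (e \in edges G).
Proof.
rewrite inE; apply: (iffP existsP) => [[x /existsP[y /andP[xy /eqP->]]]|[x [y [xy ->]]]].
  by exists x, y.
by exists x; apply/existsP; exists y; rewrite xy eqxx.
Qed.

Lemma adj_edge (G : sgraph) (x y : G) : ([set x; y] \in edges G) = adj x y.
Proof.
apply/edgesP/idP => [[u [v [uv e]]]|xy]; last by exists x, y.
by have [[-> ->]|[-> ->]] := set2_eq e; rewrite // adj_sym.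
Qed.

Lemma isomorphic_sym (F G : sgraph) : isomorphic F G -> isomorphic G F.
Proof.
move=> [f [g fK gK] fa]; exists g; first by exists f.
by move=> x y; rewrite -fa !gK.
Qed.

Lemma isomorphic_trans (F G H : sgraph) :
  isomorphic F G -> isomorphic G H -> isomorphic F H.
Proof.
move=> [f bf fa] [g bg ga]; exists (g \o f); first exact: bij_comp.
by move=> x y /=; rewrite ga fa.
Qed.

Lemma equiv_graph_refl (G : sgraph) : equiv_graph G G.
Proof. by exists id => //; exists id. Qed.

Lemma equiv_graph_sym (F G : sgraph) : equiv_graph F G -> equiv_graph G F.
Proof. exact: isomorphic_sym. Qed.

Lemma equiv_graph_trans (F G H : sgraph) :
  equiv_graph F G -> equiv_graph G H -> equiv_graph F H.
Proof. exact: isomorphic_trans. Qed.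

(** Surjectivity up to isolated vertices lets such a map witness [equiv_graph] without handling the
    sigma types of [induced]. *)
Definition embedding (F G : sgraph) (f : F -> G) : Prop :=
  [/\ injective f, forall x y, adj (f x) (f y) = adj x y &
      forall x, x \in non_isolated G -> exists y, f y = x].

Lemma embedding_equiv (F G : sgraph) (f : F -> G) :
  embedding f -> equiv_graph F G.
Proof.
move=> [injf fa fs].
have fN x : (f x \in non_isolated G) = (x \in non_isolated F).
  rewrite !inE; apply/existsP/existsP => [[y xy]|[y xy]].
    have [|z ez] := fs y; first by rewrite inE; apply/existsP; exists (f x); rewrite
      adj_sym.
    by exists z; rewrite -fa ez.
  by exists (f y); rewrite fa.
pose g (x : induced (non_isolated F)) : induced (non_isolated G) :=
  exist _ (f (val x)) (etrans (fN (val x)) (valP x)).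
exists g; last by move=> x y; rewrite /= /induced_adj /= fa.
apply: inj_card_bij => [x y /(congr1 val) /= /injf/val_inj //|].
rewrite !card_sig; rewrite -(card_imset (mem (non_isolated F)) injf).
apply: subset_leq_card; apply/subsetP=> x xN; have [y ey] := fs x xN.
by rewrite -ey in xN *; apply: imset_f; move: xN; rewrite fN.
Qed.

Lemma num_cliques_embedding (F G : sgraph) (f : F -> G) t : 1 < t ->
  embedding f -> num_cliques t F = num_cliques t G.
Proof.
move=> t1 [injf fa fs].
rewrite /num_cliques -(card_imset _ (imset_inj injf)); apply: eq_card => K.
apply/imsetP/idP => [[L + ->]|].
  rewrite !inE card_imset // => /andP[-> /cliqueP q] /=; apply/cliqueP=> x y.
  move=> /imsetP[u uL ->] /imsetP[v vL ->] uv; rewrite fa; apply: q => //.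
  by apply: contraNneq uv => ->.
rewrite !inE => /andP[/eqP cK /cliqueP q].
have eK : K = f @: (f @^-1: K).
  apply/setP=> x; apply/idP/imsetP => [xK|[y + ->]]; last by rewrite inE.
  have : 0 < #|K :\ x| by move: cK; rewrite (cardsD1 x K) xK; lia.
  move=> /card_gt0P[z /setD1P[zx zK]].
  have [|y ey] := fs x; last by exists y; rewrite ?inE ?ey.
  by rewrite inE; apply/existsP; exists z; apply: q; rewrite // eq_sym.
exists (f @^-1: K) => //; rewrite inE -(card_imset _ injf) -eK cK eqxx /=.
apply/cliqueP=> x y; rewrite !inE => xK yK xy; rewrite -fa; apply: q => //.
by apply: contraNneq xy => /injf->.
Qed.

Lemma embedding_val (G : sgraph) (C : {set G}) : non_isolated G \subset C ->
  embedding (val : induced C -> G).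
Proof.
move=> /subsetP s; split=> [||x /s xC]; [exact: val_inj | by [] |].
by exists (exist _ x xC).
Qed.

Lemma num_cliques_equiv (F G : sgraph) t : 1 < t ->
  equiv_graph F G -> num_cliques t F = num_cliques t G.
Proof.
move=> t1 [f [g fK gK] fa].
have e1 := num_cliques_embedding t1 (embedding_val (subxx (non_isolated F))).
have e2 := num_cliques_embedding t1 (embedding_val (subxx (non_isolated G))).
rewrite -e1 -e2; apply: (@num_cliques_embedding _ _ f) => //.
by split=> //; [exact: can_inj fK | move=> x _; exists (g x)].
Qed.

Section EdgeSets.
Variable G : sgraph.
Implicit Types (D : {set {set G}}).

(* The edge graph of D on the whole vertex set of G. *)
Definition spanned_adj D : rel G := fun x y => (x != y) && ([set x; y] \in D).
Fact spanned_sym D : symmetric (spanned_adj D).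
Proof. by move=> x y; rewrite /spanned_adj eq_sym setUC. Qed.
Fact spanned_irrefl D : irreflexive (spanned_adj D).
Proof. by move=> x; rewrite /spanned_adj eqxx. Qed.
Definition spanned D : sgraph := SGraph (spanned_sym D) (spanned_irrefl D).

Lemma embedding_edge_graph D : embedding (val : edge_graph D -> spanned D).
Proof.
split=> [||x]; [exact: val_inj | by [] |].
rewrite inE => /existsP[y /andP[_ xyD]].
have xD : x \in cover D by apply/bigcupP; exists [set x; y]; rewrite ?set21.
by exists (exist _ x xD).
Qed.

Lemma edges_spanned D : D \subset edges G -> edges (spanned D) = D.
Proof.
move=> /subsetP s; apply/setP=> e; apply/(@edgesP (spanned D))/idP.
  by move=> [x [y [/andP[_ xyD] ->]]].
move=> eD; have /edgesP[x [y [xy ee]]] := s e eD; exists x, y; split=> //.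
rewrite /= /spanned_adj -ee eD andbT; apply: contraTneq xy => ->.
by rewrite adj_irrefl.
Qed.

End EdgeSets.

(** * Blocks *)

Lemma card_le1_inj (T : finType) (A : {set T}) x y :
  #|A| <= 1 -> x \in A -> y \in A -> x = y.
Proof. by move=> /card_le1_eqP H xA yA; apply: H. Qed.

Lemma coverU (T : finType) (P Q : {set {set T}}) : cover (P :|: Q) = cover P :|: cover Q.
Proof. exact: bigcup_setU. Qed.

Lemma cover_sub (T : finType) (P Q : {set {set T}}) : P \subset Q -> cover P \subset
  cover Q.
Proof. by move=> s; apply/bigcupsP=> A AP; apply: bigcup_sup; apply: (subsetP s). Qed.

Section Blocks.
Variable T : finType.
Implicit Types (D B : {set {set T}}) (P : {set {set {set T}}}) (rho : {set {set T}} ->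
  nat).

(** For sets of edges of a graph this plays the role of 2-connectedness, single edges included. *)
Definition inseparable B : Prop := B != set0 /\
  forall B1, B1 \subset B -> B1 != set0 -> B1 != B ->
    1 < #|cover B1 :&: cover (B :\: B1)|.

(** Take a smallest nonempty B attached to the rest in at most one vertex. If B split into parts
    sharing at most one vertex, minimality would make each part meet D :\: B, necessarily in the
    same vertex. That vertex would be the one shared by the parts, so the first part would be
    attached only there, against minimality. *)
Lemma end_block D : D != set0 -> exists B, [/\ B \subset D, inseparable B &
  #|cover B :&: cover (D :\: B)| <= 1].
Proof.
move=> D0; pose Q B := [&& B != set0, B \subset D & #|cover B :&: cover (D :\: B)| <= 1].
have QD : Q D.
  by rewrite /Q D0 subxx setDv /cover big_set0 setI0 cards0.
case: (arg_minnP (fun B => #|B|) QD) => B /and3P[B0 BD cB] Bmin.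
exists B; split=> //; split=> // B1 B1B B10 B1n; rewrite ltnNge; apply/negP=> c1.
have B1p : #|B1| < #|B| by apply: proper_card; rewrite properEneq B1n.
have B2p : #|B :\: B1| < #|B|.
  apply: proper_card; rewrite properEneq subsetDl andbT.
  apply: contraNneq B10 => e; rewrite -subset0; apply/subsetP=> x xB1.
  by have := subsetP B1B x xB1; rewrite -e inE xB1.
have B20 : B :\: B1 != set0.
  by apply: contraNneq B1n => /eqP; rewrite setD_eq0 eqEsubset B1B.
set B2 := B :\: B1 in c1 B2p B20 *.
have D1 : D :\: B1 \subset B2 :|: (D :\: B).
  by apply/subsetP=> x; rewrite !inE => /andP[-> ->]; rewrite andbT /= orbN.
have D2 : D :\: B2 \subset B1 :|: (D :\: B).
  by apply/subsetP=> x; rewrite !inE negb_and negbK => /andP[/orP[->//|->] ->]; rewrite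
    orbT.
have X1 : cover B1 \subset cover B by apply: cover_sub.
have X2 : cover B2 \subset cover B by apply: cover_sub; apply: subsetDl.
have nQ B' : B' != set0 -> B' \subset B -> #|B'| < #|B| -> 1 < #|cover B' :&: cover (D
  :\: B')|.
  move=> B'0 B'B; rewrite [in X in X -> _]ltnNge ltnNge; apply: contra => c.
  by apply: Bmin; rewrite /Q B'0 c (subset_trans B'B BD).
have n1 := nQ _ B10 B1B B1p; have n2 := nQ _ B20 (subsetDl _ _) B2p.
have [x1 x1P] : exists x1, x1 \in cover B1 :&: cover (D :\: B).
  apply/set0Pn; apply: contraTneq n1 => e; rewrite -leqNgt.
  apply: leq_trans c1; apply: subset_leq_card.
  apply: subset_trans (setIS _ (cover_sub D1)) _.
  by rewrite coverU setIUr e setU0.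
have [x2 x2P] : exists x2, x2 \in cover B2 :&: cover (D :\: B).
  apply/set0Pn; apply: contraTneq n2 => e; rewrite -leqNgt.
  apply: leq_trans c1; rewrite setIC; apply: subset_leq_card; rewrite setIC.
  apply: subset_trans (setIS _ (cover_sub D2)) _.
  by rewrite coverU setIUr e setU0 setIC.
have XX x : x \in cover B :&: cover (D :\: B) -> x = x1.
  by move=> xX; apply: (card_le1_inj cB) => //; apply: (subsetP (setSI _ X1)).
have e21 : x2 = x1 by apply: XX; apply: (subsetP (setSI _ X2)).
have x1Y : x1 \in cover B1 :&: cover B2.
  by move: x1P x2P; rewrite e21 !inE => /andP[-> _] /andP[-> _].
move: n1; rewrite ltnNge => /negP[]; apply: leq_trans c1; apply: subset_leq_card.
apply: subset_trans (setIS _ (cover_sub D1)) _.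
rewrite coverU setIUr subUset subxx /=; apply/subsetP=> x xP.
by rewrite (XX x) // (subsetP (setSI _ X1)).
Qed.

(** An order of construction takes the place of the block tree: rho ranks the blocks so that each is
    a leaf at the moment it is added. *)
Definition block_decomposition D P rho : Prop :=
  [/\ partition P D, {in P, forall B, inseparable B}, {in P &, injective rho} &
   {in P, forall B, #|cover B :&: \bigcup_(B' in P | rho B' < rho B) cover B'| <= 1}].

Lemma block_decomposition_exists D : exists P rho, block_decomposition D P rho.
Proof.
have [n] := ubnP #|D|; elim: n D => // n IHn D lt_n.
have [->|D0] := eqVneq D set0.
  exists set0, (fun=> 0); split=> [|B|B|B]; rewrite ?inE //.
  by rewrite /partition /trivIset /cover !big_set0 cards0 eqxx inE.
have [B [BD iB cB]] := end_block D0.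
have lt_DB : #|D :\: B| < #|D|.
  apply: proper_card; rewrite properEneq subsetDl andbT.
  case: iB => /set0Pn[x xB] _; apply: contraTneq xB => e.
  by apply/negP=> xB; have := subsetP BD x xB; rewrite -e inE xB.
have [P [rho [/and3P[/eqP cP tP P0] iP injP rP]]] := IHn _ (leq_trans lt_DB lt_n).
have disB B' : B' \in P -> [disjoint B & B'].
  move=> B'P; rewrite -setI_eq0; apply/eqP/setP=> e; rewrite !inE.
  apply/negP=> /andP[eB eB'].
  have : e \in D :\: B by rewrite -cP; apply/bigcupP; exists B'.
  by rewrite inE eB.
have [tBP BP] := trivIsetU1 disB tP P0.
(* The end block is ranked above all blocks of the rest. *)
pose M := \max_(B' in P) rho B'.
pose r B' := if B' == B then M.+1 else rho B'.
have rP' B' : B' \in P -> (r B' = rho B') * (r B' < M.+1).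
  move=> B'P; have -> : r B' = rho B'.
    by rewrite /r; case: eqVneq => // e; rewrite -e B'P in BP.
  by rewrite ltnS leq_bigmax_cond.
have rB : r B = M.+1 by rewrite /r eqxx.
exists (B |: P), r; split.
- apply/and3P; split=> //.
    by rewrite coverU cP /cover big_set1 setDE setUIr setUCr setIT; apply/eqP/setUidPr.
  by rewrite in_setU1 negb_or P0 andbT eq_sym; case: iB.
- by move=> B'; rewrite in_setU1 => /orP[/eqP->|/iP].
- move=> B1 B2; rewrite !in_setU1 => /orP[/eqP->|P1] /orP[/eqP->|P2] //.
  + by rewrite rB => e; have := (rP' B2 P2).2; rewrite -e ltnn.
  + by rewrite rB => e; have := (rP' B1 P1).2; rewrite e ltnn.
  + by rewrite (rP' _ P1).1 (rP' _ P2).1; apply: injP.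
move=> B'; rewrite in_setU1 => /orP[/eqP->|P1].
  apply: leq_trans cB; apply: subset_leq_card; apply: setIS.
  apply/bigcupsP=> B2; rewrite in_setU1 => /andP[/orP[/eqP->|P2]]; first by rewrite ltnn.
  by move=> _; rewrite -cP; apply/subsetP=> x /bigcupP[e eB2 xe]; apply/bigcupP; exists
    e => //; apply/bigcupP; exists B2.
apply: leq_trans (rP B' P1); apply: subset_leq_card; apply: setIS.
apply/bigcupsP=> B2; rewrite in_setU1 => /andP[/orP[/eqP->|P2]].
  by rewrite rB ltnNge ltnW // (rP' _ P1).2.
by rewrite (rP' _ P1).1 (rP' _ P2).1 => lt; apply: bigcup_sup; rewrite P2.
Qed.

Section Decomposition.
Variables (D : {set {set T}}) (P : {set {set {set T}}}) (rho : {set {set T}} -> nat).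
Hypothesis dec : block_decomposition D P rho.

Lemma block_meet B B1 B2 x1 x2 : B \in P -> B1 \in P -> B2 \in P ->
  rho B1 < rho B -> rho B2 < rho B -> x1 \in cover B -> x2 \in cover B ->
  x1 \in cover B1 -> x2 \in cover B2 -> x1 = x2.
Proof.
case: dec => _ _ _ rP BP P1 P2 r1 r2 x1B x2B x1B1 x2B2.
apply: (card_le1_inj (rP B BP)); rewrite inE ?x1B ?x2B; apply/bigcupP.
  by exists B1; rewrite ?P1.
by exists B2; rewrite ?P2.
Qed.

Lemma block_pair B B' : B \in P -> B' \in P -> B != B' ->
  #|cover B :&: cover B'| <= 1.
Proof.
wlog lt : B B' / rho B' < rho B.
  move=> W BP B'P n; case: (ltngtP (rho B) (rho B')) => [lt|lt|e].
  - by rewrite setIC; apply: W => //; rewrite eq_sym.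
  - exact: W.
  - by case: dec => _ _ inj _; rewrite (inj _ _ BP B'P e) eqxx in n.
move=> BP B'P _; apply/card_le1_eqP=> x y; rewrite !inE => /andP[xB xB'] /andP[yB yB'].
exact: (block_meet BP B'P B'P lt lt).
Qed.

(** On a cycle, the block of highest rank has two distinct vertices as neighbours, and each lies in
    a block of smaller rank; [block_meet] forbids this. *)
Lemma block_forest (I : finType) (E : I -> {set {set T}}) : injective E ->
  (forall i, E i \in P) -> is_forest (incidence_graph (fun i => cover (E i))).
Proof.
move=> injE EP p; apply/negP=> /and3P[p2 up cp].
have [i0 i0p] : exists i, inl i \in p.
  case: p p2 cp {up} => [|[i|x] [|[j|y] p]] //= _; first by exists i; rewrite mem_head.
  by exists j; rewrite !inE eqxx orbT.
case: (@arg_maxnP _ i0 (fun i => inl i \in p) (fun i => rho (E i)) i0p) => i ip imax.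
have [k s es] := rot_to ip.
have us : uniq (inl i :: s) by rewrite -es rot_uniq.
have cs : cycle (@adj (incidence_graph (fun i => cover (E i)))) (inl i :: s).
  by rewrite -es rot_cycle.
have lt_i j : inl j \in s -> rho (E j) < rho (E i).
  move=> js; have ji : j != i by apply: contraTneq js => ->; case/andP: us.
  have -> : rho (E j) < rho (E i) = (rho (E j) != rho (E i)).
    have jp : inl j \in p by rewrite -(mem_rot k) es inE js orbT.
    by rewrite ltn_neqAle (imax j jp : rho (E j) <= rho (E i)) andbT.
  apply: contraNneq ji => e; apply/eqP/injE.
  by case: dec => _ _ inj _; exact: (inj _ _ (EP j) (EP i) e).
have : 2 < size (inl i :: s) by rewrite -es size_rot.
case: s es us cs lt_i => [|[?|x] [|[j|?] s]] //= es us cs lt_i _; last by case/andP: cs.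
case/lastP: s es us cs lt_i => [|s z] es us cs lt_i; first by case/and4P: cs.
move: cs; rewrite !rcons_path last_rcons => /and3P[xi xj /andP[/andP[_ lz] zi]].
case: z lz zi es us lt_i => [?|y] // lz yi es us lt_i.
have : last (inl j) s \in inl j :: s by apply: mem_last.
case: (last _ s) lz => [l yl ls|//].
suff xy : x = y by case/and3P: us => _ + _; rewrite xy in_cons mem_rcons mem_head.
apply: (@block_meet (E i) (E j) (E l)) => //; apply: lt_i.
  by rewrite !inE eqxx orbT.
by rewrite inE -rcons_cons mem_rcons inE ls !orbT.
Qed.

(* A triangle spread over several blocks would meet the blocks preceding its
   last one in two vertices. *)
Lemma block_triangle x y z B1 B2 B3 : x != y -> y != z -> x != z ->
  B1 \in P -> B2 \in P -> B3 \in P ->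
  [set x; y] \in B1 -> [set y; z] \in B2 -> [set x; z] \in B3 -> B1 = B2.
Proof.
have inc (u v : T) B : [set u; v] \in B -> (u \in cover B) * (v \in cover B).
  by move=> e; split; apply/bigcupP; exists [set u; v]; rewrite ?set21 ?set22.
move=> xy yz xz P1 P2 P3 e1 e2 e3.
case: dec => _ _ inj _.
have [e12 e21] := inc _ _ _ e1; have [e22 e23] := inc _ _ _ e2.
have [e31 e33] := inc _ _ _ e3.
apply: (inj _ _ P1 P2); apply/eqP; apply: contraT; rewrite neq_ltn.
case: (ltngtP (rho B1) (rho B3)) => [l13|l31|e13]; case/orP=> [l12|l21].
- case: (ltngtP (rho B2) (rho B3)) => [l|l|e].
  + by rewrite (block_meet P3 P1 P2 l13 l e31 e33 e12 e23) eqxx in xz.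
  + by rewrite (block_meet P2 P1 P3 l12 l e22 e23 e21 e33) eqxx in yz.
  + rewrite (inj _ _ P2 P3 e) in e22 e23.
    by rewrite (block_meet P3 P1 P1 l13 l13 e31 e22 e12 e21) eqxx in xy.
- by rewrite (block_meet P3 P1 P2 l13 (ltn_trans l21 l13) e31 e33 e12 e23) eqxx in xz.
- by rewrite (block_meet P2 P1 P3 l12 (ltn_trans l31 l12) e22 e23 e21 e33) eqxx in yz.
- by rewrite (block_meet P1 P3 P2 l31 l21 e12 e21 e31 e22) eqxx in xy.
- have l32 : rho B3 < rho B2 by rewrite -e13.
  rewrite -(inj _ _ P1 P3 e13) in e31 e33.
  by rewrite (block_meet P2 P1 P1 l12 l12 e22 e23 e21 e33) eqxx in yz.
- rewrite -(inj _ _ P1 P3 e13) in e33.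
  by rewrite (block_meet P1 P2 P2 l21 l21 e21 e33 e22 e23) eqxx in yz.
Qed.

End Decomposition.
End Blocks.

Section Inseparable.
Variables (G : sgraph) (B : {set {set G}}).
Hypothesis BG : B \subset edges G.
Hypothesis iB : inseparable B.

Lemma edge_graph_adj (x y : edge_graph B) : adj x y = ([set val x; val y] \in B).
Proof.
rewrite /= /edge_adj; case: eqVneq => //= ->; apply/esym/negP.
move/(subsetP BG)/edgesP=> [u [v [uv e]]].
have : u \in [set val y; val y] by rewrite e set21.
have : v \in [set val y; val y] by rewrite e set22.
by rewrite !inE !orbb => /eqP ev /eqP eu; rewrite ev eu adj_irrefl in uv.
Qed.

Lemma edge_graph_edge e : e \in B ->
  exists x y : edge_graph B, adj x y /\ e = [set val x; val y].
Proof.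
move=> eB; have /edgesP[u [v [_ ee]]] := subsetP BG e eB.
have uB : u \in cover B by apply/bigcupP; exists e; rewrite // ee set21.
have vB : v \in cover B by apply/bigcupP; exists e; rewrite // ee set22.
by exists (exist _ u uB), (exist _ v vB); rewrite edge_graph_adj /= -ee.
Qed.

(* Otherwise V would separate the edges meeting C from the other ones. *)
Lemma inseparable_closed (C : {set edge_graph B}) (V : {set edge_graph B}) :
  C != set0 -> [disjoint C & V] -> #|V| <= 1 ->
  (forall x y, adj x y -> x \in C -> (y \in C) || (y \in V)) ->
  forall x, (x \in C) || (x \in V).
Proof.
move=> /set0Pn[x0 x0C] CV V1 clC.
pose B1 := [set e in B | [exists x in C, val x \in e]].
have cB1 u : val u \in cover B1 -> (u \in C) || (u \in V).
  move=> /bigcupP[e]; rewrite inE => /andP[eB /exists_inP[x xC xe]] ue.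
  have [a [b [ab ee]]] := edge_graph_edge eB.
  move: xe ue; rewrite ee !inE !(inj_eq val_inj).
  move=> /orP[]/eqP ex /orP[]/eqP->; subst x; rewrite ?xC //; first exact: (clC a).
  by apply: (clC b); rewrite // adj_sym.
have cB2 u : val u \in cover (B :\: B1) -> u \notin C.
  move=> /bigcupP[e]; rewrite !inE => /andP[+ eB] ue; rewrite eB /=.
  by apply: contra => uC; apply/exists_inP; exists u.
have B1B : B1 \subset B by apply/subsetP=> e; rewrite inE => /andP[].
have B10 : B1 != set0.
  have /bigcupP[e eB xe] := valP x0; apply/set0Pn; exists e; rewrite inE eB.
  by apply/exists_inP; exists x0.
have eB1 : B1 = B.
  apply/eqP; apply: contraT => n; have := (proj2 iB) B1 B1B B10 n.
  rewrite ltnNge (leq_trans _ V1) // -(card_imset _ val_inj).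
  apply: subset_leq_card; apply/subsetP=> u; rewrite inE => /andP[u1 u2].
  have uB : u \in cover B by apply: (subsetP (cover_sub B1B)).
  have := cB1 (exist _ u uB) u1; rewrite (negPf (cB2 (exist _ u uB) u2)) /= => uV.
  by apply/imsetP; exists (exist _ u uB).
by move=> x; apply: cB1; rewrite eB1; apply: valP.
Qed.

Lemma inseparable_connected (x y : edge_graph B) : connect (@adj (edge_graph B)) x y.
Proof.
have := @inseparable_closed [set z | connect (@adj (edge_graph B)) x z] set0.
move=> /(_ _ _ _ _ y); rewrite !inE orbF; apply.
- by apply/set0Pn; exists x; rewrite inE.
- by rewrite disjoint_sym disjoints_subset sub0set.
- by rewrite cards0.
by move=> a b ab; rewrite !inE orbF => xa; apply: connect_trans xa (connect1 ab).
Qed.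

Lemma inseparable_biconnected : biconnected (edge_graph B).
Proof.
move=> v x y xv yv; set e := (fun _ _ => _).
have := @inseparable_closed [set z | connect e x z && (z != v)] [set v].
move=> /(_ _ _ _ _ y); rewrite !inE (negPf yv) orbF andbT; apply.
- by apply/set0Pn; exists x; rewrite inE connect0.
- by rewrite disjoint_sym disjoints_subset sub1set !inE eqxx andbF.
- by rewrite cards1.
move=> a b ab; rewrite !inE => /andP[xa av]; case: eqVneq => [->|bv]; first by rewrite
  orbT.
by rewrite orbF andbT; apply: connect_trans xa (connect1 _); rewrite /e ab av.
Qed.

End Inseparable.

(** * Counting cliques piecewise *)

Lemma no_cycle_ge_hom (F G : sgraph) (f : F -> G) k :
  (forall x y, adj x y -> adj (f x) (f y)) ->
  (forall p : seq F, is_cycle p -> {in p &, injective f}) ->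
  no_cycle_ge k G -> no_cycle_ge k F.
Proof.
move=> fa fi nG p cp; have := nG (map f p); rewrite size_map; apply.
move: (cp) => /and3P[p2 up ep]; rewrite /is_cycle size_map p2 map_inj_in_uniq ?up /=;
  last exact: fi.
case: p ep {cp p2 up} => //= x p; rewrite -map_rcons path_map.
by apply: sub_path => u v; apply: fa.
Qed.

Lemma num_cliques_edgeless (G : sgraph) t : 1 < t -> (forall x y : G, ~~ adj x y) ->
  num_cliques t G = 0.
Proof.
move=> t1 na; apply: eq_card0 => K; rewrite !inE; apply/negP=> /andP[/eqP cK /cliqueP q].
have [x xK] : exists x, x \in K by apply/card_gt0P; lia.
have [y] : exists y, y \in K :\ x by apply/card_gt0P; move: (cardsD1 x K); rewrite xK;
  lia.
by rewrite !inE => /andP[yx yK]; have := na y x; rewrite q.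
Qed.

Section Sum.
Variables (G : sgraph) (I : finType) (Q : pred I) (E : I -> {set {set G}}) (t : nat).
Hypothesis t1 : 1 < t.
Hypothesis EU : \bigcup_(i | Q i) E i = edges G.
Hypothesis Edis : forall i j, Q i -> Q j -> i != j -> [disjoint E i & E j].
Hypothesis Etri : forall i j (x y z : G), Q i -> Q j ->
  [set x; y] \in E i -> [set y; z] \in E j -> adj x z -> i = j.

(** By [Etri] two edges of a clique that share a vertex lie in the same E i. So all edges at one
    vertex of the clique do, and then all its edges. *)
Lemma num_cliques_sum :
  num_cliques t G = \sum_(i | Q i) num_cliques t (spanned (E i)).
Proof.
have Eadj i (x y : G) : Q i -> [set x; y] \in E i -> adj x y.
  by move=> qi e; rewrite -adj_edge -EU; apply/bigcupP; exists i.
have Ecl (x y : G) : adj x y -> exists2 i, Q i & [set x; y] \in E i.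
  by rewrite -adj_edge -EU => /bigcupP[i qi e]; exists i.
have Euniq i j (x y : G) : Q i -> Q j -> [set x; y] \in E i -> [set x; y] \in E j -> i
  = j.
  move=> qi qj ei ej; apply/eqP; apply: contraT => /(Edis qi qj)/pred0P/(_ [set x; y]).
  by rewrite /= ei ej.
have two (K : {set G}) : #|K| = t -> exists x y, [/\ x \in K, y \in K & x != y].
  move=> cK; have [x xK] : exists x, x \in K by apply/card_gt0P; lia.
  have [y] : exists y, y \in K :\ x by apply/card_gt0P; move: (cardsD1 x K); rewrite
    xK; lia.
  by rewrite !inE => /andP[yx yK]; exists y, x.
transitivity (\sum_(K : {set G}) \sum_(i | Q i) ((#|K| == t) && is_clique (G := spanned
  (E i)) K)).
  rewrite /num_cliques -sum1_card big_mkcond; apply: eq_bigr => K _.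
  rewrite !inE; case: eqP => [cK|_] /=; last by rewrite big1.
  have [x [y [xK yK xy]]] := two K cK.
  have clK i : Q i -> is_clique (G := spanned (E i)) K ->
      {in K &, forall u v, u != v -> [set u; v] \in E i}.
    by move=> qi /cliqueP q u v uK vK uv; case/andP: (q u v uK vK uv).
  case: (boolP (is_clique K)) => [/cliqueP q|nq].
    have [i qi exy] := Ecl _ _ (q x y xK yK xy).
    have xu u : u \in K -> u != x -> [set x; u] \in E i.
      move=> uK ux; have [->//|uy] := eqVneq u y.
      have [|j qj ej] := Ecl x u; first by rewrite q // eq_sym.
      suff -> : i = j by [].
      by apply: (@Etri i j y x u) => //; [rewrite setUC | rewrite q // eq_sym].
    have qK : is_clique (G := spanned (E i)) K.
      apply/cliqueP=> u v uK vK uv; rewrite /= /spanned_adj uv /=.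
      have [eu|ux] := eqVneq u x; first by rewrite eu xu // eq_sym -eu.
      have [ev|vx] := eqVneq v x; first by rewrite ev setUC xu.
      have [j qj ej] := Ecl _ _ (q u v uK vK uv).
      suff -> : i = j by [].
      by apply: (@Etri i j x u v) => //; [rewrite xu | rewrite q // eq_sym].
    rewrite (bigD1 i) //= qK big1 // => j /andP[qj ji].
    case: (boolP (is_clique _)) => // /(clK j qj) H.
    by rewrite (Euniq i j x y) ?eqxx // in ji; exact: H.
  rewrite big1 // => i qi; case: (boolP (is_clique _)) => // /(clK i qi) H.
  case/negP: nq; apply/cliqueP=> u v uK vK uv; exact: (Eadj i _ _ qi (H u v uK vK uv)).
rewrite exchange_big /=; apply: eq_bigr => i qi.
rewrite /num_cliques -sum1_card [RHS]big_mkcond; apply: eq_bigr => K _.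
by rewrite !inE; case: (_ && _).
Qed.

End Sum.

Lemma num_cliques_color (G : sgraph) (I : finType) (c : G -> I) t : 1 < t ->
  (forall x y, adj x y -> c x = c y) ->
  num_cliques t G = \sum_i num_cliques t (induced [set x | c x == i]).
Proof.
move=> t1 ca; pose E i := [set e in edges G | e \subset [set x | c x == i]].
have EP i (x y : G) : ([set x; y] \in E i) = [&& adj x y, c x == i & c y == i].
  by rewrite inE adj_edge subUset !sub1set !inE.
rewrite (@num_cliques_sum G I predT E) //.
- apply: eq_bigr => i _; apply/esym.
  refine (@num_cliques_embedding (@induced G _) (spanned (E i)) val t t1 _).
  split=> [||x]; first exact: val_inj.
    move=> [x xi] [y yi]; rewrite /= /spanned_adj EP /induced_adj /=.
    move: xi yi; rewrite !inE => -> ->; rewrite !andbT.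
    by case: eqVneq => // ->; rewrite adj_irrefl.
  rewrite inE => /existsP[y /andP[_]]; rewrite EP => /and3P[_ xi _].
  have xi' : x \in [set x | c x == i] by rewrite inE.
  by exists (exist _ x xi').
- apply/setP=> e; apply/bigcupP/idP => [[i _]|eG]; first by rewrite inE => /andP[].
  have /edgesP[x [y [xy ee]]] := eG; exists (c x) => //.
  by rewrite ee EP xy (ca x y xy) eqxx.
- move=> i j _ _ ij; apply/pred0P=> e /=; rewrite !inE -/(edges G).
  apply/negP=> /andP[/andP[/existsP[x /existsP[y /andP[_ /eqP ->]]]]].
  rewrite !subUset !sub1set !inE => /andP[/eqP-> _] /and3P[_ /eqP eij _].
  by rewrite eij eqxx in ij.
move=> i j x y z _ _; rewrite !EP => /and3P[_ _ /eqP <-] /and3P[_ /eqP <- _] _ //.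
Qed.

Lemma num_cliques_copies q (G : sgraph) t : 1 < t ->
  num_cliques t (copies q G) = q * num_cliques t G.
Proof.
move=> t1; rewrite (@num_cliques_color _ _ (fun u : copies q G => u.1)) //; last first.
  by move=> x y /andP[/eqP].
transitivity (\sum_(i < q) num_cliques t G); last by rewrite sum_nat_const card_ord.
apply: eq_bigr => i _.
have iP (x : G) : ((i, x) : copies q G) \in [set u : copies q G | u.1 == i] by rewrite
  inE.
pose f (x : G) : @induced (copies q G) [set u : copies q G | u.1 == i] :=
  exist _ ((i, x) : copies q G) (iP x).
apply/esym; refine (@num_cliques_embedding _ _ f t t1 _); split.
- by move=> x y [].
- by move=> x y; rewrite /= /induced_adj /= /copies_adj /= eqxx.
move=> [[j x] jx] _; have ej : j = i by move: jx; rewrite inE => /eqP.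
by exists x; apply: val_inj; rewrite /= ej.
Qed.

Lemma num_cliques_union (G H : sgraph) t : 1 < t ->
  num_cliques t (disjoint_union G H) = num_cliques t G + num_cliques t H.
Proof.
move=> t1; pose c (u : disjoint_union G H) := if u is inl _ then true else false.
rewrite (@num_cliques_color _ _ c) //; last by move=> [x|x] [y|y].
rewrite big_bool; congr (_ + _).
  have iP (x : G) : (inl x : disjoint_union G H) \in [set u | c u == true] by rewrite inE.
  pose f (x : G) : @induced (disjoint_union G H) [set u | c u == true] :=
    exist _ (inl x : disjoint_union G H) (iP x).
  apply/esym; refine (@num_cliques_embedding _ _ f t t1 _); split.
  - by move=> x y [].
  - by [].
  move=> [[x|x] jx] _; last by exfalso; move: jx; rewrite inE.
  by exists x; apply: val_inj.
have iP (x : H) : (inr x : disjoint_union G H) \in [set u | c u == false] by rewrite inE.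
pose f (x : H) : @induced (disjoint_union G H) [set u | c u == false] :=
  exist _ (inr x : disjoint_union G H) (iP x).
apply/esym; refine (@num_cliques_embedding _ _ f t t1 _); split.
- by move=> x y [].
- by [].
move=> [[x|x] jx] _; first by exfalso; move: jx; rewrite inE.
by exists x; apply: val_inj.
Qed.

Section Components.
Variable G : sgraph.
Let parts := equivalence_partition (connect (@adj G)) (non_isolated G).

Lemma adj_non_isolated (x y : G) : adj x y -> (x \in non_isolated G) && (y \in
  non_isolated G).
Proof.
move=> xy; rewrite !inE; apply/andP; split; apply/existsP; first by exists y.
by exists x; rewrite adj_sym.
Qed.

Lemma partsP C : reflect
  (exists2 x, x \in non_isolated G &
     C = [set y in non_isolated G | connect (@adj G) x y]) (C \in parts).
Proof. exact: imsetP. Qed.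

Lemma num_cliques_components t : 1 < t ->
  num_cliques t G = \sum_(F <- components G) num_cliques t F.
Proof.
move=> t1; rewrite /components big_map -/parts big_enum /=.
have cs : connect_sym (@adj G) by apply: sym_connect_sym; exact: adj_sym.
pose E (C : {set G}) := [set e in edges G | e \subset C].
have EP C (x y : G) : ([set x; y] \in E C) = [&& adj x y, x \in C & y \in C].
  by rewrite inE adj_edge subUset !sub1set.
have uniqC C C' x : C \in parts -> C' \in parts -> x \in C -> x \in C' -> C = C'.
  move=> /partsP[u _ ->] /partsP[v _ ->]; rewrite !inE => /andP[_ ux] /andP[_ vx].
  by apply/setP=> z; rewrite !inE (same_connect cs ux) (same_connect cs vx).
rewrite (@num_cliques_sum G {set G} (mem parts) E) //.
- apply: eq_bigr => C _; apply/esym.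
  refine (@num_cliques_embedding (@induced G C) (spanned (E C)) val t t1 _).
  split=> [||x]; first exact: val_inj.
    move=> [x xi] [y yi]; rewrite /= /spanned_adj EP /induced_adj /= xi yi !andbT.
    by case: eqVneq => // ->; rewrite adj_irrefl.
  rewrite inE => /existsP[y /andP[_]]; rewrite EP => /and3P[_ xi _].
  by exists (exist _ x xi).
- apply/setP=> e; apply/bigcupP/idP => [[i _]|eG]; first by rewrite inE => /andP[].
  have /edgesP[x [y [xy ee]]] := eG; have /andP[xN yN] := adj_non_isolated xy.
  exists [set y in non_isolated G | connect (@adj G) x y]; first by apply/partsP;
    exists x.
  by rewrite ee EP xy !inE connect0 connect1 // -!in_set -/(non_isolated G) ?andbT;
    move: xN yN; rewrite !inE => -> ->.
- move=> C C' CP CP' ij; apply/pred0P=> e /=; apply/negP=> /andP[eC eC'].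
  have /edgesP[x [y [xy ee]]] : e \in edges G by move: eC; rewrite inE => /andP[].
  move: eC eC'; rewrite ee !EP => /and3P[_ xC _] /and3P[_ xC' _].
  by rewrite (uniqC _ _ x CP CP' xC xC') eqxx in ij.
move=> C C' x y z CP CP'; rewrite !EP => /and3P[_ _ yC] /and3P[_ yC' _] _.
exact: (uniqC _ _ y).
Qed.

End Components.

Lemma num_cliques_forest (Fs : seq sgraph) (H : sgraph) t : 1 < t ->
  forest_of_connected Fs H -> num_cliques t H = \sum_(F <- Fs) num_cliques t F.
Proof.
move=> t1 [E [EU Edis Eeq Epair Eforest]].
have inc i (u v : H) : [set u; v] \in E i -> [/\ u != v, u \in cover (E i) & v \in
  cover (E i)].
  move=> e; split; try by apply/bigcupP; exists [set u; v]; rewrite ?set21 ?set22.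
  have : [set u; v] \in edges H by rewrite -EU; apply/bigcupP; exists i.
  by rewrite adj_edge; apply: contraTneq => ->; rewrite adj_irrefl.
rewrite (@num_cliques_sum H _ predT E) //.
- rewrite (big_nth (complete 0)) big_mkord; apply: eq_bigr => i _.
  rewrite -(num_cliques_equiv t1 (Eeq i)).
  exact/esym/(num_cliques_embedding t1 (embedding_edge_graph (E i))).
- by move=> i j _ _; apply: Edis.
move=> i j x y z _ _ exy eyz; rewrite -adj_edge -EU => /bigcupP[l _ exz].
have [xy xi yi] := inc _ _ _ exy; have [yz yj zj] := inc _ _ _ eyz.
have [xz xl zl] := inc _ _ _ exz.
have meet i1 i2 u v : i1 != i2 -> u \in cover (E i1) -> u \in cover (E i2) ->
    v \in cover (E i1) -> v \in cover (E i2) -> u = v.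
  move=> n u1 u2 v1 v2; apply: (card_le1_inj (Epair i1 i2 n)); rewrite inE.
    by rewrite u1.
  by rewrite v1.
apply/eqP; apply: contraT => ij.
have [eli|il] := eqVneq l i; first by rewrite eli in zl; rewrite (meet i j y z) ?eqxx
  in yz.
have [elj|jl] := eqVneq l j; first by rewrite elj in xl; rewrite (meet i j x y) ?eqxx
  in xy.
(* Three different sets around a triangle would give a cycle of length 6 in the incidence graph. *)
have := Eforest [:: inl i; inr y; inl j; inr z; inl l; inr x].
by rewrite /is_cycle /= !inE !(inj_eq inl_inj) !(inj_eq inr_inj) /= yi yj zj zl xl xi
   !andbT (negPf ij) eq_sym (negPf il) eq_sym (negPf yz) [y == x]eq_sym (negPf xy)
   [j == l]eq_sym (negPf jl) [z == x]eq_sym (negPf xz).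
Qed.

Lemma num_cliques_complete n t : num_cliques t (complete n) = 'C(n, t).
Proof.
rewrite num_cliquesE ncl_clique ?cardsT ?card_ord //.
by apply/cliqueP=> x y _ _.
Qed.

Lemma num_cliques_forest_family q n (L H : sgraph) t : 1 < t ->
  forest_family (nseq q (complete n) ++ [:: L]) H ->
  num_cliques t H = q * 'C(n, t) + num_cliques t L.
Proof.
move=> t1 /(num_cliques_forest t1) ->; rewrite big_flatten big_map.
under eq_bigr => F _ do rewrite -num_cliques_components //.
rewrite big_cat big_seq1 /= big_nseq iter_addn_0 num_cliques_complete.
by rewrite mulnC.
Qed.

Lemma no_cycle_ge_edge_graph (G : sgraph) (B : {set {set G}}) k :
  B \subset edges G -> no_cycle_ge k G -> no_cycle_ge k (edge_graph B).
Proof.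
move=> BG nG; refine (@no_cycle_ge_hom (edge_graph B) G val k _ _ nG); last first.
  by move=> p _ x y _ _ /val_inj.
move=> x y.
by rewrite edge_graph_adj // => e; rewrite -adj_edge; apply: (subsetP BG).
Qed.

Lemma card_spanned_edges (G : sgraph) (B : {set {set G}}) :
  B \subset edges G -> num_cliques 2 (spanned B) = #|B|.
Proof. by move=> BG; rewrite -card_edges edges_spanned. Qed.

Lemma block_bound (G : sgraph) (B : {set {set G}}) k t : 2 < t < k ->
  B \subset edges G -> inseparable B -> no_cycle_ge k G ->
  num_cliques t (spanned B) <= kextr t (k - 1) #|B| /\
  (num_cliques t (spanned B) = kextr t (k - 1) #|B| ->
   #|B| < 'C(k - 1, 2) \/
   [/\ #|B| = 'C(k - 1, 2), #|edge_graph B| = k - 1 &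
       is_clique [set: edge_graph B]]).
Proof.
move=> /andP[t2 tk] BG iB nG.
have t1 : 1 < t by apply: ltnW.
have eB := card_spanned_edges BG.
have emb := embedding_edge_graph B.
rewrite -(num_cliques_embedding t1 emb).
rewrite -(num_cliques_embedding (ltnSn 1) emb) in eB.
rewrite num_cliquesE in eB; rewrite num_cliquesE -eB.
have nB := no_cycle_ge_edge_graph BG nG.
case: (ltnP (ncl [set: edge_graph B] 2) 'C(k - 1, 2)) => Mm.
  by split; [rewrite kextr_small // kruskal_katona | left].
case: (ltnP #|edge_graph B| k) => nk; last first.
  have lt := @biconnected_bound (edge_graph B) k t ltac:(lia) nk
    (inseparable_biconnected BG iB) nB Mm.
  by split=> [|e]; [exact: ltnW | rewrite e ltnn in lt].
have nk' : #|edge_graph B| <= k - 1 by lia.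
have le2 := ncl_le_bin [set: edge_graph B] 2; rewrite cardsT in le2.
have := leq_bin2l 2 nk' => le3.
have em : ncl [set: edge_graph B] 2 = 'C(k - 1, 2) by lia.
have en : #|edge_graph B| = k - 1.
  apply/eqP; rewrite eqn_leq nk' leqNgt; apply/negP=> lt.
  have : #|edge_graph B| <= (k - 1).-1 by lia.
  move/(leq_bin2l 2); have := bin2S (k - 1).-1; rewrite prednK; lia.
have q : is_clique [set: edge_graph B].
  by apply: (@ncl_full _ _ 2); rewrite cardsT en //; lia.
rewrite em kextr_full; last by lia.
rewrite ncl_clique // cardsT en; split=> // _; right; split=> //.
Qed.

(* Up to isolated vertices, the colex graph with 'C(r, 2) + s edges. *)
Definition half_adj n r s : rel 'I_n := fun x y =>
  (x != y) && ((maxn x y < r) || ((maxn x y == r) && (minn x y < s))).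
Fact half_sym n r s : symmetric (@half_adj n r s).
Proof. by move=> x y; rewrite /half_adj eq_sym maxnC minnC. Qed.
Fact half_irrefl n r s : irreflexive (@half_adj n r s).
Proof. by move=> x; rewrite /half_adj eqxx. Qed.
Definition half_graph n r s : sgraph := SGraph (@half_sym n r s) (@half_irrefl n r s).

Lemma card_ord_lt n r : r <= n -> #|[set i : 'I_n | i < r]| = r.
Proof.
move=> rn; have winj : injective (widen_ord rn) by move=> i j /(congr1 val) /= /val_inj.
rewrite -[RHS]card_ord -(card_imset _ winj).
apply: eq_card => i; rewrite inE; apply/idP/imsetP => [ir|[j _ ->]]; last by rewrite /=
  ltn_ord.
by exists (Ordinal ir) => //; apply: val_inj.
Qed.

Lemma colex_lt_pair n (x y : 'I_n) (A : {set 'I_n}) : x < y ->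
  (#|A| == 2) && colex_lt A [set x; y] =
  ((A \subset [set i : 'I_n | i < y]) && (#|A| == 2)) ||
  (A \in [set [set u; y] | u : 'I_n in [set i : 'I_n | i < x]]).
Proof.
move=> xy; apply/idP/idP.
  move=> /andP[cA /exists_inP[z]]; rewrite !inE => /andP[zA /orP[]/eqP ez] /forall_inP
    H; subst z.
    apply/orP; right; have yA : y \in A.
      apply: contraT => yA; have := H y; rewrite !inE yA eqxx orbT => /(_ isT).
      by rewrite leqNgt xy.
    have : #|A :\ y| == 1 by move: cA; rewrite (cardsD1 y) yA.
    move=> /cards1P[u eu]; have : u \in A :\ y by rewrite eu set11.
    rewrite !inE => /andP[uy uA].
    have ux : u != x by apply: contraNneq zA => <-.
    apply/imsetP; exists u; last by rewrite -(setD1K yA) eu setUC.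
    have := H u; rewrite !inE uA (negPf ux) (negPf uy) => /(_ isT).
    by rewrite ltn_neqAle => ->; rewrite andbT.
  apply/orP; left; rewrite cA andbT; apply/subsetP=> a aA; rewrite inE.
  have ay : a != y by apply: contraNneq zA => <-.
  have [->//|ax] := eqVneq a x.
  by have := H a; rewrite !inE aA (negPf ax) (negPf ay) => /(_ isT); rewrite ltn_neqAle
    => ->; rewrite andbT.
have xny : x != y by apply: contraTneq xy => ->; rewrite ltnn.
case/orP=> [/andP[/subsetP As ->]|/imsetP[u]] /=.
  have yA : y \notin A by apply/negP=> /As; rewrite inE ltnn.
  apply/exists_inP; exists y; first by rewrite !inE yA eqxx orbT.
  apply/forall_inP=> z; rewrite !inE => /orP[/andP[_ /As]|/andP[_ /orP[]/eqP->]] //.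
    by rewrite inE => /ltnW.
  exact: ltnW.
rewrite inE => ux ->; have uy : u != y.
  by apply: contraTneq (ltn_trans ux xy) => ->; rewrite ltnn.
have unx : u != x by apply: contraTneq ux => ->; rewrite ltnn.
rewrite cards2 uy eqxx /=; apply/exists_inP; exists x.
  by rewrite !inE eqxx andbT negb_or eq_sym unx.
apply/forall_inP=> z; rewrite !inE.
case: (eqVneq z y) => [->|zy] /=; rewrite ?orbT ?andbF //= !orbF.
by case: (eqVneq z u) => [->|] /=; [rewrite ltnW | case: (eqVneq z x) => [->|]].
Qed.

Lemma card_colex_lt n (x y : 'I_n) : x < y ->
  #|[set A : {set 'I_n} | (#|A| == 2) && colex_lt A [set x; y]]| = 'C(y, 2) + x.
Proof.
move=> xy.
have -> : [set A : {set 'I_n} | (#|A| == 2) && colex_lt A [set x; y]] =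
  [set A : {set 'I_n} | (A \subset [set i : 'I_n | i < y]) && (#|A| == 2)] :|:
  [set [set u; y] | u : 'I_n in [set i : 'I_n | i < x]].
  by apply/setP=> A; rewrite !inE colex_lt_pair.
rewrite cardsU cards_draws card_ord_lt; last exact: ltnW.
rewrite card_in_imset; last first.
  move=> u v; rewrite !inE => ux vx e; have : u \in [set v; y] by rewrite -e set21.
  rewrite !inE => /orP[/eqP//|/eqP eu].
  by move: (ltn_trans ux xy); rewrite eu ltnn.
rewrite card_ord_lt; last by apply: ltnW.
rewrite (_ : _ :&: _ = set0) ?cards0 ?subn0 //.
apply/setP=> A; rewrite !inE; apply/negP=> /andP[/andP[/subsetP As _] /imsetP[u _ eA]].
by have := As y; rewrite eA set22 inE ltnn => /(_ isT).
Qed.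

(** By [card_colex_lt], ['C(y, 2) + x] pairs precede the pair x < y, and this is below
    ['C(r, 2) + s] exactly if y < r, or y = r and x < s. *)
Lemma colex_half m r s : m = 'C(r, 2) + s -> s < r ->
  isomorphic (colex_graph m) (half_graph m.+1 r s).
Proof.
move=> em sr; exists id; first by exists id.
move=> x y; wlog xy : x y / x <= y.
  move=> W; case: (leqP x y) => [|/ltnW] /W //.
  by rewrite [RHS]adj_sym => <-; rewrite adj_sym.
rewrite /= /half_adj /colex_adj; case: (eqVneq x y) => //= nxy.
have {}xy : x < y by rewrite ltn_neqAle nxy.
rewrite card_colex_lt // (maxn_idPr (ltnW xy)) (minn_idPl (ltnW xy)).
case: (ltngtP y r) => yr /=.
- by have := leq_bin2l 2 yr; rewrite bin2S; lia.
- by have := leq_bin2l 2 yr; rewrite bin2S; lia.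
by have := congr1 (binomial^~ 2) yr; rewrite /=; lia.
Qed.

Lemma isomorphic_num_cliques (F G : sgraph) t : 1 < t ->
  isomorphic F G -> num_cliques t F = num_cliques t G.
Proof.
move=> t1 [f [g fK gK] fa]; apply: (@num_cliques_embedding _ _ f) => //.
by split=> //; [exact: can_inj fK | move=> x _; exists (g x)].
Qed.

Lemma isomorphic_equiv (F G : sgraph) : isomorphic F G -> equiv_graph F G.
Proof.
move=> [f [g fK gK] fa]; apply: (@embedding_equiv _ _ f).
by split=> //; [exact: can_inj fK | move=> x _; exists (g x)].
Qed.

Lemma ncl_non_isolated (G : sgraph) (U : {set G}) t : 1 < t ->
  non_isolated G \subset U -> ncl [set: G] t = ncl U t.
Proof.
move=> t1 /subsetP sU; apply: eq_card => K; rewrite !inE subsetT /=.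
case: (boolP (#|K| == t)) => [/eqP cK|]; rewrite ?andbF //=.
case: (boolP (is_clique K)) => [/cliqueP q|]; rewrite ?andbF // andbT.
apply/esym/subsetP=> x xK; apply: sU; rewrite inE; apply/existsP.
have [y] : exists y, y \in K :\ x by apply/card_gt0P; move: (cardsD1 x K); rewrite xK;
  lia.
by rewrite !inE => /andP[yx yK]; exists y; apply: q; rewrite // eq_sym.
Qed.

Lemma num_cliques_half n r s t : 1 < t -> s < r -> r + (0 < s) <= n ->
  num_cliques t (half_graph n r s) = 'C(r, t) + 'C(s, t - 1).
Proof.
move=> t1 sr rn.
pose K := [set i : 'I_n | i < r] : {set half_graph n r s}.
have qK : is_clique K.
  apply/cliqueP=> x y; rewrite !inE => xr yr xy.
  by rewrite /= /half_adj xy gtn_max xr yr.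
have cK : #|K| = r by apply: card_ord_lt; lia.
rewrite num_cliquesE; case: (posnP s) => [s0|s0].
  rewrite (@ncl_non_isolated _ K) // ?ncl_clique // ?cK.
    by rewrite s0 bin0n; lia.
  apply/subsetP=> x; rewrite !inE => /existsP[y]; rewrite /= /half_adj s0 ltn0 andbF orbF.
  by rewrite gtn_max => /and3P[].
rewrite s0 addn1 in rn; pose v : half_graph n r s := Ordinal rn.
rewrite (@ncl_non_isolated _ (v |: K)) //; last first.
  apply/subsetP=> x; rewrite inE => /existsP[y]; rewrite /= /half_adj => /andP[_].
  rewrite !inE => /orP[|/andP[/eqP e _]]; first by rewrite gtn_max => /andP[->];
    rewrite orbT.
  have : x <= r by rewrite -e leq_maxl.
  by rewrite leq_eqVlt => /orP[/eqP ex|->]; rewrite ?orbT // -(inj_eq val_inj) /= ex eqxx.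
have vK : v \notin K by rewrite inE ltnn.
case: t t1 => // t t1; rewrite (@ncl_del _ v) ?setU11 // setU1K // ncl_clique // cK
  subn1 /=.
congr (_ + _).
have -> : nbrs v :&: (v |: K) = [set i : 'I_n | i < s] :> {set half_graph n r s}.
  apply/setP=> x; rewrite !inE /= /half_adj -!(inj_eq val_inj) /=.
  by clear -sr; apply/idP/idP; lia.
rewrite ncl_clique ?card_ord_lt //; try lia.
apply: sub_clique qK; apply/subsetP=> x; rewrite !inE; lia.
Qed.

Lemma num_cliques_colex t m : 1 < t -> num_cliques t (colex_graph m) = kcolex t m.
Proof.
move=> t1; have [e sr] := rowcolP m.
rewrite (isomorphic_num_cliques t1 (colex_half e sr)) num_cliques_half //.
set r := (rowcol m).1 in e sr *; set s := (rowcol m).2 in e sr *.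
rewrite e; case: r sr {e} => // r sr; rewrite bin2S; case: (posnP s) => s0; last by lia.
by case: r sr => // r _; rewrite bin2S; lia.
Qed.

(** * The extremal family *)

Lemma kcolex0 t : 1 < t -> kcolex t 0 = 0.
Proof. by move=> t1; have := @kcolex_bin t 0 t1; rewrite !bin0n => ->; lia. Qed.

(** Beyond the colex graph: for s < t - 1 the r-clique alone attains the bound, and for r < t the
    bound is 0. *)
Lemma C_family_num_cliques t k b L : 2 < t -> C_family t k b L ->
  num_cliques t L = kcolex t b.
Proof.
move=> t2; have t1 := ltnW t2.
have KK : #|edges L| = b -> num_cliques t L <= kcolex t b.
  by move=> <-; rewrite card_edges !num_cliquesE; apply: kruskal_katona.
case.
- move=> -> e0; rewrite kcolex0 // num_cliques_edgeless // => x y.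
  by rewrite -adj_edge e0 inE.
- by move=> r s _ _ _ _ /(num_cliques_equiv t1) ->; rewrite num_cliques_colex.
- move=> r s _ eb sr tr st [/(num_cliques_equiv t1) ->|[eL _ [K [cK qK]]]].
    by rewrite num_cliques_colex.
  apply/eqP; rewrite eqn_leq KK //= eb kcolexE //; try lia.
  rewrite [X in _ + X]bin_small // addn0 num_cliquesE -cK -(ncl_clique _ qK).
  by apply: ncl_mono; apply: subsetT.
move=> r s _ eb sr rt [/(num_cliques_equiv t1) ->|[eL _]].
  by rewrite num_cliques_colex.
have e0 : kcolex t b = 0 by rewrite eb kcolexE ?(bin_small rt) ?bin_small; lia.
by apply/eqP; rewrite e0 -leqn0 -e0 KK.
Qed.

Lemma embedding_widen n p r s : s < r -> r < n -> n <= p ->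
  exists f : half_graph n r s -> half_graph p r s, embedding f.
Proof.
move=> sr rn np; exists (widen_ord np); split.
- by move=> i j /(congr1 val) /= /val_inj.
- by move=> i j; rewrite /= /half_adj /= -!(inj_eq val_inj).
move=> x; rewrite inE => /existsP[y]; rewrite /= /half_adj => /andP[_ H].
have xn : x < n by move: H rn; clear; lia.
by exists (Ordinal xn); apply: val_inj.
Qed.

Lemma embedding_half (L : sgraph) (K : {set L}) (v : L) r s :
  #|K| = r -> is_clique K -> v \notin K -> #|nbrs v :&: K| = s -> s < r ->
  num_cliques 2 L = 'C(r, 2) + s ->
  exists f : half_graph r.+1 r s -> L, embedding f.
Proof.
move=> cK qK vK cN sr e2.
have eN : nbrs v :&: (v |: K) = nbrs v :&: K.
  by apply/setP=> x; rewrite !inE; case: eqVneq => //= ->; rewrite adj_irrefl.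
have ecl : cliques (v |: K) 2 = cliques [set: L] 2.
  apply/eqP; rewrite eqEcard; apply/andP; split.
    by apply/subsetP=> A; rewrite !inE subsetT => /andP[].
  rewrite -!/(ncl _ _) -num_cliquesE e2 (@ncl_del _ v) ?setU11 // setU1K // ncl_clique //.
  by rewrite cK eN ncl1 cN.
(* The neighbours of v come first, so being adjacent to v means having index below s. The default v
   of [nth] is the value at index r. *)
pose l := enum (nbrs v :&: K) ++ enum (K :\: nbrs v).
have sl : size l = r.
  by rewrite size_cat -!cardE setIC cardsID.
have ml x : (x \in l) = (x \in K).
  by rewrite mem_cat !mem_enum !inE; case: (adj v x); rewrite ?orbF.
have ul : uniq l.
  rewrite cat_uniq !enum_uniq /= andbT; apply/hasPn=> x; rewrite !mem_enum !inE.
  by case/andP=> /negPf->.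
have fK (i : 'I_r.+1) : i < r -> nth v l i \in K by move=> ir; rewrite -ml mem_nth ?sl.
have fr (i : 'I_r.+1) : r <= i -> nth v l i = v by move=> ri; rewrite nth_default ?sl.
have fN (i : 'I_r.+1) : i < r -> adj v (nth v l i) = (i < s).
  move=> ir; rewrite /l nth_cat -cardE cN; case: ltnP => is_.
    have : nth v (enum (nbrs v :&: K)) i \in nbrs v :&: K by rewrite -mem_enum mem_nth
      // -cardE cN.
    by rewrite !inE => /andP[].
  have : nth v (enum (K :\: nbrs v)) (i - s) \in K :\: nbrs v.
    rewrite -mem_enum mem_nth // -(ltn_add2l s) subnKC //.
    by rewrite -[in X in _ < X]cN cardE -size_cat -/l sl.
  by rewrite !inE => /andP[/negPf].
have fmax (i : 'I_r.+1) : r <= i -> i = r :> nat.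
  by move=> ri; apply/eqP; rewrite eqn_leq ri -ltnS ltn_ord.
have finj : injective (fun i : half_graph r.+1 r s => nth v l i).
  move=> i j; case: (ltnP i r) => ir; case: (ltnP j r) => jr.
  - by move=> /eqP; rewrite nth_uniq ?sl // => /eqP/val_inj.
  - by rewrite (fr j jr) => e; have := fK i ir; rewrite e (negPf vK).
  - by rewrite (fr i ir) => e; have := fK j jr; rewrite -e (negPf vK).
  by move=> _; apply: val_inj; rewrite /= (fmax i ir) (fmax j jr).
exists (fun i : half_graph r.+1 r s => nth v l i); split=> // [i j|x].
  rewrite /= /half_adj; case: (eqVneq i j) => [->|ij] /=; first by rewrite adj_irrefl.
  have nij : (i : nat) != j by rewrite (inj_eq val_inj).
  case: (ltnP i r) => ir; case: (ltnP j r) => jr.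
  - rewrite gtn_max ir jr /=; move/cliqueP: qK; apply; rewrite ?fK //.
    by rewrite (inj_eq finj).
  - rewrite (fr j jr) adj_sym fN // (fmax j jr) (maxn_idPr (ltnW ir)).
    by rewrite ltnn eqxx (minn_idPl (ltnW ir)).
  - rewrite (fr i ir) fN // (fmax i ir) (maxn_idPl (ltnW jr)).
    by rewrite ltnn eqxx (minn_idPr (ltnW jr)).
  by rewrite (fmax i ir) (fmax j jr) eqxx in nij.
rewrite inE => /existsP[y xy].
have : x \in v |: K.
  have : [set x; y] \in cliques [set: L] 2.
    have : [set x; y] \in edges L by rewrite adj_edge.
    move=> e; rewrite inE subsetT /=.
    have nxy : x != y by apply: contraTneq xy => ->; rewrite adj_irrefl.
    rewrite cards2 nxy; apply/cliqueP=> u w; rewrite !inE.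
    by move=> /orP[]/eqP-> /orP[]/eqP->; rewrite ?eqxx // adj_sym.
  by rewrite -ecl inE subUset !sub1set => /andP[/andP[]].
rewrite in_setU1 => /orP[/eqP->|xK].
  by exists ord_max; rewrite fr.
have xl : index x l < r.+1 by rewrite ltnW // ltnS -sl index_mem ml.
by exists (Ordinal xl); rewrite /= nth_index // ml.
Qed.

Lemma C_family_intro t k b L : 2 < t -> b <= 'C(k - 1, 2) -> #|edges L| = b ->
  no_cycle_ge k L -> num_cliques t L = kcolex t b -> C_family t k b L.
Proof.
move=> t2 bM eL nL nt; case: (posnP b) => [b0|b0].
  by apply: C_empty => //; apply/eqP; rewrite -cards_eq0 eL b0.
have [eb sr] := rowcolP b; move: (rowcol b).1 (rowcol b).2 eb sr => r s eb sr.
have bM' : 0 < b <= 'C(k - 1, 2) by rewrite b0.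
have e2 : ncl [set: L] 2 = 'C(r, 2) + s by rewrite -num_cliquesE -card_edges eL.
have nt' : num_cliques t L = 'C(r, t) + 'C(s, t - 1).
  by rewrite nt eb kcolexE //; lia.
have KK (tr : t <= r) := @kruskal_katona_eq L [set: L] t r s ltac:(lia) sr e2
  ltac:(rewrite -num_cliquesE nt'; lia).
case: (leqP (t - 1) s) => ts.
  have [K [_ cK qK]] := KK ltac:(lia).
  move=> /(_ ts)[v]; rewrite inE => /andP[vK _] cN.
  rewrite -num_cliquesE in e2.
  have [f ef] := embedding_half cK qK vK cN sr e2.
  have rb : r.+1 <= b.+1.
    by move: eb ts t2 sr; clear; case: r => // r; rewrite bin2S; case: s => //; lia.
  have [g eg] := embedding_widen sr (ltnSn r) rb.
  apply: (@C_colex t k b L r s) => //.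
  apply: equiv_graph_trans (equiv_graph_sym (embedding_equiv ef)) _.
  apply: equiv_graph_trans (embedding_equiv eg) _.
  exact/equiv_graph_sym/isomorphic_equiv/colex_half.
case: (leqP t r) => tr.
  apply: (@C_clique t k b L r s) => //; right; split=> //.
  by have [K [_ cK qK _]] := KK tr; exists K.
by apply: (@C_small t k b L r s) => //; right.
Qed.

(** * The union of the small blocks and its place in the forest *)

Section Piles.
Variables (G : sgraph) (R : {set {set {set G}}}).
Hypothesis RG : {in R, forall B : {set {set G}}, B \subset edges G}.
Hypothesis Ris : {in R, forall B : {set {set G}}, inseparable B}.

(* The vertex-disjoint union of the edge graphs of the members of R. *)
Let V : finType := ({set {set G}} * G)%type.
Definition piles_adj : rel V := fun u v =>
  [&& u.1 == v.1, u.1 \in R & spanned_adj u.1 u.2 v.2].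
Fact piles_sym : symmetric piles_adj.
Proof.
by move=> u v; rewrite /piles_adj eq_sym; case: eqVneq => //= ->; rewrite spanned_sym.
Qed.
Fact piles_irrefl : irreflexive piles_adj.
Proof. by move=> u; rewrite /piles_adj spanned_irrefl !andbF. Qed.
Definition piles : sgraph := SGraph piles_sym piles_irrefl.

Lemma num_cliques_piles t : 1 < t ->
  num_cliques t piles = \sum_(B in R) num_cliques t (spanned B).
Proof.
move=> t1; rewrite (@num_cliques_color _ _ (fun u : piles => u.1)) //; last first.
  by move=> u v /and3P[/eqP].
rewrite [RHS]big_mkcond; apply: eq_bigr => B _; case: ifP => BR; last first.
  apply: num_cliques_edgeless => // [[[B1 x] xB] [[B2 y] yB]].
  rewrite /= /induced_adj /= /piles_adj /=; move: (xB); rewrite inE /= => /eqP ->.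
  by rewrite BR andbF.
refine (@num_cliques_embedding (@induced piles _) (spanned B) (fun z => (val z).2) t t1
  _).
split.
- move=> [[B1 x] xB] [[B2 y] yB] /= exy; apply: val_inj => /=.
  by move: xB yB; rewrite !inE exy /= => /eqP-> /eqP->.
- move=> [[B1 x] xB] [[B2 y] yB]; rewrite /= /induced_adj /= /piles_adj /=.
  by move: xB yB; rewrite !inE /= => /eqP-> /eqP->; rewrite eqxx BR.
move=> x _; have xB : ((B, x) : piles) \in [set u : piles | u.1 == B] by rewrite inE.
by exists (exist _ ((B, x) : piles) xB).
Qed.

Lemma connect_piles_fst (u v : piles) : connect (@adj piles) u v -> u.1 = v.1.
Proof.
move=> uv; apply/eqP; have cl : closed (@adj piles) [pred w : piles | w.1 == v.1].
  by move=> a b /and3P[/eqP ab _ _]; rewrite !inE ab.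
by have := closed_connect cl uv; rewrite !inE eqxx.
Qed.

(** A cycle stays within one copy, on which the projection to G is injective. *)
Lemma no_cycle_ge_piles k : no_cycle_ge k G -> no_cycle_ge k piles.
Proof.
move=> nG; refine (@no_cycle_ge_hom piles G (fun u => u.2) k _ _ nG).
  move=> u v /and3P[_ uR /andP[_ e]]; rewrite -adj_edge.
  exact: (subsetP (RG uR)).
move=> p /and3P[_ _ cp] [B x] [B' y] xp yp /= exy.
by have := connect_piles_fst (connect_cycle cp xp yp) => /= ->; rewrite exy.
Qed.

Definition pile (B : {set {set G}}) : {set piles} :=
  [set u : piles | (u.1 == B) && (u.2 \in cover B)].

Lemma pile_equiv B : B \in R -> equiv_graph (edge_graph B) (induced (pile B)).
Proof.
move=> BR; apply: equiv_graph_trans (embedding_equiv (embedding_edge_graph B)) _.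
apply: equiv_graph_sym.
apply: (@embedding_equiv (induced (pile B)) (spanned B) (fun z => (val z).2)); split.
- move=> [[B1 x] xB] [[B2 y] yB] /= exy; apply: val_inj => /=.
  by move: xB yB; rewrite !inE exy /= => /andP[/eqP-> _] /andP[/eqP-> _].
- move=> [[B1 x] xB] [[B2 y] yB]; rewrite /= /induced_adj /= /piles_adj /=.
  by move: xB yB; rewrite !inE /= => /andP[/eqP-> _] /andP[/eqP-> _]; rewrite eqxx BR.
move=> x; rewrite inE => /existsP[y /andP[_ xy]].
have xB : ((B, x) : piles) \in pile B.
  by rewrite inE eqxx; apply/bigcupP; exists [set x; y]; rewrite ?set21.
by exists (exist _ ((B, x) : piles) xB).
Qed.

Lemma pile_neq0 B : B \in R -> exists x, ((B, x) : piles) \in pile B.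
Proof.
move=> BR; have [/set0Pn[e eB] _] := Ris BR.
have /edgesP[x [y [_ ee]]] := subsetP (RG BR) e eB.
by exists x; rewrite inE eqxx; apply/bigcupP; exists e; rewrite // ee set21.
Qed.

Lemma piles_non_isolated (u : piles) :
  (u \in non_isolated piles) = (u.1 \in R) && (u.2 \in cover u.1).
Proof.
case: u => B x /=; rewrite inE; apply/existsP/andP => [[[B' y]]|[BR /bigcupP[e eB xe]]].
  move=> /and3P[_ BR /andP[_ xy]]; split=> //.
  by apply/bigcupP; exists [set x; y]; rewrite ?set21.
have /edgesP[a [b [ab ee]]] := subsetP (RG BR) e eB.
have nab : a != b by apply: contraTneq ab => ->; rewrite adj_irrefl.
move: xe; rewrite ee !inE => /orP[]/eqP->.
  by exists (B, b); rewrite /= /piles_adj /= eqxx BR /spanned_adj nab -ee.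
by exists (B, a); rewrite /= /piles_adj /= eqxx BR /spanned_adj eq_sym nab setUC -ee.
Qed.

Lemma pile_component B x : B \in R -> x \in cover B ->
  pile B = [set u in non_isolated piles | connect (@adj piles) (B, x) u].
Proof.
move=> BR xB; apply/setP=> [[B' y]]; rewrite [LHS]in_set [RHS]in_set piles_non_isolated
  /=.
apply/andP/andP => [[/eqP-> yB]|[/andP[B'R yB'] /connect_piles_fst /= e]]; last first.
  by rewrite e eqxx.
split; first by rewrite BR.
have /connectP[p ep ey] := inseparable_connected (RG BR) (Ris BR) (exist _ x xB) (exist
  _ y yB).
apply/connectP; exists (map (fun z : edge_graph B => (B, val z) : piles) p).
  rewrite -[(B, x)]/((fun z : edge_graph B => (B, val z) : piles) (exist _ x xB))
    path_map.
  apply: sub_path ep => a b ab; rewrite /= /piles_adj /= eqxx BR /=.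
  by move: ab; rewrite /= /edge_adj /spanned_adj (inj_eq val_inj).
rewrite -[(B, x)]/((fun z : edge_graph B => (B, val z) : piles) (exist _ x xB))
  last_map -ey //.
Qed.

(** Inseparable edge sets are connected, so splitting [piles] into components, as [forest_family]
    does, gives back the blocks. *)
Lemma piles_components :
  equivalence_partition (connect (@adj piles)) (non_isolated piles) = pile @: R.
Proof.
apply/setP=> C; apply/partsP/imsetP => [[[B x]]|[B BR ->]].
  rewrite piles_non_isolated /= => /andP[BR xB] ->; exists B => //.
  by rewrite (pile_component BR xB).
have [x] := pile_neq0 BR; rewrite inE eqxx /= => xB.
by exists (B, x); rewrite ?piles_non_isolated ?BR //= (pile_component BR xB).
Qed.

Lemma pile_inj : {in R &, injective pile}.
Proof.
move=> B B' BR _ e; have [x] := pile_neq0 BR.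
by rewrite e inE => /andP[/eqP].
Qed.

End Piles.

Lemma eq_of_leq_sum (I : finType) (Q : pred I) (f g : I -> nat) :
  (forall i, Q i -> f i <= g i) -> \sum_(i | Q i) g i <= \sum_(i | Q i) f i ->
  forall i, Q i -> f i = g i.
Proof.
move=> le ge i qi; apply/eqP; rewrite eqn_leq le //= leqNgt; apply/negP=> lt.
move: ge; rewrite (bigD1 i qi) [X in _ <= X](bigD1 i qi) /= leqNgt => /negP[].
rewrite -addSn leq_add // leq_sum // => j /andP[qj _]; exact: le.
Qed.

Lemma components_complete n : 1 < n ->
  components (complete n) = [:: induced [set: complete n]].
Proof.
case: n => // n n1; rewrite /components.
have cn (x y : complete n.+1) : connect (@adj (complete n.+1)) x y.
  by have [->|xy] := eqVneq x y; [apply: connect0 | apply: connect1].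
have nN (x : complete n.+1) : x \in non_isolated (complete n.+1).
  have [y] : exists y : complete n.+1, y \in [set~ x].
    by apply/card_gt0P; rewrite cardsC1 card_ord.
  by rewrite !inE => yx; apply/existsP; exists y; rewrite /= /complete_adj eq_sym.
suff -> : equivalence_partition (connect (@adj (complete n.+1)))
    (non_isolated (complete n.+1)) = [set [set: complete n.+1]] by rewrite enum_set1.
have eT x : [set y in non_isolated (complete n.+1) | connect (@adj (complete n.+1)) x
  y] = [set: _].
  by apply/setP=> y; rewrite in_set cn nN in_setT.
apply/setP=> C; rewrite in_set1; apply/partsP/eqP => [[x _ ->]|->]; first by rewrite eT.
by exists ord0; rewrite ?eT.
Qed.

Lemma complete_block (G : sgraph) (B : {set {set G}}) n :
  #|edge_graph B| = n -> is_clique [set: edge_graph B] ->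
  equiv_graph (edge_graph B) (complete n).
Proof.
move=> en /cliqueP q; apply: equiv_graph_sym.
apply: (@embedding_equiv (complete n) _ (fun i => enum_val (cast_ord (esym en) i))).
have inj : injective (fun i : complete n => enum_val (cast_ord (esym en) i)).
  by move=> i j /enum_val_inj/cast_ord_inj.
split=> // [i j|x _].
  rewrite [RHS]/(i != j); case: (eqVneq i j) => [->|ij]; first by rewrite adj_irrefl.
  by apply: q; rewrite ?inE // (inj_eq inj).
by exists (cast_ord en (enum_rank x)); rewrite cast_ordK enum_rankK.
Qed.

Lemma forest_of_blocks (G : sgraph) (P : {set {set {set G}}}) rho (Fs : seq sgraph)
    (Bs : seq {set {set G}}) :
  block_decomposition (edges G) P rho -> uniq Bs -> Bs =i P -> size Bs = size Fs ->
  (forall i, i < size Fs -> equiv_graph (edge_graph (nth set0 Bs i)) (nth (complete 0)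
    Fs i)) ->
  forest_of_connected Fs G.
Proof.
move=> dec uB mB sB eB; have [/and3P[/eqP cP tP _] _ _ _] := dec.
pose E (i : 'I_(size Fs)) := nth set0 Bs i.
have EP i : E i \in P by rewrite -mB mem_nth // sB.
have Einj : injective E.
  by move=> i j /eqP; rewrite nth_uniq ?sB // => /eqP/val_inj.
have Eneq i j : i != j -> E i != E j by rewrite (inj_eq Einj).
exists E; split.
- apply/setP=> e; rewrite -cP; apply/bigcupP/bigcupP => [[i _ ei]|[B BP eBB]].
    by exists (E i).
  have iB : index B Bs < size Fs by rewrite -sB index_mem mB.
  by exists (Ordinal iB); rewrite // /E /= nth_index // mB.
- by move=> i j /Eneq; apply: (trivIsetP tP).
- by move=> i; apply: eB.
- by move=> i j /Eneq; apply: (block_pair dec).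
exact: (block_forest dec Einj EP).
Qed.

Section Extremal.
Variables (G : sgraph) (P : {set {set {set G}}}) (rho : {set {set G}} -> nat) (k q : nat).
Hypothesis dec : block_decomposition (edges G) P rho.
Hypothesis k1 : 2 < k.
Let R := [set B in P | #|B| < 'C(k - 1, 2)].
Hypothesis full : {in P :\: R, forall B : {set {set G}},
  #|edge_graph B| = k - 1 /\ is_clique [set: edge_graph B]}.
Hypothesis cardF : #|P :\: R| = q.

Lemma block_edges B : B \in P -> B \subset edges G.
Proof.
by case: dec => /and3P[/eqP <- _ _] _ _ _ BP; apply: (bigcup_sup B).
Qed.

Lemma extremal_forest_family :
  forest_family (nseq q (complete (k - 1)) ++ [:: piles R]) G.
Proof.
have RP B : B \in R -> B \in P by rewrite inE => /andP[].
have RG : {in R, forall B : {set {set G}}, B \subset edges G} by move=> B /RP/block_edges.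
have Ris : {in R, forall B : {set {set G}}, inseparable B}.
  by move=> B /RP; case: dec => _ + _ _; apply.
rewrite /forest_family map_cat flatten_cat /= cats0 map_nseq components_complete; last
  by lia.
have -> (T : Type) (x : T) : flatten (nseq q [:: x]) = nseq q x by elim: (q) => //= n ->.
rewrite /components piles_components //.
(* The components are enumerated as vertex sets of [piles], in an order of their own; [blk] recovers
   the blocks so that they can be listed in the same order. *)
pose blk C := odflt set0 [pick B in R | pile R B == C].
have blkP C : C \in pile R @: R -> blk C \in R /\ pile R (blk C) = C.
  rewrite /blk => /imsetP[B BR ->]; case: pickP => [B' /andP[B'R /eqP //]|/(_ B)].
  by rewrite BR eqxx.
apply: (@forest_of_blocks G P rho _ (enum (P :\: R) ++ map blk (enum (pile R @: R))) dec).
- rewrite cat_uniq enum_uniq map_inj_in_uniq ?enum_uniq ?andbT /=.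
    apply/hasPn=> B /mapP[C]; rewrite mem_enum => /blkP[bR _] ->.
    by rewrite mem_enum inE bR.
  move=> C C'; rewrite !mem_enum => /blkP[_ e] /blkP[_ e'] eb.
  by rewrite -e -e' eb.
- move=> B; rewrite mem_cat mem_enum in_setD; apply/orP/idP => [[/andP[]//|]|BP].
    by move=> /mapP[C]; rewrite mem_enum => /blkP[/RP + _] ->.
  case: (boolP (B \in R)) => BR; [right | by left].
  have CR : pile R B \in pile R @: R by apply: imset_f.
  apply/mapP; exists (pile R B); first by rewrite mem_enum.
  by have [bR e] := blkP _ CR; apply/esym/(pile_inj RG Ris bR BR e).
- by rewrite !size_cat !size_map size_nseq -cardE cardF.
move=> i; rewrite size_cat size_nseq size_map => lt_i.
rewrite !nth_cat size_nseq -cardE cardF; case: ltnP => iq.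
  have : nth set0 (enum (P :\: R)) i \in P :\: R.
    by rewrite -mem_enum mem_nth // -cardE cardF.
  move=> /full[e1 e2]; rewrite nth_nseq iq.
  apply: equiv_graph_trans (complete_block e1 e2) _.
  exact/equiv_graph_sym/embedding_equiv/embedding_val/subsetT.
have lt_iq : i - q < size (enum (pile R @: R)) by rewrite ltn_subLR.
rewrite !(nth_map set0) //.
have : nth set0 (enum (pile R @: R)) (i - q) \in pile R @: R by rewrite -mem_enum mem_nth.
move=> /blkP[bR e]; rewrite -{2}e; exact: pile_equiv.
Qed.

End Extremal.

Theorem theorem1p10 (t k m q b : nat) (G : sgraph)
  (ht : 3 <= t) (htk : t < k)
  (hm : m = q * 'C(k - 1, 2) + b) (hb : b < 'C(k - 1, 2))
  (hG : #|edges G| = m) (hcyc : no_cycle_ge k G) :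
  let extremal :=
    disjoint_union (copies q (complete (k - 1))) (colex_graph b) in
  num_cliques t G <= num_cliques t extremal /\
  (num_cliques t G = num_cliques t extremal <->
   exists L H : sgraph,
     [/\ C_family t k b L,
         forest_family (nseq q (complete (k - 1)) ++ [:: L]) H &
         equiv_graph G H]).
Proof.
move=> extremal; have t1 : 1 < t by apply: ltnW.
have ttk : 2 < t < k by rewrite ht.
have tK : 2 < t <= k - 1 by lia.
have eX : num_cliques t extremal = q * 'C(k - 1, t) + kcolex t b.
  by rewrite num_cliques_union // num_cliques_copies // num_cliques_complete
    num_cliques_colex.
have eM : kextr t (k - 1) m = num_cliques t extremal.
  by rewrite eX /kextr hm divnMDl ?(leq_ltn_trans _ hb) // modnMDl divn_small //
    modn_small // addn0.
have [P [rho dec]] := block_decomposition_exists (edges G).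
have [partP insP injP rP] := dec; have [/eqP cP tP P0] := and3P partP.
have BG B : B \in P -> B \subset edges G by apply: (block_edges dec).
have sumP : num_cliques t G = \sum_(B in P) num_cliques t (spanned B).
  apply: (@num_cliques_sum G _ (mem P) id t t1 cP) => [i j|i j x y z Pi Pj exy eyz xz].
    exact: (trivIsetP tP).
  have adjB B u v : B \in P -> [set u; v] \in B -> u != v.
    move=> /BG/subsetP BGs /BGs; rewrite adj_edge.
    by apply: contraTneq => ->; rewrite adj_irrefl.
  have : [set x; z] \in cover P by rewrite cP adj_edge.
  move=> /bigcupP[l Pl exz].
  exact: (block_triangle dec (adjB _ _ _ Pi exy) (adjB _ _ _ Pj eyz) (adjB _ _ _ Pl
    exz) Pi Pj Pl exy eyz exz).
have cardP : \sum_(B in P) #|B| = m by rewrite -hG; apply/esym/card_partition.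
have bound B : B \in P -> num_cliques t (spanned B) <= kextr t (k - 1) #|B| /\
    (num_cliques t (spanned B) = kextr t (k - 1) #|B| ->
     #|B| < 'C(k - 1, 2) \/
     [/\ #|B| = 'C(k - 1, 2), #|edge_graph B| = k - 1 & is_clique [set: edge_graph B]]).
  by move=> BP; apply: block_bound => //; [exact: BG | exact: insP].
have leS : \sum_(B in P) num_cliques t (spanned B) <= \sum_(B in P) kextr t (k - 1) #|B|.
  by apply: leq_sum => B /bound[].
have [leK eqK] := @kextr_sum t (k - 1) _ (enum P) (fun B => #|B|) tK.
rewrite !big_enum /= cardP in leK eqK.
have le : num_cliques t G <= num_cliques t extremal.
  by rewrite sumP -eM; apply: leq_trans leS leK.
split=> //; split=> [e|[L [H [LC HL GH]]]]; last first.
  rewrite (num_cliques_equiv t1 GH) (num_cliques_forest_family t1 HL) eX.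
  by rewrite (C_family_num_cliques ht LC).
rewrite -eM sumP in e.
have eS : \sum_(B in P) kextr t (k - 1) #|B| = kextr t (k - 1) m.
  by apply/eqP; rewrite eqn_leq leK -e leS.
(* Equality of the sums leaves no slack in any single block. *)
have eqB B : B \in P -> num_cliques t (spanned B) = kextr t (k - 1) #|B|.
  move: B; apply: (@eq_of_leq_sum _ (mem P) (fun B => num_cliques t (spanned B))
    (fun B => kextr t (k - 1) #|B|)) => [A /bound[]//|].
  by rewrite eS e.
have modP := eqK eS.
set M := 'C(k - 1, 2) in hm hb bound modP *.
pose R := [set B in P | #|B| < M].
have PR : P :&: R = R by apply/setIidPr/subsetP=> B; rewrite inE => /andP[].
have full B : B \in P :\: R -> [/\ #|B| = M, #|edge_graph B| = k - 1 & is_clique [set: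
  edge_graph B]].
  rewrite !inE => /andP[+ BP]; rewrite BP /= -leqNgt => MB.
  by have [_ /(_ (eqB B BP)) [|//]] := bound B BP; rewrite ltnNge MB.
have sumR : \sum_(B in R) #|B| = b.
  (* Full blocks have residue 0 and each small block is its own residue, so the absence of a carry
     gives the small blocks b edges in all. *)
  move: modP; rewrite hm modnMDl (modn_small hb) => <-.
  rewrite [RHS](big_setID R) PR /= [X in _ = _ + X]big1 ?addn0; last first.
    by move=> B /full[-> _ _]; rewrite modnn.
  by apply: eq_bigr => B; rewrite inE => /andP[_ lt]; rewrite modn_small.
have cardF : #|P :\: R| = q.
  move: cardP; rewrite (big_setID R) PR /= sumR hm addnC.
  have -> : \sum_(B in P :\: R) #|B| = #|P :\: R| * M.
    by rewrite -sum_nat_const; apply: eq_bigr => B /full[].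
  move/eqP; rewrite eqn_add2r eqn_pmul2r; first by move/eqP.
  exact: leq_ltn_trans hb.
have RG : {in R, forall B : {set {set G}}, B \subset edges G}.
  by move=> B; rewrite inE => /andP[/BG].
have eL : #|edges (piles R)| = b.
  rewrite card_edges num_cliques_piles // -sumR; apply: eq_bigr => B /RG.
  exact: card_spanned_edges.
have tL : num_cliques t (piles R) = kcolex t b.
  rewrite num_cliques_piles //; move: e; rewrite eM eX (big_setID R) PR /=.
  have -> : \sum_(B in P :\: R) num_cliques t (spanned B) = q * 'C(k - 1, t).
    rewrite -cardF -sum_nat_const; apply: eq_bigr => B BF.
    rewrite eqB; last by case/setDP: BF.
    by case: (full B BF) => -> _ _; rewrite kextr_full //; lia.
  by rewrite addnC => /addnI.
(* G itself is the member of the forest family; only L has to be built anew. *)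
exists (piles R), G; split; last exact: equiv_graph_refl.
  by apply: C_family_intro => //; [exact: ltnW | exact: no_cycle_ge_piles].
apply: (@extremal_forest_family G P rho) => //.
- by lia.
- by move=> B /full[].
Qed.
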